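(* Assume Assumption $(\ast)$: for all positive integers $a, f$ with $1\leq a\leq f$, $\gcd(a,f)=1$ and $4\mid f$, and every odd prime $g$ dividing $f$ such that $\left(\frac{g}{a}\right)=-1$, there exists a prime $\ell$ such that $\ell\equiv a \pmod f$ and $g$ is a primitive root modulo $\ell$. Then for any distinct odd primes $p,q,r$, one of which is congruent to $3$ or $5$ modulo $8$, there exist infinitely many primes $s$ such that, for each such $s$, there exist infinitely many quadruples $(a,b,c,d)$ of positive integers with $$pqrs \mid p^a+q^b+r^c+s^d.$$
   Context: $\left(\frac{\cdot}{\cdot}\right)$ denotes the Kronecker symbol. *)

(* Defs.v *)
From mathcomp Require Import all_boot all_order all_algebra.
From mathcomp Require Import classical_sets cardinality.
Set Implicit Arguments.
Unset Strict Implicit.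
Unset Printing Implicit Defensive.
Import Order.TTheory GRing.Theory Num.Theory.

(* Legendre symbol (a/p), meaningful for p an odd prime. *)
Definition legendre (a : int) (p : nat) : int :=
  (if (p %| a)%Z then 0
   else if [exists x : 'I_p, ((x : nat)%:Z ^+ 2 == a %[mod p])%Z] then 1
   else -1)%R.

Definition kronecker_at2 (a : int) : int :=
  (if (2 %| a)%Z then 0
   else if ((a %% 8)%Z == 1) || ((a %% 8)%Z == 7) then 1
   else -1)%R.

Definition kronecker_prime (a : int) (p : nat) : int :=
  if p == 2 then kronecker_at2 a else legendre a p.

(* The first factor of the last case is the value of the symbol at the sign
   of n. *)
Definition kronecker (a n : int) : int :=
  (if n == 0 then (if `|a| == 1 then 1 else 0)
   else (if (n < 0) && (a < 0) then -1 else 1)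
        * \prod_(p <- primes `|n|%N) kronecker_prime a p ^+ logn p `|n|%N)%R.

(* The class of g has multiplicative order totient n in Z/nZ; meaningful for
   1 < n, since 'Z_0 and 'Z_1 denote Z/2Z. *)
Definition primitive_root_mod (g n : nat) : bool :=
  ((totient n).-primitive_root (g%:R : 'Z_n))%R.

Definition assumption_star : Prop :=
  forall a f : nat,
    1 <= a <= f -> coprime a f -> 4 %| f ->
  forall g : nat,
    prime g -> odd g -> g %| f -> kronecker g%:Z a%:Z = (-1)%R ->
  exists l : nat,
    [/\ prime l, l = a %[mod f] & primitive_root_mod g l].

(* Main.v *)
Require Import Defs.
From HB Require Import structures.
From mathcomp Require Import all_boot all_order all_fingroup all_solvable all_algebra all_field all_character.
From mathcomp Require Import complex.
From mathcomp Require Import boolp classical_sets cardinality reals exp Rstruct.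
From mathcomp Require Import zify ring lra.
Set Implicit Arguments.
Unset Strict Implicit.
Unset Printing Implicit Defensive.
Import Order.TTheory GRing.Theory Num.Theory.
Local Open Scope ring_scope.

(** The theorem holds because primes s can be found modulo which q and r have no cube
    roots. Let D = (p - 1) (q - 1) (r - 1), let 3^K be the power of 3 in D, and name the
    primes so that q and r differ from 3. Suppose that s is 1 modulo 3^(K+1), that s is
    -2 modulo p, q and r, and that q and r are not cubes modulo s. Then multiples b, c
    of D can be chosen with q^b and r^c the two primitive cube roots of unity modulo s,
    so p^a + q^b + r^c + s^d is 1 + w + w^2 = 0 modulo s for a = D (s - 1). Modulo p, q
    or r one of the first three terms vanishes, the other two are 1, and s^d = s = -2 as
    soon as d = 1 modulo D. The freedom in d gives infinitely many quadruples
    ([quadruples_away_from_3], [exists_quadruples]).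

    The existence of such s ([primes_with_cubic_nonresidues]) is a Dirichlet theorem for
    the Eisenstein integers Z[w]. For a prime s = 1 modulo 3, minus the Jacobi sum of
    the cubic character of F_s is a primary prime pi of Z[w] above s ([jac_primary],
    [jacobi_norm]), and raising the Gauss sum to the power q^2 shows that the cubic
    character of q modulo s is that of pi modulo q ([jacobi_expr], [jacobi_exists]).
    Thus the condition that q and r be noncubes modulo s concerns only the residue of pi
    modulo q r, and can be detected by the characters psi(N(x)) psi_q(x)^i psi_r(x)^j,
    where psi runs over Dirichlet characters and psi_q, psi_r are the cubic residue
    characters.

    Each of these characters, other than the trivial one, must be shown to have bounded
    sums of chi(pi) lg p / p. The proof follows Mertens and Shapiro and uses finite sums
    only. If a Dirichlet series has an Euler product and coefficient sums O(sqrt x), the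
    sums of its logarithmic derivative are either bounded or follow - lg x, according to
    whether its value at 1 is nonzero ([dichotomy]). For characters of Z[w] the
    coefficient sums are sums over discs, which are small because a shift by a period
    moves only boundary points ([disc_sum_bound]), and the Euler product is obtained by
    dividing by one prime element at a time ([rep_multf]). Vanishing at 1 is excluded by
    3-4-1 when i or j is not 0: these characters have nontrivial squares, and half of
    the primes are inert ([hecke_bounded]). The characters with i = j = 0 are Dirichlet
    characters; among them the quadratic ones need the separate argument of
    [real_nonvanishing]. *)

(** * Multiplicative functions and Dirichlet convolution *)

(** Multiplicative functions are determined by one prime at a time, so identities
    between them reduce to adjoining a new prime power to a coprime argument. *)
Lemma prime_power_ind (P : nat -> Prop) :
  P 1%N ->
  (forall p k m, prime p -> (0 < k)%N -> (0 < m)%N -> coprime p m -> P m ->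
     P (p ^ k * m)%N) ->
  forall n, (0 < n)%N -> P n.
Proof.
move=> P1 PM n; elim/ltn_ind: n => n IHn n_gt0.
have [n1|n_gt1] := leqP n 1; first by have -> : n = 1%N by lia.
have p_pr := pdiv_prime n_gt1.
have [m co_pm En] := pfactor_coprime p_pr n_gt0.
have k_gt0 : (0 < logn (pdiv n) n)%N by rewrite logn_gt0 mem_primes p_pr n_gt0 pdiv_dvd.
have m_gt0 : (0 < m)%N by case: (posnP m) En => // -> ; lia.
rewrite En mulnC; apply: PM => //; apply: IHn => //.
move: En (ltn_expl (logn (pdiv n) n) (prime_gt1 p_pr)).
by move: (_ ^ _)%N => y En; nia.
Qed.

Lemma perm_divisors_pfactor p k m :
  prime p -> (0 < m)%N -> coprime p m ->
  perm_eq (divisors (p ^ k * m))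
          [seq (p ^ i * e)%N | i <- iota 0 k.+1, e <- divisors m].
Proof.
move=> p_pr m_gt0 co_pm; have p_gt0 := prime_gt0 p_pr.
have coE e i : (e %| m)%N -> logn p (p ^ i * e) = i.
  move=> dv; have e_gt0 := dvdn_gt0 m_gt0 dv.
  by rewrite mulnC logn_Gauss ?pfactorK // (coprime_dvdr dv).
apply: uniq_perm; first exact: divisors_uniq.
  apply: allpairs_uniq; rewrite ?iota_uniq ?divisors_uniq //.
  move=> [i e] [j f] /allpairsPdep[i' [e' [_ He [-> ->]]]].
  move=> /allpairsPdep[j' [f' [_ Hf [-> ->]]]] /= E.
  rewrite -dvdn_divisors // in He; rewrite -dvdn_divisors // in Hf.
  have Eij : i' = j' by rewrite -(coE _ i' He) E coE.
  by move: E; rewrite Eij => /eqP; rewrite eqn_pmul2l ?expn_gt0 ?p_gt0 // => /eqP ->.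
move=> d; rewrite -dvdn_divisors ?muln_gt0 ?expn_gt0 ?p_gt0 //.
apply/idP/allpairsPdep => [dv | [i [e [Hi He ->]]]]; last first.
  rewrite -dvdn_divisors // in He; rewrite mem_iota /= in Hi.
  by apply: dvdn_mul => //; apply: dvdn_exp2l; lia.
have n_gt0 : (0 < p ^ k * m)%N by rewrite muln_gt0 expn_gt0 p_gt0.
have d_gt0 := dvdn_gt0 n_gt0 dv.
have [e co_pe Ed] := pfactor_coprime p_pr d_gt0.
exists (logn p d), e; split; last by rewrite mulnC.
  rewrite mem_iota /= add0n ltnS -(pfactorK k p_pr) -(logn_Gauss (p^k) co_pm) mulnC.
  exact: dvdn_leq_log.
rewrite -dvdn_divisors // -(@Gauss_dvdr _ (p ^ k)); last by rewrite coprimeXr // coprime_sym.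
by apply: dvdn_trans dv; rewrite [X in (_ %| X)%N]Ed dvdn_mulr.
Qed.

Section ArithmeticFunctions.
Variable C : comNzRingType.
Implicit Types (f g h : nat -> C) (loc : nat -> nat -> C).

Lemma divisors_pfactor_sum (F : nat -> C) p k m :
  prime p -> (0 < m)%N -> coprime p m ->
  \sum_(d <- divisors (p ^ k * m)) F d =
  \sum_(i < k.+1) \sum_(e <- divisors m) F (p ^ i * e)%N.
Proof.
move=> p_pr m_gt0 co_pm.
rewrite (perm_big _ (perm_divisors_pfactor k p_pr m_gt0 co_pm)).
by rewrite big_allpairs_dep -[iota 0 k.+1]/(index_iota 0 k.+1) big_mkord.
Qed.

Lemma divisors_sum_range (F : nat -> C) n x : (0 < n <= x)%N ->
  \sum_(d <- divisors n) F d = \sum_(1 <= d < x.+1 | (d %| n)%N) F d.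
Proof.
move=> /andP[n_gt0 le_nx]; rewrite -[RHS]big_filter; apply: perm_big.
apply: uniq_perm; rewrite ?divisors_uniq ?filter_uniq ?iota_uniq //.
move=> d; rewrite mem_filter -dvdn_divisors // mem_index_iota.
case: (boolP ((d %| n)%N)) => //= dv; have := dvdn_leq n_gt0 dv.
have := dvdn_gt0 n_gt0 dv; lia.
Qed.

(** Both sides run over the lattice points under the hyperbola d e = x. *)
Lemma divisors_sum_exchange (G : nat -> nat -> C) x :
  \sum_(1 <= n < x.+1) \sum_(d <- divisors n) G d (n %/ d)%N =
  \sum_(1 <= d < x.+1) \sum_(1 <= e < (x %/ d).+1) G d e.
Proof.
under eq_big_nat => n Hn.
  rewrite (@divisors_sum_range (fun d => G d (n %/ d)%N) n x); last by lia.
  over.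
rewrite (exchange_big_dep xpredT) //=; apply: eq_big_nat => d /andP[d_gt0 d_le].
rewrite -[LHS]big_filter.
have -> : \sum_(1 <= e < (x %/ d).+1) G d e =
   \sum_(n <- [seq (d * e)%N | e <- index_iota 1 (x %/ d).+1]) G d (n %/ d)%N.
  by rewrite big_map; apply: eq_bigr => e _; rewrite mulKn.
apply: perm_big; apply: uniq_perm; rewrite ?filter_uniq ?iota_uniq //.
  rewrite map_inj_uniq ?iota_uniq // => e f /eqP.
  by rewrite eqn_pmul2l // => /eqP.
move=> n; rewrite mem_filter mem_index_iota; apply/idP/mapP.
  move=> /and3P[/dvdnP[e ->] H1 H2]; exists e; last by rewrite mulnC.
  by rewrite mem_index_iota ltnS leq_divRL //; apply/andP; split; lia.
move=> [e]; rewrite mem_index_iota ltnS leq_divRL // => /andP[e1 e2] ->.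
by rewrite dvdn_mulr //=; apply/andP; split; nia.
Qed.

(** Coefficients of the Dirichlet series with Euler factors
    sum_k [loc p k] p^(-k s). *)
Definition multf loc n := \prod_(p <- primes n) loc p (logn p n).

Lemma multf1 loc : multf loc 1 = 1.
Proof. by rewrite /multf big_nil. Qed.

Lemma multf_pfactor loc p k m : (forall p, loc p 0%N = 1) ->
  prime p -> (0 < m)%N -> coprime p m ->
  multf loc (p ^ k * m) = loc p k * multf loc m.
Proof.
move=> loc0 p_pr m_gt0 co_pm.
have [->|k_gt0] := posnP k; first by rewrite expn0 mul1n loc0 mul1r.
have p_gt0 := prime_gt0 p_pr.
have n_gt0 : (0 < p ^ k * m)%N by rewrite muln_gt0 expn_gt0 p_gt0.
have pNm : p \notin primes m.
  by rewrite mem_primes p_pr m_gt0 /= -prime_coprime.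
rewrite /multf [LHS](perm_big (p :: primes m)) /=; last first.
  apply: uniq_perm; rewrite ?primes_uniq //= ?primes_uniq ?pNm //.
  move=> s; rewrite primesM ?expn_gt0 ?p_gt0 // primesX // primes_prime //.
  by rewrite !inE.
rewrite big_cons mulnC logn_Gauss // pfactorK //; congr (_ * _).
apply: eq_big_seq => s Hs; rewrite mulnC logn_Gauss //.
have s_pr : prime s by move: Hs; rewrite mem_primes => /andP[].
rewrite coprimeXr // prime_coprime // dvdn_prime2 //.
by apply: contraNneq pNm => <-.
Qed.

Definition conv f g n := \sum_(d <- divisors n) f d * g (n %/ d)%N.

(** The divisors of p^k m are the products of a divisor of p^k and one of m. *)
Lemma conv_pfactor f g p k m (f1 : nat -> C) (f2 g2 : nat -> C):
  prime p -> (0 < m)%N -> coprime p m ->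
  (forall i e, (e %| m)%N -> f (p ^ i * e)%N = f1 i * f2 e) ->
  (forall i e, (e %| m)%N -> g (p ^ i * e)%N = g2 i * g e) ->
  conv f g (p ^ k * m) =
  (\sum_(i < k.+1) f1 i * g2 (k - i)%N) * \sum_(e <- divisors m) f2 e * g (m %/ e)%N.
Proof.
move=> p_pr m_gt0 co_pm Hf Hg; rewrite /conv divisors_pfactor_sum // big_distrl /=.
apply: eq_bigr => i _; rewrite big_distrr /=; apply: eq_big_seq => e.
rewrite -dvdn_divisors // => dv; rewrite Hf //.
have p_gt0 := prime_gt0 p_pr; have e_gt0 := dvdn_gt0 m_gt0 dv.
have -> : (p ^ k * m %/ (p ^ i * e) = p ^ (k - i) * (m %/ e))%N.
  rewrite -{1}(subnK (ltnSE (ltn_ord i))) expnD -{1}(divnK dv) [(_ * p ^ i)%N]mulnC.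
  rewrite mulnA [X in (X %/ _)%N](_ : _ = (p ^ i * e * (p ^ (k - i) * (m %/ e)))%N); last by lia.
  by rewrite mulKn // muln_gt0 expn_gt0 p_gt0.
rewrite Hg; first by ring.
by rewrite -{2}(divnK dv) dvdn_mulr.
Qed.

(** Products of Dirichlet series with Euler products are formed factor by factor. *)
Lemma conv_multf la lb lc :
  (forall p, la p 0%N = 1) -> (forall p, lb p 0%N = 1) -> (forall p, lc p 0%N = 1) ->
  (forall p k, prime p -> \sum_(i < k.+1) la p i * lb p (k - i)%N = lc p k) ->
  forall n, (0 < n)%N -> conv (multf la) (multf lb) n = multf lc n.
Proof.
move=> la0 lb0 lc0 H; apply: prime_power_ind.
  by rewrite /conv big_seq1 /= !multf1 mul1r.
move=> p k m p_pr k_gt0 m_gt0 co_pm IHm.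
have cop e : (e %| m)%N -> coprime p e by move=> dv; apply: coprime_dvdr dv co_pm.
rewrite (@conv_pfactor _ _ p k m (la p) (multf la) (lb p)) //; first last.
- by move=> i e dv; rewrite multf_pfactor ?cop //; apply: dvdn_gt0 dv.
- by move=> i e dv; rewrite multf_pfactor ?cop //; apply: dvdn_gt0 dv.
by rewrite H // -/(conv _ _ _) IHm multf_pfactor.
Qed.

Lemma eq_multf la lb : (forall p k, prime p -> (0 < k)%N -> la p k = lb p k) ->
  forall n, multf la n = multf lb n.
Proof.
move=> H n; apply: eq_big_seq => p Hp; apply: H; last by rewrite logn_gt0.
by move: Hp; rewrite mem_primes => /and3P[].
Qed.

(** The identity for [conv]. *)
Definition deltaf (n : nat) : C := (n == 1%N)%:R.

Lemma multf_delta n : (0 < n)%N -> multf (fun _ k => (k == 0%N)%:R) n = deltaf n.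
Proof.
move: n; apply: prime_power_ind => [|p k m p_pr k_gt0 m_gt0 co_pm _].
  by rewrite multf1 /deltaf eqxx.
rewrite multf_pfactor // eqn0Ngt k_gt0 mul0r /deltaf.
suff -> : (p ^ k * m == 1)%N = false by [].
apply/negP => /eqP; have := ltn_expl k (prime_gt1 p_pr); nia.
Qed.

(** Von Mangoldt type functions: coefficients of logarithmic derivatives of Euler
    products. *)
Definition ppf (l : nat -> nat -> C) n : C :=
  if primes n is [:: p] then l p (logn p n) else 0.

Lemma ppf1 l : ppf l 1 = 0. Proof. by []. Qed.

Lemma ppf_pfactor l p k : prime p -> (0 < k)%N -> ppf l (p ^ k) = l p k.
Proof.
by move=> p_pr k_gt0; rewrite /ppf primesX // primes_prime // pfactorK.
Qed.

Lemma ppf_prime l p : prime p -> ppf l p = l p 1%N.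
Proof. by move=> p_pr; rewrite -{1}[p]expn1 ppf_pfactor. Qed.

Lemma ppf_coprime l p k m : prime p -> (0 < k)%N -> (1 < m)%N -> coprime p m ->
  ppf l (p ^ k * m) = 0.
Proof.
move=> p_pr k_gt0 m_gt1 co_pm; rewrite /ppf.
have p_gt0 := prime_gt0 p_pr.
have Hs s : s \in primes (p ^ k * m) = (s == p) || (s \in primes m).
  have m_gt0 := ltnW m_gt1.
  by rewrite primesM ?expn_gt0 ?p_gt0 // primesX // primes_prime // inE.
case E: (primes (p ^ k * m)) Hs (primes_uniq (p ^ k * m)) => [|s [|t r]] //= Hs _.
have := Hs p; rewrite eqxx /= inE => /eqP Ep.
have /esym := Hs (pdiv m); rewrite mem_primes pdiv_prime // pdiv_dvd (ltnW m_gt1) orbT.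
rewrite inE -Ep => /esym/eqP E'; move: co_pm; rewrite prime_coprime // -E'.
by rewrite pdiv_dvd.
Qed.

(** The derivation f -> f lg satisfies the Leibniz rule for [conv], hence the
    identity lam * f = f lg between an Euler product and its logarithmic derivative
    can be checked on Euler factors; off prime powers lam contributes nothing, which
    leaves in each divisor sum only the powers of p and the divisors of m. *)
Lemma conv_ppf_multf (lg : nat -> C) l la :
  (forall m n, (0 < m)%N -> (0 < n)%N -> lg (m * n)%N = lg m + lg n) ->
  (forall p, la p 0%N = 1) ->
  (forall p k, prime p ->
     \sum_(i < k) l p i.+1 * la p (k - i.+1)%N = la p k *+ k * lg p) ->
  forall n, (0 < n)%N -> conv (ppf l) (multf la) n = multf la n * lg n.
Proof.
move=> lgM la0 H.
have lg1 : lg 1%N = 0 by have /eqP := lgM 1%N 1%N isT isT; rewrite -subr_eq subrr eq_sym => /eqP.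
have lgX p k : (0 < p)%N -> lg (p ^ k)%N = lg p *+ k.
  move=> p_gt0; elim: k => [|k IHk]; first by rewrite expn0 mulr0n.
  by rewrite expnS lgM ?expn_gt0 ?p_gt0 // IHk mulrS.
apply: prime_power_ind.
  by rewrite /conv big_seq1 ppf1 mul0r lg1 mulr0.
move=> p k m p_pr k_gt0 m_gt0 co_pm IHm; have p_gt0 := prime_gt0 p_pr.
have cop e : (e %| m)%N -> coprime p e by move=> dv; apply: coprime_dvdr dv co_pm.
rewrite /conv divisors_pfactor_sum // big_ord_recl /=.
have -> : \sum_(e <- divisors m) ppf l (p ^ 0 * e) * multf la (p ^ k * m %/ (p ^ 0 * e))
   = la p k * (multf la m * lg m).
  rewrite -IHm /conv big_distrr /=; apply: eq_big_seq => e.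
  rewrite -dvdn_divisors // => dv; rewrite expn0 mul1n -muln_divA // multf_pfactor //.
  - by ring.
  - by rewrite divn_gt0 ?(dvdn_gt0 _ dv) // dvdn_leq.
  - by apply: cop; rewrite -{2}(divnK dv) dvdn_mulr.
rewrite multf_pfactor // lgM ?expn_gt0 ?p_gt0 // lgX //.
have -> : la p k * multf la m * (lg p *+ k + lg m) =
   (la p k *+ k * lg p) * multf la m + la p k * (multf la m * lg m).
  by rewrite mulrDr mulrnAr !mulrnAl; congr (_ *+ _ + _); ring.
rewrite addrC; congr (_ + _); rewrite -H // big_distrl /=.
apply: eq_bigr => i _.
rewrite (big_rem 1%N) /=; last by rewrite divisor1.
rewrite muln1 ppf_pfactor // [X in _ + X]big_seq big1 => [|e].
  rewrite addr0 /bump /= add1n.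
  have -> : (p ^ k * m %/ p ^ i.+1 = p ^ (k - i.+1) * m)%N.
    by rewrite -{1}(subnK (ltn_ord i)) expnD mulnAC mulnK // expn_gt0 p_gt0.
  by rewrite multf_pfactor // mulrA.
rewrite mem_rem_uniq ?divisors_uniq // inE -dvdn_divisors // => /andP[e1 dv].
by rewrite ppf_coprime ?mul0r ?cop //; have := dvdn_gt0 m_gt0 dv; lia.
Qed.

End ArithmeticFunctions.

(** * Absolute values and fourth roots *)

Section Norm.
Variable R : rcfType.
Implicit Types z : R[i].

(** The modulus as an element of R: the norm of R[i] lives in R[i] itself, where
    inequalities are only a partial order. *)
Definition nrm z : R := Normc.normc z.
Arguments nrm : simpl never.

Lemma nrm_ge0 z : 0 <= nrm z.
Proof. by case: z => a b; exact: sqrtr_ge0. Qed.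
Lemma nrmM z1 z2 : nrm (z1 * z2) = nrm z1 * nrm z2.
Proof. exact: Normc.normcM. Qed.
Lemma nrmD z1 z2 : nrm (z1 + z2) <= nrm z1 + nrm z2.
Proof. exact: le_normcD. Qed.
Lemma nrmN z : nrm (- z) = nrm z.
Proof. exact: normcN. Qed.
Lemma nrm0 : nrm 0 = 0.
Proof. exact: Normc.normc0. Qed.
Lemma nrm1 : nrm 1 = 1.
Proof. exact: Normc.normc1. Qed.
Lemma nrmV z : nrm z^-1 = (nrm z)^-1.
Proof. exact: Normc.normcV. Qed.
Lemma nrmB z1 z2 : nrm (z1 - z2) <= nrm z1 + nrm z2.
Proof. by rewrite -(nrmN z2) nrmD. Qed.
Lemma nrmBC z1 z2 : nrm (z1 - z2) = nrm (z2 - z1).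
Proof. by rewrite -nrmN opprB. Qed.
Lemma nrmX z n : nrm (z ^+ n) = nrm z ^+ n.
Proof. by elim: n => [|n IH]; rewrite ?expr0 ?nrm1 // !exprS nrmM IH. Qed.
Lemma nrm_eq0 z : (nrm z == 0) = (z == 0).
Proof. by apply/eqP/eqP => [/Normc.eq0_normc|->]; rewrite ?nrm0. Qed.
Lemma nrm_gt0 z : (0 < nrm z) = (z != 0).
Proof. by rewrite lt_def nrm_ge0 andbT nrm_eq0. Qed.
Lemma nrmR (x : R) : nrm x%:C%C = `|x|.
Proof. by rewrite /nrm /= expr0n /= addr0 sqrtr_sqr. Qed.
Lemma nrm_nat n : nrm n%:R = n%:R.
Proof. by rewrite -(rmorph_nat (real_complex R)) nrmR normr_nat. Qed.
Lemma nrm_sum (I : Type) (r : seq I) (P : pred I) (F : I -> R[i]) :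
  nrm (\sum_(i <- r | P i) F i) <= \sum_(i <- r | P i) nrm (F i).
Proof.
elim/big_rec2: _ => [|i y1 y2 _ IH]; first by rewrite nrm0.
by apply: le_trans (nrmD _ _) _; rewrite lerD2l.
Qed.
Lemma le_Re_nrm z : `|complex.Re z| <= nrm z.
Proof. by have := normc_ge_Re z; rewrite /nrm lecE /= eqxx. Qed.
Lemma Re_le_nrm z : complex.Re z <= nrm z.
Proof. exact: le_trans (ler_norm _) (le_Re_nrm z). Qed.
Lemma Im_le_nrm z : `|complex.Im z| <= nrm z.
Proof.
case: z => a b; rewrite /nrm /= -(sqrtr_sqr b).
by apply: ler_wsqrtr; rewrite lerDr sqr_ge0.
Qed.
Lemma nrm_le_ReIm z : nrm z <= `|complex.Re z| + `|complex.Im z|.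
Proof.
case: z => a b; rewrite /nrm /= -[leRHS]ger0_norm ?addr_ge0 // -[leRHS]sqrtr_sqr.
apply: ler_wsqrtr; rewrite sqrrD !real_normK ?num_real //.
have := mulr_ge0 (normr_ge0 a) (normr_ge0 b); lra.
Qed.
End Norm.


Arguments nrm {R} z : simpl never.

Section Rho.
Variable R : rcfType.

Let le_pow (a b : R) n : 0 <= a -> a <= b -> a ^+ n <= b ^+ n.
Proof. by move=> a0 ab; rewrite lerXn2r ?nnegrE // (le_trans a0). Qed.

(** The fourth root of n, the only fractional power that the estimates need. *)
Definition rho (n : nat) : R := Num.sqrt (Num.sqrt n%:R).

Lemma rho_sqr n : rho n ^+ 2 = Num.sqrt n%:R.
Proof. by rewrite sqr_sqrtr // sqrtr_ge0. Qed.
Lemma rho4 n : rho n ^+ 4 = n%:R.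
Proof. by rewrite -[4%N]/(2 * 2)%N exprM rho_sqr sqr_sqrtr // ler0n. Qed.
Lemma rho_ge0 n : 0 <= rho n. Proof. exact: sqrtr_ge0. Qed.
Lemma rho_gt0 n : (0 < n)%N -> 0 < rho n.
Proof. by move=> n_gt0; rewrite !sqrtr_gt0 ltr0n. Qed.
Lemma rhoM m n : rho (m * n) = rho m * rho n.
Proof. by rewrite /rho natrM !sqrtrM ?sqrtr_ge0. Qed.
Lemma le_rho m n : (m <= n)%N -> rho m <= rho n.
Proof. by move=> le_mn; do 2!apply: ler_wsqrtr; rewrite ler_nat. Qed.
Lemma rho1 : rho 1 = 1. Proof. by rewrite /rho !sqrtr1. Qed.
Lemma rho_ge1 n : (0 < n)%N -> 1 <= rho n.
Proof. by move=> n_gt0; rewrite -rho1 le_rho. Qed.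
Lemma rho16 : rho 16 = 2.
Proof.
apply/eqP; rewrite -(@eqrXn2 _ 4) ?rho_ge0 // rho4 -natrX //.
Qed.

(** Mean value inequality for the fourth root. *)
Lemma rho_step n : (0 < n)%N -> 1 <= 4 * rho n.+1 ^+ 3 * (rho n.+1 - rho n).
Proof.
move=> n_gt0; have a0 := rho_gt0 n_gt0; have b0 := rho_gt0 (ltn0Sn n).
have ab := le_rho (leqnSn n); have := rho4 n.+1; have := rho4 n.
rewrite -natr1; move: (rho n) (rho n.+1) n%:R a0 b0 ab => a b c a0 b0 ab Ha Hb.
have E : 1 = (b - a) * (b ^+ 3 + b ^+ 2 * a + b * a ^+ 2 + a ^+ 3).
  rewrite (_ : _ * _ = b ^+ 4 - a ^+ 4); last by ring.
  by rewrite Ha Hb addrAC subrr add0r.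
rewrite {1}E [leRHS]mulrC ler_wpM2l ?subr_ge0 //.
have h1 : b ^+ 2 * a <= b ^+ 3 by rewrite [leRHS]exprSr ler_wpM2l ?exprn_ge0 // ltW.
have h2 : b * a ^+ 2 <= b ^+ 3.
  by rewrite [leRHS]exprS ler_wpM2l ?(ltW b0) // le_pow // ltW.
have h3 : a ^+ 3 <= b ^+ 3 by rewrite le_pow // ltW.
lra.
Qed.

Lemma telescope_le (F G : nat -> R) m N : (m <= N)%N ->
  (forall i, (m <= i < N)%N -> F i <= G i.+1 - G i) ->
  \sum_(m <= i < N) F i <= G N - G m.
Proof. by move=> le_mN H; rewrite -telescope_sumr //; apply: ler_sum_nat. Qed.

(** The comparison is with the telescoping differences of -4 / rho. *)
Lemma sum_rho_tail m N : (0 < m <= N)%N ->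
  \sum_(m <= i < N) rho i ^+ 3 / (i%:R * i.+1%:R) <= 4 / rho m.
Proof.
move=> /andP[m_gt0 le_mN].
apply: (@le_trans _ _ (- (4 / rho N) - - (4 / rho m))).
  apply: (@telescope_le _ (fun i => - (4 / rho i))) => // i /andP[mi _].
  have i_gt0 : (0 < i)%N by lia.
  have := rho_step i_gt0; rewrite -(rho4 i) -(rho4 i.+1).
  have := rho_gt0 i_gt0; have := rho_gt0 (ltn0Sn i).
  move: (rho i) (rho i.+1) => a b b0 a0 H.
  have -> : a ^+ 3 / (a ^+ 4 * b ^+ 4) = (a * b ^+ 4)^-1.
    by field; rewrite ?(gt_eqF a0) ?(gt_eqF b0).
  have -> : - (4 / b) - - (4 / a) = (4 * b ^+ 3 * (b - a)) * (a * b ^+ 4)^-1.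
    by field; rewrite ?(gt_eqF a0) ?(gt_eqF b0).
  by rewrite ler_peMl // invr_ge0 mulr_ge0 ?exprn_ge0 // ltW.
by rewrite opprK gerDr oppr_le0 divr_ge0 // rho_ge0.
Qed.

Lemma sum_sqrt_tail m N : (0 < m <= N)%N ->
  \sum_(m <= i < N) rho i ^+ 2 / (i%:R * i.+1%:R) <= 2 / rho m ^+ 2.
Proof.
move=> /andP[m_gt0 le_mN].
apply: (@le_trans _ _ (- (2 / rho N ^+ 2) - - (2 / rho m ^+ 2))).
  apply: (@telescope_le _ (fun i => - (2 / rho i ^+ 2))) => // i /andP[mi _].
  have i_gt0 : (0 < i)%N by lia.
  have := rho4 i; have := rho4 i.+1; rewrite -natr1 => Eb Ea.
  have := rho_gt0 i_gt0; have := rho_gt0 (ltn0Sn i).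
  have := le_rho (leqnSn i).
  move: Ea Eb; move: (rho i) (rho i.+1) i%:R => a b c <- Eb ab b0 a0.
  rewrite -Eb.
  have -> : a ^+ 2 / (a ^+ 4 * b ^+ 4) = (a ^+ 2 * b ^+ 4)^-1.
    by field; rewrite ?(gt_eqF a0) ?(gt_eqF b0).
  have -> : - (2 / b ^+ 2) - - (2 / a ^+ 2) = (2 * b ^+ 2 * (b ^+ 2 - a ^+ 2)) * (a ^+ 2 * b ^+ 4)^-1.
    by field; rewrite ?(gt_eqF a0) ?(gt_eqF b0).
  rewrite ler_peMl // ?invr_ge0 ?mulr_ge0 ?exprn_ge0 ?(ltW a0) ?(ltW b0) //.
  have h : a ^+ 2 <= b ^+ 2 by rewrite le_pow // ltW.
  have e : 1 = (b ^+ 2 - a ^+ 2) * (b ^+ 2 + a ^+ 2).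
    rewrite (_ : _ * _ = b ^+ 4 - a ^+ 4); last by ring.
    by rewrite Eb addrAC subrr add0r.
  rewrite [leLHS]e [leLHS]mulrC ler_wpM2r ?subr_ge0 //; lra.
by rewrite opprK gerDr oppr_le0 divr_ge0 // exprn_ge0 // rho_ge0.
Qed.

(** The weights rho(i) / i of a partial summation decrease slowly enough to be
    compared with the increments of rho. *)
Lemma rho_weight_step i : (0 < i)%N ->
  i%:R * (rho i / i%:R - rho i.+1 / i.+1%:R) <= 3 * (rho i.+1 - rho i).
Proof.
move=> i_gt0; have := rho_step i_gt0.
have := rho4 i; have := rho4 i.+1; rewrite -natr1 => Eb Ea.
have := rho_gt0 i_gt0; have := rho_gt0 (ltn0Sn i).
move: Ea Eb; move: (rho i) (rho i.+1) i%:R => a b c <- Eb b0 a0 H.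
rewrite -Eb; have -> : a ^+ 4 * (a / a ^+ 4 - b / b ^+ 4) = a - a ^+ 4 / b ^+ 3.
  by field; rewrite ?(gt_eqF a0) ?(gt_eqF b0).
have -> : a ^+ 4 = b ^+ 4 - 1 by rewrite Eb addrK.
have -> : a - (b ^+ 4 - 1) / b ^+ 3 = a - b + 1 / b ^+ 3.
  by field; rewrite ?(gt_eqF a0) ?(gt_eqF b0).
suff : 1 / b ^+ 3 <= 4 * (b - a) by lra.
rewrite ler_pdivrMr ?exprn_gt0 //; apply: le_trans H _.
by rewrite le_eqVlt (_ : _ == _) //; apply/eqP; ring.
Qed.

End Rho.

(** * Partial summation and the dichotomy for logarithmic derivatives *)

(** Only these properties of the logarithm enter the analytic part, so that no
    analysis of the exponential function is needed before the last section. *)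
Record logarithm (R : realType) := Logarithm {
  lg :> nat -> R;
  lgM : forall m n, (0 < m)%N -> (0 < n)%N -> lg (m * n)%N = lg m + lg n;
  lg_step : forall n, (0 < n)%N -> 0 <= lg n.+1 - lg n <= n%:R^-1;
  lg_rho : forall n, (0 < n)%N -> lg n <= 4 * rho R n;
  lg_unbounded : forall K : R, exists2 n : nat, (0 < n)%N & K < lg n
}.

Section Logarithm.
Variables (R : realType) (lg : logarithm R).

Lemma lg1 : lg 1%N = 0.
Proof. by have /eqP := lgM lg (ltn0Sn 0) (ltn0Sn 0); rewrite -subr_eq subrr eq_sym => /eqP. Qed.

Lemma le_lg m n : (0 < m <= n)%N -> lg m <= lg n.
Proof.
move=> /andP[m_gt0]; elim: n => [|n IH]; first by move=> /(leq_trans m_gt0).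
rewrite leq_eqVlt => /predU1P[-> // | le_mn]; apply: le_trans (IH le_mn) _.
by have /andP[+ _] := lg_step lg (leq_trans m_gt0 le_mn); rewrite subr_ge0.
Qed.

Lemma lg_ge0 n : (0 < n)%N -> 0 <= lg n.
Proof. by move=> n_gt0; rewrite -lg1 le_lg. Qed.

Lemma lgX p k : (0 < p)%N -> lg (p ^ k)%N = lg p *+ k.
Proof.
move=> p_gt0; elim: k => [|k IHk]; first by rewrite expn0 mulr0n lg1.
by rewrite expnS lgM ?expn_gt0 ?p_gt0 // IHk mulrS.
Qed.

(** Here x < d (y + 1) with y = x %/ d, and y + 1 <= 16 y, whose fourth root is
    twice that of y. *)
Lemma lg_div x d : (0 < d <= x)%N -> lg x - lg d <= 8 * rho R (x %/ d).
Proof.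
move=> /andP[d_gt0 le_dx].
have y_gt0 : (0 < x %/ d)%N by rewrite divn_gt0.
have xd : (x <= d * (x %/ d).+1)%N by rewrite mulnC ltnW // ltn_ceil.
have : lg x <= lg d + lg (x %/ d).+1.
  by rewrite -lgM // le_lg // xd andbT (leq_trans d_gt0).
have := lg_rho lg (ltn0Sn (x %/ d)).
have : rho R (x %/ d).+1 <= rho R (16 * (x %/ d)) by apply: le_rho; lia.
rewrite rhoM rho16; lra.
Qed.
End Logarithm.

Section PartialSums.
Variable V : comNzRingType.

Definition psum (a : nat -> V) x := \sum_(1 <= n < x.+1) a n.

Lemma psum0 a : psum a 0 = 0. Proof. by rewrite /psum big_geq. Qed.
Lemma psumS a x : psum a x.+1 = psum a x + a x.+1.
Proof. by rewrite /psum big_nat_recr. Qed.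

Lemma psum_tail a m N : (m <= N)%N ->
  psum a N - psum a m = \sum_(m <= i < N) a i.+1.
Proof.
move=> le_mN; rewrite -telescope_sumr //; apply: eq_bigr => i _.
by rewrite psumS addrAC subrr add0r.
Qed.

Lemma abel_summation a (f : nat -> V) m N : (m <= N)%N ->
  \sum_(m <= i < N) a i.+1 * f i.+1 =
  psum a N * f N - psum a m * f m - \sum_(m <= i < N) psum a i * (f i.+1 - f i).
Proof.
move=> le_mN; rewrite -(telescope_sumr (fun i => psum a i * f i)) // -sumrB.
by apply: eq_bigr => i _; rewrite psumS; ring.
Qed.

(** The lattice points d e <= x are symmetric in d and e. *)
Lemma sum_exchange (G : nat -> nat -> V) x :
  \sum_(1 <= d < x.+1) \sum_(1 <= e < (x %/ d).+1) G d e =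
  \sum_(1 <= e < x.+1) \sum_(1 <= d < (x %/ e).+1) G d e.
Proof.
have H (F : nat -> nat -> V) : \sum_(1 <= d < x.+1) \sum_(1 <= e < (x %/ d).+1) F d e =
   \sum_(1 <= d < x.+1) \sum_(1 <= e < x.+1 | (d * e <= x)%N) F d e.
  apply: eq_big_nat => d /andP[d_gt0 _].
  rewrite (big_nat_widen _ _ x.+1) ?ltnS ?leq_div //.
  rewrite big_nat_cond [RHS]big_nat_cond; apply: eq_bigl => e.
  case: (boolP (1 <= e < x.+1)%N) => //= He.
  by rewrite ltnS leq_divRL // mulnC; lia.
rewrite H (H (fun e d => G d e)) /= (exchange_big_dep xpredT) //=.
by apply: eq_bigr => e _; apply: eq_bigl => d; rewrite mulnC.
Qed.
End PartialSums.

Section Estimates.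
Variable R : realType.
Local Notation rho := (rho R).

(** The limit is the supremum of the lower bounds x n - r n. *)
Lemma real_limit (x r : nat -> R) :
  (forall m n, (0 < m <= n)%N -> `|x n - x m| <= r m) ->
  exists L, forall n, (0 < n)%N -> `|x n - L| <= r n.
Proof.
move=> H.
have key m n : (0 < m)%N -> (0 < n)%N -> x m - r m <= x n + r n.
  move=> m0 n0; have rm : 0 <= r m by apply: le_trans (H m m _); rewrite ?m0 /=.
  have rn : 0 <= r n by apply: le_trans (H n n _); rewrite ?n0 /=.
  case/orP: (leq_total m n) => mn.
    have := H m n; rewrite m0 mn => /(_ isT); rewrite ler_norml; lra.
  have := H n m; rewrite n0 mn => /(_ isT); rewrite ler_norml; lra.
pose S : set R := [set y | exists2 m, (0 < m)%N & y = x m - r m]%classic.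
have hs : has_sup S.
  split; first by exists (x 1%N - r 1%N); exists 1%N.
  by exists (x 1%N + r 1%N) => y [m m0 ->]; apply: key.
exists (sup S) => n n0; rewrite ler_norml; apply/andP; split.
  suff : sup S <= x n + r n by lra.
  by apply: ge_sup; [case: hs | move=> y [m m0 ->]; apply: key].
suff : x n - r n <= sup S by lra.
by apply: ub_le_sup; [case: hs | exists n].
Qed.

Lemma complex_limit (b : nat -> R[i]) (r : nat -> R) :
  (forall m n, (0 < m <= n)%N -> nrm (b n - b m) <= r m) ->
  exists L, forall n, (0 < n)%N -> nrm (b n - L) <= 2 * r n.
Proof.
move=> H.
have [|x Hx] := @real_limit (fun n => complex.Re (b n)) r.
  by move=> m n mn; rewrite -raddfB; apply: le_trans (le_Re_nrm _) (H m n mn).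
have [|y Hy] := @real_limit (fun n => complex.Im (b n)) r.
  by move=> m n mn; rewrite -raddfB; apply: le_trans (Im_le_nrm _) (H m n mn).
exists (Complex x y) => n n0; apply: le_trans (nrm_le_ReIm _) _.
rewrite !raddfB /=; have := Hx n n0; have := Hy n n0; lra.
Qed.

Section Tail.
Variables (a : nat -> R[i]) (K : R).
Hypothesis Ha : forall x, nrm (psum a x) <= K * rho x ^+ 2.

Let K_ge0 : 0 <= K.
Proof. by have := Ha 1; rewrite rho1 expr1n mulr1; apply/le_trans/nrm_ge0. Qed.

(** Partial summation: a has sums O(rho^2), while f is of size rho(i) / i with
    differences of size rho(i) / i^2, so the tails of the series of a f are
    O(1 / rho). It serves f(n) = lg n / n. *)
Lemma tail_bound (f : nat -> R[i]) c :
  (forall i, (0 < i)%N -> nrm (f i) <= c * rho i / i%:R) ->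
  (forall i, (0 < i)%N -> nrm (f i.+1 - f i) <= c * rho i / (i%:R * i.+1%:R)) ->
  forall m N, (0 < m <= N)%N ->
  nrm (psum (fun n => a n * f n) N - psum (fun n => a n * f n) m) <= 6 * c * K / rho m.
Proof.
move=> Hf Hdf m N /andP[m_gt0 le_mN].
have c_ge0 : 0 <= c.
  by have := Hf 1%N isT; rewrite rho1 mulr1 divr1; apply/le_trans/nrm_ge0.
rewrite psum_tail // abel_summation //.
have Hterm i : (m <= i)%N -> nrm (psum a i * f i) <= c * K / rho m.
  move=> mi; have i_gt0 := leq_trans m_gt0 mi.
  rewrite nrmM; apply: le_trans (ler_pM (nrm_ge0 _) (nrm_ge0 _) (Ha i) (Hf i i_gt0)) _.
  have -> : K * rho i ^+ 2 * (c * rho i / i%:R) = c * K / rho i.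
    by rewrite -(rho4 R i); field; rewrite gt_eqF // rho_gt0.
  rewrite ler_wpM2l ?mulr_ge0 // lef_pV2 ?posrE ?rho_gt0 //; exact: le_rho.
have Hsum : nrm (\sum_(m <= i < N) psum a i * (f i.+1 - f i)) <= 4 * c * K / rho m.
  apply: le_trans (nrm_sum _ _ _) _.
  apply: (@le_trans _ _ (\sum_(m <= i < N) c * K * (rho i ^+ 3 / (i%:R * i.+1%:R)))).
    apply: ler_sum_nat => i /andP[mi _]; have i_gt0 := leq_trans m_gt0 mi.
    rewrite nrmM; apply: le_trans (ler_pM (nrm_ge0 _) (nrm_ge0 _) (Ha i) (Hdf i i_gt0)) _.
    by rewrite le_eqVlt (_ : _ == _) //; apply/eqP; rewrite !mulrA; congr (_ / _); ring.
  rewrite -mulr_sumr.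
  have H := @sum_rho_tail R m N; rewrite m_gt0 le_mN in H.
  apply: le_trans (ler_wpM2l _ (H isT)) _; first by rewrite mulr_ge0.
  by rewrite le_eqVlt (_ : _ == _) //; apply/eqP; ring.
apply: le_trans (nrmB _ _) _.
have h1 := nrmB (psum a N * f N) (psum a m * f m).
have h2 := Hterm N le_mN; have h3 := Hterm m (leqnn m).
have -> : 6 * c * K / rho m = c * K / rho m + c * K / rho m + 4 * c * K / rho m by ring.
lra.
Qed.

(** For f(n) = 1 / n the same argument gains a further factor 1 / rho. *)
Lemma tail_bound_inv m N : (0 < m <= N)%N ->
  nrm (psum (fun n => a n / n%:R) N - psum (fun n => a n / n%:R) m) <= 4 * K / rho m ^+ 2.
Proof.
move=> /andP[m_gt0 le_mN].
rewrite psum_tail // (abel_summation a (fun n => n%:R^-1)) //.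
have Hterm i : (m <= i)%N -> nrm (psum a i / i%:R) <= K / rho m ^+ 2.
  move=> mi; have i_gt0 := leq_trans m_gt0 mi.
  rewrite nrmM nrmV nrm_nat.
  apply: (@le_trans _ _ (K * rho i ^+ 2 / i%:R)).
    by rewrite ler_wpM2r ?invr_ge0 ?ler0n.
  have -> : K * rho i ^+ 2 / i%:R = K / rho i ^+ 2.
    by rewrite -(rho4 R i); field; rewrite gt_eqF // rho_gt0.
  rewrite ler_wpM2l // lef_pV2 ?posrE ?exprn_gt0 ?rho_gt0 //.
  by rewrite lerXn2r ?nnegrE ?rho_ge0 // le_rho.
have Hsum : nrm (\sum_(m <= i < N) psum a i * (i.+1%:R^-1 - i%:R^-1)) <= 2 * K / rho m ^+ 2.
  apply: le_trans (nrm_sum _ _ _) _.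
  apply: (@le_trans _ _ (\sum_(m <= i < N) K * (rho i ^+ 2 / (i%:R * i.+1%:R)))).
    apply: ler_sum_nat => i /andP[mi _]; have i_gt0 := leq_trans m_gt0 mi.
    have -> : i.+1%:R^-1 - i%:R^-1 = - (i%:R * i.+1%:R)^-1 :> R[i].
      by rewrite -natr1; field; rewrite natr1 !pnatr_eq0 -!lt0n i_gt0.
    rewrite nrmM nrmN nrmV -natrM nrm_nat natrM mulrA.
    by rewrite ler_wpM2r // invr_ge0 mulr_ge0.
  rewrite -mulr_sumr.
  have H := @sum_sqrt_tail R m N; rewrite m_gt0 le_mN in H.
  apply: le_trans (ler_wpM2l K_ge0 (H isT)) _.
  by rewrite le_eqVlt (_ : _ == _) //; apply/eqP; ring.
apply: le_trans (nrmB _ _) _.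
have h1 := nrmB (psum a N / N%:R) (psum a m / m%:R).
have h2 := Hterm N le_mN; have h3 := Hterm m (leqnn m).
have -> : 4 * K / rho m ^+ 2 = K / rho m ^+ 2 + K / rho m ^+ 2 + 2 * K / rho m ^+ 2 by ring.
lra.
Qed.
End Tail.

(** The loss 1 / rho(x / d) is small unless d is close to x, where the weights
    w(d) / d have bounded total mass on each dyadic range; replacing 1 / rho(x %/ d)
    by a multiple of rho(d) / rho(x) reduces this to a partial summation. *)
Lemma weight_sum (w : nat -> R) K : (forall d, 0 <= w d) ->
  (forall x, psum w x <= K * x%:R) ->
  forall x, (0 < x)%N ->
  \sum_(1 <= d < x.+1) w d / d%:R / rho (x %/ d) <= 8 * K.
Proof.
move=> w_ge0 Hw x x_gt0.
have K_ge0 : 0 <= K.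
  have := Hw 1%N; rewrite mulr1; apply: le_trans.
  by rewrite psumS psum0 add0r.
have rx := rho_gt0 R x_gt0.
apply: (@le_trans _ _ (2 / rho x * \sum_(1 <= d < x.+1) w d * (rho d / d%:R))).
  rewrite mulr_sumr; apply: ler_sum_nat => d /andP[d_gt0 d_le].
  have y_gt0 : (0 < x %/ d)%N by rewrite divn_gt0.
  have H : rho x <= 2 * rho d * rho (x %/ d).
    rewrite -rho16 -!rhoM; apply: le_rho.
    have := ltn_ceil x d_gt0; move: y_gt0; move: (x %/ d)%N => y; nia.
  have ry := rho_gt0 R y_gt0; have rd := rho_gt0 R d_gt0.
  have -> : 2 / rho x * (w d * (rho d / d%:R)) = w d / d%:R * (2 * rho d / rho x) by ring.
  apply: ler_wpM2l; first by rewrite divr_ge0.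
  rewrite ler_pdivlMr // mulrC ler_pdivrMr //.
rewrite -ler_pdivlMl ?divr_gt0 //.
have -> : (2 / rho x)^-1 * (8 * K) = 4 * K * rho x.
  by field; rewrite gt_eqF.
have -> : \sum_(1 <= d < x.+1) w d * (rho d / d%:R) = \sum_(0 <= i < x) w i.+1 * (rho i.+1 / i.+1%:R).
  by rewrite big_add1.
rewrite (abel_summation w (fun i => rho i / i%:R)) // psum0 mul0r subr0 -sumrN.
have Hfirst : psum w x * (rho x / x%:R) <= K * rho x.
  apply: (@le_trans _ _ (K * x%:R * (rho x / x%:R))).
    by rewrite ler_wpM2r // divr_ge0 // rho_ge0.
  by rewrite le_eqVlt (_ : _ == _) //; apply/eqP; field; rewrite pnatr_eq0 -lt0n.
suff : \sum_(0 <= i < x) - (psum w i * (rho i.+1 / i.+1%:R - rho i / i%:R)) <= 3 * K * rho x by lra.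
apply: (@le_trans _ _ (\sum_(0 <= i < x) (3 * K * rho i.+1 - 3 * K * rho i))).
  apply: ler_sum_nat => i _; have [->|i_gt0] := posnP i.
    by rewrite psum0 mul0r oppr0 -mulrBr mulr_ge0 ?mulr_ge0 // subr_ge0 le_rho.
  have HD := @rho_weight_step R i i_gt0.
  rewrite -[X in X <= _]mulrN opprB; move: HD; set D := rho i / _ - _ => HD.
  have [D0|D0] := leP 0 D.
    apply: (@le_trans _ _ (K * (i%:R * D))); first by rewrite mulrA ler_wpM2r.
    by rewrite -mulrBr -mulrA [leRHS]mulrCA ler_wpM2l.
  apply: (@le_trans _ _ 0).
    by rewrite mulr_ge0_le0 //; [apply: sumr_ge0 | apply: ltW].
  by rewrite -mulrBr mulr_ge0 ?mulr_ge0 // subr_ge0 le_rho.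
rewrite telescope_sumr // lerBlDr lerDl mulr_ge0 ?mulr_ge0 ?rho_ge0 //.
Qed.
End Estimates.

Section Dichotomy.
Variables (R : realType) (lg : logarithm R).
Local Notation rho := (rho R).

Definition bounded (f : nat -> R[i]) :=
  exists K, forall x, (0 < x)%N -> nrm (f x) <= K.

Variables (a lam m : nat -> R[i]) (l w : nat -> R) (K : R).
Hypothesis Ha : forall x, nrm (psum a x) <= K * rho x ^+ 2.
Hypothesis Hlog : forall n, (0 < n)%N -> conv lam a n = a n * (lg n)%:C%C.
Hypothesis Hinv : forall n, (0 < n)%N -> conv m a n = deltaf _ n.
Hypothesis Hl : forall n, nrm (lam n) <= l n.
Hypothesis Hsl : forall x, psum l x <= K * x%:R.
Hypothesis Hw : forall n, nrm (m n) <= w n.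
Hypothesis Hsw : forall x, psum w x <= K * x%:R.

Let B := psum (fun n => a n / n%:R).
Let E := psum (fun n => lam n / n%:R).

Let sum_conv (f g : nat -> R[i]) (h : nat -> R[i]) x :
  psum (fun n => conv f g n / n%:R * h n) x =
  \sum_(1 <= d < x.+1) f d / d%:R * \sum_(1 <= e < (x %/ d).+1) g e / e%:R * h (d * e)%N.
Proof.
under [RHS]eq_bigr => d _ do rewrite mulr_sumr.
rewrite -divisors_sum_exchange; apply: eq_big_nat => n /andP[n_gt0 _].
rewrite /conv !mulr_suml; apply: eq_big_seq => d; rewrite -dvdn_divisors // => dv.
have En : n = (d * (n %/ d))%N by rewrite mulnC divnK.
have -> : n%:R = d%:R * (n %/ d)%:R :> R[i] by rewrite -natrM -En.
by rewrite -En invfM; ring.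
Qed.

(** This replaces the behaviour of a logarithmic derivative at s = 1, after Mertens
    and Shapiro. Let B(y) be the partial sums of a(n) / n, which converge to L at
    rate 1 / rho^2, because a has sums O(sqrt x). Summing a lg = lam * a gives
    sum_d lam(d)/d B(x/d) = O(1), and replacing B by its limit L costs O(1) by
    [weight_sum]; so E is bounded when L is not 0. When L = 0, summing
    m * a = delta against lg(x/n) expresses lg x + E(x) as
    sum_d m(d)/d lg(x/d) B(x/d), whose terms are again O(1 / rho(x/d)). *)
Lemma dichotomy : exists2 L,
  forall n, (0 < n)%N -> nrm (psum (fun n => a n / n%:R) n - L) <= 8 * K / rho n ^+ 2 &
  bounded (psum (fun n => lam n / n%:R)) \/
  L = 0 /\ bounded (fun x => psum (fun n => lam n / n%:R) x + (lg x)%:C%C).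
Proof.
have K_ge0 : 0 <= K by have := Ha 1; rewrite rho1 expr1n mulr1; apply/le_trans/nrm_ge0.
have l_ge0 d : 0 <= l d by apply: le_trans (Hl d); exact: nrm_ge0.
have w_ge0 d : 0 <= w d by apply: le_trans (Hw d); exact: nrm_ge0.
have [L HL] : exists L, forall n, (0 < n)%N -> nrm (B n - L) <= 2 * (4 * K / rho n ^+ 2).
  by apply: complex_limit => i j; apply: tail_bound_inv.
exists L => [n n_gt0|].
  by apply: le_trans (HL n n_gt0) _; rewrite mulrA mulrA -natrM.
have BL y : (0 < y)%N -> nrm (B y - L) <= 8 * K / rho y.
  move=> y_gt0; apply: le_trans (HL y y_gt0) _; rewrite [leLHS]mulrA mulrA.
  rewrite (_ : 2 * 4 = 8) -?natrM // ler_wpM2l ?mulr_ge0 //.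
  rewrite lef_pV2 ?posrE ?exprn_gt0 ?rho_gt0 //.
  by rewrite expr2 ler_peMl ?rho_ge0 ?rho_ge1.
have [L0|L0] := eqVneq L 0.
  right; split=> //; exists (64 * K * (8 * K)) => x x_gt0.
  (* summation of m * a = delta *)
  have EB y : (0 < y)%N -> \sum_(1 <= d < y.+1) m d / d%:R * B (y %/ d) = 1.
    move=> y_gt0.
    have := @sum_conv m a (fun=> 1) y.
    under eq_bigr => d _ do under eq_bigr => e _ do rewrite mulr1.
    move=> <-; rewrite /psum (big_cat_nat (n := 2)) //= big_nat1 Hinv // divr1 mulr1.
    rewrite /deltaf eqxx big_nat big1 ?addr0 // => n /andP[n_gt1 _].
    by rewrite Hinv ?(ltnW n_gt1) // /deltaf gtn_eqF // mul0r mul0r.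
  (* m * (a lg) = m * a * lam = lam *)
  have E1 : \sum_(1 <= d < x.+1) m d / d%:R *
     \sum_(1 <= e < (x %/ d).+1) a e / e%:R * (lg e)%:C%C = E x.
    transitivity (\sum_(1 <= d < x.+1) \sum_(1 <= e < (x %/ d).+1)
        (m d / d%:R * (lam e / e%:R * B (x %/ d %/ e)))).
      apply: eq_big_nat => d /andP[d_gt0 d_le]; rewrite -mulr_sumr; congr (_ * _).
      have := @sum_conv lam a (fun=> 1) (x %/ d).
      under [RHS]eq_bigr => e _ do under eq_bigr => f _ do rewrite mulr1.
      move=> <-; apply: eq_big_nat => n /andP[n_gt0 _]; rewrite Hlog //; ring.
    rewrite sum_exchange; apply: eq_big_nat => e /andP[e_gt0 e_le].
    rewrite -[RHS]mulr1 -[X in _ = _ * X](EB (x %/ e)%N) ?divn_gt0 // mulr_sumr.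
    by apply: eq_bigr => d _; rewrite divnAC mulrCA.
  have key : (lg x)%:C%C = \sum_(1 <= d < x.+1) m d / d%:R * ((lg x - lg d)%:C%C * B (x %/ d)) - E x.
    rewrite -E1 -sumrB.
    have := @sum_conv m a (fun n => (lg x)%:C%C - (lg n)%:C%C) x.
    rewrite /psum (big_cat_nat (n := 2)) //= big_nat1 Hinv // divr1.
    rewrite /deltaf eqxx big_nat big1 ?addr0 => [|n /andP[n_gt1 _]]; last first.
      by rewrite Hinv ?(ltnW n_gt1) // /deltaf gtn_eqF // mul0r mul0r.
    rewrite lg1 subr0 mul1r => ->; apply: eq_big_nat => d /andP[d_gt0 _].
    rewrite -mulrBr; congr (_ * _); rewrite mulr_sumr -sumrB.
    apply: eq_big_nat => e /andP[e_gt0 _]; rewrite lgM // rmorphD rmorphB /=; ring.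
  rewrite {1}key addrCA subrr addr0.
  apply: le_trans (nrm_sum _ _ _) _.
  apply: (@le_trans _ _ (64 * K * \sum_(1 <= d < x.+1) w d / d%:R / rho (x %/ d))).
    rewrite mulr_sumr; apply: ler_sum_nat => d /andP[d_gt0 d_le].
    have y_gt0 : (0 < x %/ d)%N by rewrite divn_gt0.
    have ry := rho_gt0 R y_gt0.
    rewrite !nrmM nrmV nrm_nat nrmR.
    have := HL _ y_gt0; rewrite L0 subr0 => HB.
    have := @lg_div R lg x d; rewrite d_gt0 /= => /(_ d_le) Hd.
    have Hd' : 0 <= lg x - lg d by rewrite subr_ge0 le_lg // d_gt0.
    rewrite ger0_norm //.
    apply: (@le_trans _ _ (w d / d%:R * (8 * rho (x %/ d) * (2 * (4 * K / rho (x %/ d) ^+ 2))))).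
      apply: ler_pM; rewrite ?mulr_ge0 ?nrm_ge0 ?invr_ge0 ?ler0n //.
        by rewrite ler_wpM2r ?invr_ge0 ?ler0n.
      by apply: ler_pM; rewrite ?nrm_ge0.
    by rewrite le_eqVlt (_ : _ == _) //; apply/eqP; field; rewrite gt_eqF //= pnatr_eq0 -lt0n.
  by apply: ler_wpM2l (weight_sum w_ge0 Hsw x_gt0); rewrite mulr_ge0.
left.
pose B1 := psum (fun n => a n * ((lg n / n%:R)%:C)%C).
have B1_bd x : (0 < x)%N -> nrm (B1 x) <= nrm (B1 1%N) + 30 * K.
  move=> x_gt0; rewrite -[B1 x](subrK (B1 1%N)) addrC.
  apply: le_trans (nrmD _ _) _; rewrite lerD2l.
  have -> : 30 * K = 6 * 5 * K / rho 1 by rewrite rho1 divr1 -natrM.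
  apply: (tail_bound Ha) => // i i_gt0.
    rewrite nrmR ger0_norm ?divr_ge0 ?lg_ge0 // ler_wpM2r ?invr_ge0 ?ler0n //.
    have := lg_rho lg i_gt0; have := rho_ge0 R i; lra.
  rewrite -rmorphB nrmR.
  have i0 : i%:R != 0 :> R by rewrite pnatr_eq0 -lt0n.
  have i1 : i.+1%:R != 0 :> R by rewrite pnatr_eq0.
  have -> : lg i.+1 / i.+1%:R - lg i / i%:R =
     (i%:R * (lg i.+1 - lg i) - lg i) / (i%:R * i.+1%:R).
    by move: i1; rewrite -natr1 => i1; field; rewrite ?i0 ?i1.
  rewrite normrM [X in _ * X]ger0_norm ?invr_ge0 ?mulr_ge0 //.
  rewrite ler_wpM2r ?invr_ge0 ?mulr_ge0 //.
  have /andP[s0 s1] := lg_step lg i_gt0.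
  have s2 : i%:R * (lg i.+1 - lg i) <= 1.
    by apply: le_trans (ler_wpM2l (ler0n _ _) s1) _; rewrite divff.
  have s3 : 0 <= i%:R * (lg i.+1 - lg i) by rewrite mulr_ge0.
  have := lg_rho lg i_gt0; have := rho_ge1 R i_gt0; have := lg_ge0 lg i_gt0.
  rewrite ler_norml; lra.
exists ((nrm (B1 1%N) + 30 * K + 8 * K * (8 * K)) / nrm L) => x x_gt0.
rewrite ler_pdivlMr ?nrm_gt0 // -nrmM.
have -> : E x * L = B1 x - \sum_(1 <= d < x.+1) lam d / d%:R * (B (x %/ d) - L).
  have -> : B1 x = psum (fun n => conv lam a n / n%:R * 1) x.
    apply: eq_big_nat => n /andP[n_gt0 _]; rewrite Hlog // mulr1.
    by rewrite -mulrA; congr (_ * _); rewrite rmorphM fmorphV rmorph_nat.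
  rewrite (sum_conv lam a (fun=> 1)) -sumrB /E /psum mulr_suml.
  apply: eq_bigr => d _; under eq_bigr => e _ do rewrite mulr1.
  by rewrite -mulrBr subKr.
apply: le_trans (nrmB _ _) _; apply: lerD; first exact: B1_bd.
apply: le_trans (nrm_sum _ _ _) _.
apply: (@le_trans _ _ (8 * K * \sum_(1 <= d < x.+1) l d / d%:R / rho (x %/ d))).
  rewrite mulr_sumr; apply: ler_sum_nat => d /andP[d_gt0 d_le].
  have y_gt0 : (0 < x %/ d)%N by rewrite divn_gt0.
  rewrite !nrmM nrmV nrm_nat.
  apply: (@le_trans _ _ (l d / d%:R * (8 * K / rho (x %/ d)))).
    apply: ler_pM; rewrite ?mulr_ge0 ?nrm_ge0 ?invr_ge0 ?ler0n ?BL //.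
    by rewrite ler_wpM2r ?invr_ge0 ?ler0n.
  by rewrite le_eqVlt (_ : _ == _) //; apply/eqP; ring.
by apply: ler_wpM2l (weight_sum l_ge0 Hsl x_gt0); rewrite mulr_ge0.
Qed.
End Dichotomy.

(** * Estimates of Chebyshev and Mertens *)

Section Chebyshev.
Variables (R : realType) (lg : logarithm R).
Local Notation rho := (rho R).

(** The von Mangoldt function. *)
Definition vm : nat -> R := ppf (fun p _ => lg p).

Lemma vm_ge0 n : 0 <= vm n.
Proof.
rewrite /vm /ppf; case E: (primes n) => [|p [|q r]] //; apply: lg_ge0.
have : p \in primes n by rewrite E inE.
by rewrite mem_primes => /and3P[/prime_gt0].
Qed.

Lemma sum_vm n : (0 < n)%N -> \sum_(d <- divisors n) vm d = lg n.
Proof.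
move=> n_gt0.
have multf1' k : multf (fun _ _ => 1 : R) k = 1 by rewrite /multf big1.
rewrite -[RHS]mul1r -(multf1' n) -(@conv_ppf_multf R lg (fun p _ => lg p)) //.
- by apply: eq_bigr => d _; rewrite multf1' mulr1.
- exact: lgM.
move=> p k _; under eq_bigr => i _ do rewrite mulr1.
by rewrite sumr_const card_ord mulr_natl.
Qed.

Lemma psum_lg x : psum lg x = \sum_(1 <= d < x.+1) vm d * (x %/ d)%:R.
Proof.
have := divisors_sum_exchange (fun d _ => vm d) x.
under eq_big_nat => n /andP[n_gt0 _] do rewrite sum_vm //.
rewrite -/(psum lg x) => ->; apply: eq_bigr => d _.
by rewrite sumr_const_nat subn1 /= mulr_natr.
Qed.

Lemma psum_lg_fact n : psum lg n = lg (n`!).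
Proof.
elim: n => [|n IH]; first by rewrite psum0 fact0 lg1.
by rewrite psumS IH factS lgM ?fact_gt0 // addrC.
Qed.

Lemma le_lg2 : lg 2 <= 1.
Proof. by have /andP[_] := lg_step lg (ltn0Sn 0); rewrite lg1 subr0 invr1. Qed.

(** The logarithm of the central binomial coefficient of 2n, which is at most 2n lg 2,
    equals sum_d vm(d) ((2n) %/ d - 2 (n %/ d)); all terms are nonnegative, and those
    with n < d <= 2n are vm(d). *)
Lemma chebyshev_dyadic n : psum vm n.*2 - psum vm n <= 2 * n%:R.
Proof.
have [->|n_gt0] := posnP n; first by rewrite psum0 mulr0 subrr.
apply: (@le_trans _ _ (psum lg n.*2 - 2 * psum lg n)).
  rewrite !psum_lg psum_tail; last by lia.
  rewrite [X in _ <= X - _](@big_cat_nat _ _ _ n.+1) //=; last by lia.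
  rewrite mulr_sumr addrAC -sumrB.
  have : 0 <= \sum_(1 <= i < n.+1) (vm i * (n.*2 %/ i)%:R - 2 * (vm i * (n %/ i)%:R)).
    rewrite big_nat; apply: sumr_ge0 => i /andP[i_gt0 _].
    rewrite mulrCA -mulrBr mulr_ge0 ?vm_ge0 // subr_ge0 -natrM ler_nat.
    rewrite leq_divRL // -mulnA mul2n leq_double; exact: leq_trunc_div.
  rewrite big_add1 /=.
  have : \sum_(n <= i < n.*2) vm i.+1 <= \sum_(n <= i < n.*2) vm i.+1 * (n.*2 %/ i.+1)%:R.
    apply: ler_sum_nat => i /andP[i1 i2]; rewrite ler_peMr ?vm_ge0 // ler1n.
    by rewrite divn_gt0.
  lra.
rewrite !psum_lg_fact.
have E : (n.*2)`! = ('C(n.*2, n) * (n`! * n`!))%N.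
  by rewrite -addnn -(bin_fact (leq_addr n n)) addnK.
have C_gt0 : (0 < 'C(n.*2, n))%N by rewrite bin_gt0 -addnn leq_addr.
rewrite E !lgM ?muln_gt0 ?fact_gt0 ?C_gt0 //.
have : lg 'C(n.*2, n) <= lg (2 ^ n.*2)%N.
  have E2 : (2 ^ n.*2 = (1 + 1) ^ n.*2)%N by [].
  apply: le_lg; rewrite C_gt0 /= E2 expnDn.
  have nn : (n < n.*2.+1)%N by lia.
  rewrite (bigD1 (Ordinal nn)) //= !exp1n !muln1; exact: leq_addr.
rewrite lgX // -mul2n.
have := ler_wpM2l (ler0n R (2 * n)) le_lg2.
rewrite -[lg 2 *+ _]mulr_natl mulr1 natrM; lra.
Qed.

Lemma chebyshev x : psum vm x <= 6 * x%:R.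
Proof.
elim/ltn_ind: x => x IH.
case: x IH => [|[|x]] IH; first by rewrite psum0 mulr0.
  by rewrite psumS psum0 add0r /vm ppf1 mulr1.
pose n := uphalf x.+2.
have n1 : (n < x.+2)%N by rewrite /n; lia.
have n2 : (x.+2 <= n.*2)%N by rewrite /n; lia.
have n3 : (n.*2 <= x.+3)%N by rewrite /n; lia.
have := IH n n1; have := chebyshev_dyadic n.
have : psum vm x.+2 <= psum vm n.*2.
  rewrite -subr_ge0 psum_tail // sumr_ge0 // => i _; exact: vm_ge0.
have : 2 * n%:R <= x%:R + 3 :> R by rewrite -natrM -natrD ler_nat; lia.
have -> : x.+2%:R = x%:R + 2 :> R by rewrite -addn2 natrD.
move=> h1 h2 h3 h4.
have x0 : 0 <= x%:R :> R by [].
lra.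
Qed.

Lemma psum_lg_le x : (0 < x)%N -> x%:R * lg x - x%:R <= psum lg x <= x%:R * lg x.
Proof.
move=> x_gt0; apply/andP; split; last first.
  apply: (@le_trans _ _ (\sum_(1 <= n < x.+1) lg x)).
    by apply: ler_sum_nat => n /andP[n0 nx]; rewrite le_lg // n0.
  by rewrite sumr_const_nat subn1 mulr_natl.
elim: x x_gt0 => // x IH _; have [->|x_gt0] := posnP x.
  by rewrite psumS psum0 add0r lg1 mulr0; lra.
rewrite psumS; have := IH x_gt0; have /andP[s0 s1] := lg_step lg x_gt0.
have : x%:R * (lg x.+1 - lg x) <= 1.
  by apply: le_trans (ler_wpM2l (ler0n _ _) s1) _; rewrite divff // pnatr_eq0 -lt0n.
rewrite -natr1; lra.
Qed.

(** Mertens' first theorem: lg(x!) is sum_d vm(d) (x %/ d), and dropping the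
    fractional parts costs at most psum vm x, which is O(x). *)
Lemma mertens x : (0 < x)%N ->
  lg x - 1 <= psum (fun n => vm n / n%:R) x <= lg x + 6.
Proof.
move=> x_gt0; have x0 : 0 < x%:R :> R by rewrite ltr0n.
have /andP[t1 t2] := psum_lg_le x_gt0.
have E : x%:R * psum (fun n => vm n / n%:R) x = \sum_(1 <= d < x.+1) vm d * (x%:R / d%:R).
  by rewrite /psum mulr_sumr; apply: eq_bigr => d _; ring.
have h1 : psum lg x <= x%:R * psum (fun n => vm n / n%:R) x.
  rewrite E psum_lg; apply: ler_sum_nat => d /andP[d_gt0 _].
  rewrite ler_wpM2l ?vm_ge0 // ler_pdivlMr ?ltr0n // -natrM ler_nat; exact: leq_trunc_div.
have h2 : x%:R * psum (fun n => vm n / n%:R) x <= psum lg x + 6 * x%:R.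
  apply: (@le_trans _ _ (psum lg x + psum vm x)); last by have := chebyshev x; lra.
  rewrite E psum_lg /psum -big_split /=; apply: ler_sum_nat => d /andP[d_gt0 _].
  rewrite -[X in _ + X]mulr1 -mulrDr ler_wpM2l ?vm_ge0 // ler_pdivrMr ?ltr0n //.
  by rewrite natr1 -natrM ler_nat ltnW // ltn_ceil.
apply/andP; split.
  by rewrite -(ler_pM2l x0) mulrBr mulr1; apply: le_trans h1.
rewrite -(ler_pM2l x0) mulrDr; lra.
Qed.

Lemma sum_nat_ge (F : nat -> R) i m n : (forall j, (m <= j < n)%N -> 0 <= F j) ->
  (m <= i < n)%N -> F i <= \sum_(m <= j < n) F j.
Proof.
move=> F0 Hi; rewrite (big_rem i) ?mem_index_iota //= lerDl big_seq.
by apply: sumr_ge0 => j /mem_rem; rewrite mem_index_iota; apply: F0.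
Qed.

(** Over p^k with k > 1 the sum is dominated by that of lg p / p^2. *)
Lemma sum_vm_nonprime x :
  \sum_(1 <= n < x.+1 | ~~ prime n) vm n / n%:R <= 32.
Proof.
pose F p k : R := lg p / (p ^ k)%:R.
have F_ge0 p k : (0 < p)%N -> 0 <= F p k by move=> p0; rewrite divr_ge0 ?lg_ge0.
apply: (@le_trans _ _ (\sum_(1 <= n < x.+1) \sum_(2 <= p < x.+1) \sum_(2 <= k < x.+1)
   (if n == (p ^ k)%N then F p k else 0))).
  rewrite big_mkcond /=; apply: ler_sum_nat => n /andP[n_gt0 n_le].
  have G_ge0 : 0 <= \sum_(2 <= p < x.+1) \sum_(2 <= k < x.+1) (if n == (p ^ k)%N then F p k else 0).
    rewrite big_nat; apply: sumr_ge0 => p /andP[p2 _]; apply: sumr_ge0 => k _.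
    by case: ifP => // _; apply: F_ge0; lia.
  case: ifP => // nprime; rewrite /vm /ppf.
  case E: (primes n) => [|p [|q r]]; rewrite ?mul0r //.
  have p_in : p \in primes n by rewrite E inE.
  have /and3P[p_pr _ p_dv] : [&& prime p, (0 < n)%N & (p %| n)%N] by rewrite -mem_primes.
  have En : n = (p ^ logn p n)%N.
    by rewrite {1}(prod_prime_decomp n_gt0) prime_decompE E big_seq1.
  have k2 : (1 < logn p n)%N.
    case k: (logn p n) => [|[|//]]; move: nprime; rewrite En k ?expn0 ?expn1 ?p_pr //.
    by move: p_in; rewrite -logn_gt0 k.
  have p2 := prime_gt1 p_pr; have pn := dvdn_leq n_gt0 p_dv.
  have kn : (logn p n < n)%N by rewrite {2}En ltn_expl.
  have Hpos q k : (2 <= q < x.+1)%N -> 0 <= (if n == (q ^ k)%N then F q k else 0).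
    by move=> q1; case: ifP => // _; apply: F_ge0; lia.
  apply: le_trans (_ : _ <= \sum_(2 <= k < x.+1) (if n == (p ^ k)%N then F p k else 0)) _.
    apply: le_trans (sum_nat_ge (i := logn p n) _ _).
    - by rewrite -En eqxx /F -En.
    - by move=> k _; apply: Hpos; lia.
    - by lia.
  apply: (@sum_nat_ge (fun q => \sum_(2 <= k < x.+1) (if n == (q ^ k)%N then F q k else 0))).
    by move=> q Hq; apply: sumr_ge0 => k _; apply: Hpos.
  by lia.
rewrite exchange_big /=.
apply: (@le_trans _ _ (\sum_(2 <= p < x.+1) 16 * (rho p ^+ 2 / (p%:R * p.+1%:R)))).
  apply: ler_sum_nat => p /andP[p2 p_le]; rewrite exchange_big /=.
  have p0 : 0 < p%:R :> R by rewrite ltr0n; lia.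
  apply: (@le_trans _ _ (\sum_(2 <= k < x.+1) F p k)).
    apply: ler_sum_nat => k /andP[k2 _].
    have [Hin|Hout] := boolP ((p ^ k)%N \in index_iota 1 x.+1).
      rewrite (big_rem _ Hin) /= eqxx big_seq big1 ?addr0 // => n.
      by rewrite mem_rem_uniq ?iota_uniq // inE => /andP[/negPf -> _].
    rewrite big_seq big1 ?F_ge0 //; first by lia.
    by move=> n Hn; case: eqP => // En; rewrite -En Hn in Hout.
  have geo N : \sum_(2 <= k < N.+2) F p k <= lg p * (2 / p%:R ^+ 2) * (1 - (p%:R^-1) ^+ N).
    have lp : 0 <= lg p by rewrite lg_ge0 //; lia.
    elim: N => [|N IH]; first by rewrite big_geq // expr0 subrr mulr0.
    rewrite big_nat_recr //=; apply: le_trans (lerD IH (lexx _)) _.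
    rewrite /F natrX -!mulrA -mulrDr ler_wpM2l // !exprS.
    have : p%:R^-1 <= 2^-1 :> R by rewrite lef_pV2 ?posrE ?ltr0n ?ler_nat //; lia.
    have v0 : 0 < p%:R^-1 :> R by rewrite invr_gt0.
    rewrite expr0 !invfM -exprVn invr1; move: (p%:R^-1) v0 => v v0 v2.
    have y0 : 0 <= v ^+ N by rewrite exprn_ge0 // ltW.
    move: (v ^+ N) y0 => y y0.
    have : 0 <= (v * v) * y * (1 - 2 * v) by rewrite !mulr_ge0 ?(ltW v0) //; lra.
    lra.
  case: x p_le => [|x] p_le; first by lia.
  apply: le_trans (geo x) _.
  have lp := lg_rho lg (ltnW p2).
  have lp0 : 0 <= lg p by rewrite lg_ge0 // ltnW.
  apply: (@le_trans _ _ (lg p * (2 / p%:R ^+ 2))).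
    rewrite ler_piMr ?mulr_ge0 ?invr_ge0 ?exprn_ge0 ?(ltW p0) //.
    by rewrite gerBl exprn_ge0 // invr_ge0 ltW.
  apply: (@le_trans _ _ (4 * rho p ^+ 2 * (2 / p%:R ^+ 2))).
    rewrite ler_wpM2r ?mulr_ge0 ?invr_ge0 ?exprn_ge0 ?(ltW p0) //.
    apply: le_trans lp _; rewrite ler_wpM2l // expr2 ler_peMl ?rho_ge0 //.
    by rewrite rho_ge1 // ltnW.
  have -> : 4 * rho p ^+ 2 * (2 / p%:R ^+ 2) = 8 * rho p ^+ 2 * (p%:R * p%:R)^-1 by ring.
  rewrite (_ : 16 * _ = 8 * rho p ^+ 2 * (2 / (p%:R * p.+1%:R))); last by ring.
  rewrite ler_wpM2l ?mulr_ge0 ?exprn_ge0 ?rho_ge0 //.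
  rewrite -[leLHS]mul1r ler_pdivrMr ?mulr_gt0 // mulrAC ler_pdivlMr ?mulr_gt0 // mul1r.
  have : p.+1%:R <= 2 * p%:R :> R by rewrite -natrM ler_nat; lia.
  move: (p.+1%:R : R) => z Hz.
  have : p%:R * z <= p%:R * (2 * p%:R) by rewrite ler_pM2l.
  lra.
rewrite -mulr_sumr.
have [x1|x1] := leqP x 1; first by rewrite big_geq ?mulr0 //; lia.
have H := @sum_sqrt_tail R 2 x.+1.
have := H ltac:(lia).
have : 2 / rho 2 ^+ 2 <= 2 :> R.
  rewrite ler_pdivrMr ?exprn_gt0 ?rho_gt0 // ler_peMr //.
  by rewrite exprn_ege1 // rho_ge1.
lra.
Qed.
End Chebyshev.

(** * Nonvanishing for quadratic characters *)

Section Moebius.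
Variable V : comNzRingType.

Lemma multf_one n : multf (fun _ _ => 1 : V) n = 1.
Proof. by rewrite /multf big1. Qed.

Definition mu : nat -> V :=
  multf (fun _ k => if k is 0 then 1 else if k is 1 then -1 else 0).

Lemma conv_mu1 n : (0 < n)%N -> conv mu (fun=> 1) n = deltaf V n.
Proof.
move=> n_gt0; rewrite -multf_delta //.
rewrite -(@conv_multf V (fun _ k => if k is 0 then 1 else if k is 1 then -1 else 0)
          (fun _ _ => 1)) //; first by apply: eq_bigr => d _; rewrite multf_one.
move=> p k _; under eq_bigr => i _ do rewrite mulr1.
case: k => [|k]; first by rewrite big_ord1.
by rewrite !big_ord_recl /= big1 // addr0 subrr.
Qed.

Variable f : nat -> V.
Hypothesis f1 : f 1%N = 1.
Hypothesis fM : forall m n, (0 < m)%N -> (0 < n)%N -> f (m * n)%N = f m * f n.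

Lemma cmulX p k : (0 < p)%N -> f (p ^ k)%N = f p ^+ k.
Proof.
move=> p0; elim: k => [|k IH]; first by rewrite expn0 f1.
by rewrite expnS exprS fM ?expn_gt0 ?p0 // IH.
Qed.

(** Twisting by a completely multiplicative function commutes with convolution;
    this carries the identities for vm and mu over to characters. *)
Lemma conv_cmul (g h : nat -> V) n : (0 < n)%N ->
  conv (fun d => f d * g d) (fun d => f d * h d) n = f n * conv g h n.
Proof.
move=> n_gt0; rewrite /conv big_distrr /=; apply: eq_big_seq => d.
rewrite -dvdn_divisors // => dv; have d0 := dvdn_gt0 n_gt0 dv.
have q0 : (0 < n %/ d)%N by rewrite divn_gt0 // dvdn_leq.
have -> : f n = f d * f (n %/ d)%N by rewrite -(fM d0 q0) mulnC divnK.
by rewrite mulrACA.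
Qed.

Lemma multf_cmul n : (0 < n)%N -> multf (fun p k => f p ^+ k) n = f n.
Proof.
move: n; apply: prime_power_ind; first by rewrite multf1 f1.
move=> p k m p_pr k0 m0 co IH; have p0 := prime_gt0 p_pr.
by rewrite multf_pfactor // IH fM ?expn_gt0 ?p0 // cmulX.
Qed.
End Moebius.

Section RealCharacter.
Variable R : realType.

Lemma le_sum_subset (F : nat -> R) (s t : seq nat) : uniq s -> uniq t ->
  {subset s <= t} -> (forall n, n \in t -> 0 <= F n) ->
  \sum_(n <- s) F n <= \sum_(n <- t) F n.
Proof.
move=> us ut st F0; rewrite (bigID (fun n => n \in s) _ F (r := t)) /=.
rewrite -[X in _ <= X + _]big_filter [X in _ <= X + _](perm_big s) /=.
  rewrite lerDl big_seq_cond; apply: sumr_ge0 => n /andP[nt _]; exact: F0.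
apply: uniq_perm; rewrite ?filter_uniq // => n; rewrite mem_filter.
by case: (boolP (n \in s)) => //= /st.
Qed.

Variables (g : nat -> R) (K : R).
Hypothesis g1 : g 1%N = 1.
Hypothesis gM : forall m n, (0 < m)%N -> (0 < n)%N -> g (m * n)%N = g m * g n.
Hypothesis g_val : forall n, (0 < n)%N -> g n = 0 \/ g n = 1 \/ g n = -1.
Hypothesis Hg : forall x, `|psum g x| <= K.

Let f n := conv g (fun=> 1) n.

Let fE n : (0 < n)%N -> f n = multf (fun p k => \sum_(i < k.+1) g p ^+ i) n.
Proof.
move=> n_gt0; rewrite -(@conv_multf R (fun p k => g p ^+ k) (fun _ _ => 1)) //.
- apply: eq_big_seq => d; rewrite -dvdn_divisors // => dv.
  by rewrite multf_cmul ?(dvdn_gt0 n_gt0) // multf_one.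
- by move=> p; rewrite big_ord1.
by move=> p k _; apply: eq_bigr => i _; rewrite mulr1.
Qed.

Let geo_ge0 p k : (0 < p)%N -> 0 <= \sum_(i < k.+1) g p ^+ i.
Proof.
move=> p0; case: (g_val p0) => [->|[->|->]].
- by rewrite big_ord_recl expr0 big1 ?addr0 // => i _; rewrite exprS mul0r.
- by rewrite sumr_ge0 // => i _; rewrite expr1n.
suff : \sum_(i < k.+1) (-1) ^+ i = (~~ odd k)%:R :> R by move->.
elim: k => [|k IH]; first by rewrite big_ord1.
rewrite big_ord_recr /= IH -signr_odd /=; case: (odd k) => /=; rewrite ?expr0 ?expr1; lra.
Qed.

Let geo_ge1 p k : (0 < p)%N -> ~~ odd k -> 1 <= \sum_(i < k.+1) g p ^+ i.
Proof.
move=> p0 ek; case: (g_val p0) => [->|[->|->]].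
- by rewrite big_ord_recl expr0 big1 ?addr0 // => i _; rewrite exprS mul0r.
- rewrite big_ord_recl expr0 lerDl sumr_ge0 // => i _; rewrite expr1n //.
suff : \sum_(i < k.+1) (-1) ^+ i = (~~ odd k)%:R :> R by move->; rewrite ek.
elim: k {ek} => [|k IH]; first by rewrite big_ord1.
rewrite big_ord_recr /= IH -signr_odd /=; case: (odd k) => /=; rewrite ?expr0 ?expr1; lra.
Qed.

Let f_ge0 n : (0 < n)%N -> 0 <= f n.
Proof.
move=> n0; rewrite fE // /multf big_seq; apply: prodr_ge0 => p.
by rewrite mem_primes => /and3P[/prime_gt0 p0 _ _]; apply: geo_ge0.
Qed.

Let f_sqr m : (0 < m)%N -> 1 <= f (m * m)%N.
Proof.
move=> m0; rewrite fE ?muln_gt0 ?m0 // /multf big_seq.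
elim/big_rec: _ => // p y; rewrite mem_primes => /and3P[/prime_gt0 p0 _ _] y1.
rewrite lognM // -[1]mulr1; apply: ler_pM => //.
by apply: geo_ge1; rewrite // addnn odd_double.
Qed.

Let K_ge0 : 0 <= K. Proof. exact: le_trans (Hg 0). Qed.

(** The weight 1 - n / x smooths the count of multiples of d up to x, so the error
    is d / x instead of a constant. *)
Let T_bound x d : (0 < d <= x)%N ->
  `|\sum_(1 <= e < (x %/ d).+1) (1 - (d * e)%:R / x%:R) - (x%:R / (2 * d%:R) - 2^-1)| <= d%:R / x%:R :> R.
Proof.
move=> /andP[d0 dx]; set k := (x %/ d)%N.
have k0 : (0 < k)%N by rewrite divn_gt0.
have x0 : 0 < x%:R :> R by rewrite ltr0n (leq_trans d0).
have d0' : 0 < d%:R :> R by rewrite ltr0n.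
have -> : \sum_(1 <= e < k.+1) (1 - (d * e)%:R / x%:R) =
    k%:R - d%:R * k%:R * (k%:R + 1) / (2 * x%:R) :> R.
  elim: (k) => [|j IH]; first by rewrite big_geq // !(mulr0, mul0r) subr0.
  rewrite big_nat_recr //= IH natrM -natr1; field; exact: lt0r_neq0.
have [r1 r2] : d%:R * k%:R <= x%:R :> R /\ x%:R <= d%:R * (k%:R + 1) :> R.
  by rewrite natr1 -!natrM !ler_nat mulnC leq_trunc_div mulnC ltnW // ltn_ceil.
move: (k%:R : R) (d%:R : R) (x%:R : R) r1 r2 x0 d0' => u a b r1 r2 b0 a0.
have -> : u - a * u * (u + 1) / (2 * b) - (b / (2 * a) - 2^-1) =
  (b - a * u) * (a * (u + 1) - b) / (2 * (a * b)).
  by field; rewrite ?lt0r_neq0.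
have h1 : 0 <= b - a * u by lra.
have h2 : 0 <= a * (u + 1) - b by lra.
rewrite ger0_norm ?divr_ge0 ?mulr_ge0 ?(ltW a0) ?(ltW b0) //.
rewrite ler_pdivrMr ?mulr_gt0 //.
have -> : a / b * (2 * (a * b)) = 2 * (a * a) by field; rewrite lt0r_neq0.
have h3 : (b - a * u) * (a * (u + 1) - b) <= a * a.
  by apply: ler_pM => //; lra.
have : 0 <= a * a by rewrite mulr_ge0 // ltW.
lra.
Qed.

Hypothesis HB : forall D, (0 < D)%N -> `|psum (fun n => g n / n%:R) D| <= K / D%:R.

Let weighted_sum x := \sum_(1 <= n < x.+1) f n * (1 - n%:R / x%:R).

(** Dirichlet hyperbola method: divisors d <= D are summed over their cofactor, and
    the others are grouped by the cofactor e < x / D. *)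
Let weighted_split x D : (0 < x)%N -> (0 < D <= x)%N ->
  weighted_sum x =
   \sum_(1 <= d < D.+1) g d * \sum_(1 <= e < (x %/ d).+1) (1 - (d * e)%:R / x%:R) +
   \sum_(1 <= e < (x %/ D).+1) \sum_(D <= d < maxn D (x %/ e)) g d.+1 * (1 - (d.+1 * e)%:R / x%:R).
Proof.
move=> x0 /andP[D0 Dx].
have -> : weighted_sum x = \sum_(1 <= d < x.+1) \sum_(1 <= e < (x %/ d).+1)
    g d * (1 - (d * e)%:R / x%:R).
  rewrite -(divisors_sum_exchange (fun d e => g d * (1 - (d * e)%:R / x%:R))).
  apply: eq_big_nat => n /andP[n0 _]; rewrite /f /conv mulr_suml.
  apply: eq_big_seq => d; rewrite -dvdn_divisors // => dv.
  by rewrite mulr1 [(d * _)%N]mulnC divnK.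
rewrite (big_cat_nat (n := D.+1)) //=; congr (_ + _).
  by apply: eq_bigr => d _; rewrite mulr_sumr.
have step d : (D < d)%N -> (\sum_(1 <= e < (x %/ d).+1) g d * (1 - (d * e)%:R / x%:R) =
    \sum_(1 <= e < (x %/ D).+1 | (d * e <= x)%N) g d * (1 - (d * e)%:R / x%:R)).
  move=> Dd; have d0 : (0 < d)%N by lia.
  rewrite (big_nat_widen _ _ (x %/ D).+1); last by rewrite ltnS leq_div2l // ltnW.
  rewrite big_nat_cond [RHS]big_nat_cond; apply: eq_bigl => e.
  by case: (_ <= _ < _)%N => //=; rewrite ltnS leq_divRL // mulnC.
under eq_big_nat => d /andP[Dd _] do rewrite step //.
rewrite (exchange_big_dep xpredT) //=.
apply: eq_big_nat => e /andP[e0 eD].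
have De : (D <= x %/ e)%N.
  by move: eD; rewrite ltnS !leq_divRL // mulnC.
rewrite (maxn_idPr De) -[RHS](big_add1 _ _ D (x %/ e).+1 xpredT (fun d => g d * (1 - (d * e)%:R / x%:R))).
rewrite [RHS](big_nat_widen _ _ x.+1); last by rewrite ltnS leq_div.
rewrite big_nat_cond [RHS]big_nat_cond; apply: eq_bigl => d.
by case: (_ <= _ < _)%N => //=; rewrite ltnS leq_divRL // mulnC.
Qed.

Let tail_sum x D e : (0 < x)%N -> (0 < D)%N -> (0 < e)%N ->
  `|\sum_(D <= d < maxn D (x %/ e)) g d.+1 * (1 - (d.+1 * e)%:R / x%:R)| <= 2 * K.
Proof.
move=> x0 D0 e0; set N := maxn D _.
have x0' : 0 < x%:R :> R by rewrite ltr0n.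
have e0' : 0 < e%:R :> R by rewrite ltr0n.
have DN : (D <= N)%N by rewrite leq_maxl.
have [ND|ND] := leqP N D; first by rewrite big_geq // normr0 mulr_ge0.
have Nx : (N * e <= x)%N.
  have -> : N = (x %/ e)%N by move: ND; rewrite /N; lia.
  exact: leq_trunc_div.
pose w d : R := 1 - (d * e)%:R / x%:R.
have wS i : w i.+1 - w i = - (e%:R / x%:R).
  by rewrite /w -addn1 mulnDl mul1n natrD; field; rewrite lt0r_neq0.
have w_ge0 i : (i <= N)%N -> 0 <= w i.
  move=> iN; rewrite subr_ge0 ler_pdivrMr // mul1r ler_nat; nia.
have w_le1 i : w i <= 1 by rewrite gerBl divr_ge0.
rewrite (abel_summation g w) //.
under eq_bigr => i _ do rewrite wS mulrN.
rewrite sumrN opprK -mulr_suml.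
have hA : `|psum g N * w N| <= K * w N.
  by rewrite normrM [`|w N|]ger0_norm ?w_ge0 // ler_wpM2r ?w_ge0.
have hB : `|psum g D * w D| <= K * w D.
  by rewrite normrM [`|w D|]ger0_norm ?w_ge0 // ler_wpM2r ?w_ge0.
have hC : `|(\sum_(D <= i < N) psum g i) * (e%:R / x%:R)| <= K * (w D - w N).
  rewrite normrM [X in _ * X]ger0_norm ?divr_ge0 //.
  have -> : w D - w N = (N - D)%:R * (e%:R / x%:R).
    rewrite /w natrB // !natrM; field; exact: lt0r_neq0.
  rewrite [leRHS]mulrA ler_wpM2r ?divr_ge0 //.
  apply: le_trans (ler_norm_sum _ _ _) _.
  apply: (@le_trans _ _ (\sum_(D <= i < N) K)); first by apply: ler_sum => i _; apply: Hg.
  by rewrite sumr_const_nat mulr_natr.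
have h1 := ler_normD (psum g N * w N - psum g D * w D) ((\sum_(D <= i < N) psum g i) * (e%:R / x%:R)).
have h2 := ler_normB (psum g N * w N) (psum g D * w D).
have h3 := ler_wpM2l K_ge0 (w_le1 D).
lra.
Qed.

Let upper y : (0 < y)%N -> weighted_sum (y ^ 3) <= (3 * K + 1) * y%:R + K.
Proof.
move=> y0; have y0' : 0 < y%:R :> R by rewrite ltr0n.
have y1 : 1 <= y%:R :> R by rewrite ler1n.
have yn : y%:R != 0 :> R by rewrite lt0r_neq0.
set x := (y ^ 3)%N; pose D := (y ^ 2)%N.
have x0 : (0 < x)%N by rewrite expn_gt0 y0.
have D0 : (0 < D)%N by rewrite expn_gt0 y0.
have Dx : (D <= x)%N by rewrite leq_pexp2l.
have xD : (x %/ D = y)%N by rewrite /x expnS mulnK.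
have Ex : x%:R = y%:R ^+ 3 :> R by rewrite natrX.
have ED : D%:R = y%:R ^+ 2 :> R by rewrite natrX.
rewrite (@weighted_split x D) ?D0 // xD; apply: le_trans (ler_norm _) _.
apply: le_trans (ler_normD _ _) _.
have hb : `|\sum_(1 <= e < y.+1) \sum_(D <= d < maxn D (x %/ e)) g d.+1 * (1 - (d.+1 * e)%:R / x%:R)| <= 2 * K * y%:R.
  apply: le_trans (ler_norm_sum _ _ _) _.
  apply: (@le_trans _ _ (\sum_(1 <= e < y.+1) 2 * K)).
    by apply: ler_sum_nat => e /andP[e0 _]; apply: tail_sum.
  by rewrite sumr_const_nat subn1 mulr_natr.
pose T d : R := \sum_(1 <= e < (x %/ d).+1) (1 - (d * e)%:R / x%:R).
have ha : `|\sum_(1 <= d < D.+1) g d * T d| <= K * y%:R / 2 + K / 2 + y%:R.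
  have -> : \sum_(1 <= d < D.+1) g d * T d =
     x%:R / 2 * psum (fun n => g n / n%:R) D - psum g D / 2 +
     \sum_(1 <= d < D.+1) g d * (T d - (x%:R / (2 * d%:R) - 2^-1)).
    rewrite /psum mulr_sumr mulr_suml -sumrB -big_split /=.
    apply: eq_big_nat => d /andP[d0 _]; rewrite invfM; ring.
  have e1 : `|\sum_(1 <= d < D.+1) g d * (T d - (x%:R / (2 * d%:R) - 2^-1))| <= y%:R.
    apply: le_trans (ler_norm_sum _ _ _) _.
    apply: (@le_trans _ _ (\sum_(1 <= d < D.+1) D%:R / x%:R)).
      apply: ler_sum_nat => d /andP[d0 dD]; rewrite normrM.
      have Hd := @T_bound x d; have := Hd ltac:(lia).
      have : `|g d| <= 1.
        by case: (g_val d0) => [->|[->|->]]; rewrite ?normrN ?normr0 ?normr1.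
      have : d%:R / x%:R <= D%:R / x%:R :> R by rewrite ler_wpM2r ?invr_ge0 ?ler_nat.
      move=> h1 h2 h3; apply: le_trans h1; rewrite -[leRHS]mul1r.
      by apply: ler_pM.
    rewrite sumr_const_nat subn1 /= -[_ *+ D]mulr_natr Ex ED.
    by rewrite le_eqVlt (_ : _ == _) //; apply/eqP; field.
  have e2 : `|x%:R / 2 * psum (fun n => g n / n%:R) D| <= K * y%:R / 2.
    rewrite normrM ger0_norm ?divr_ge0 //.
    apply: le_trans (ler_wpM2l _ (HB D0)) _; first by rewrite divr_ge0.
    by rewrite Ex ED le_eqVlt (_ : _ == _) //; apply/eqP; field.
  have e3 : `|psum g D / 2| <= K / 2.
    have := Hg D; rewrite !ler_norml; lra.
  apply: le_trans (ler_normD _ _) _; apply: lerD => //.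
  by apply: le_trans (ler_normB _ _) _; apply: lerD.
apply: le_trans (lerD ha hb) _.
have : 0 <= K * y%:R by rewrite mulr_ge0.
have := K_ge0; lra.
Qed.

Let lower k : (0 < k)%N -> k%:R ^+ 3 <= weighted_sum ((2 * k ^ 2) ^ 3).
Proof.
move=> k0; set x := (_ ^ 3)%N.
have x0 : 0 < x%:R :> R by rewrite ltr0n expn_gt0 muln_gt0 expn_gt0 k0.
pose M := (2 * k ^ 3)%N.
have MM : (2 * (M * M) = x)%N by rewrite /M /x; ring.
apply: (@le_trans _ _ (\sum_(n <- [seq (m * m)%N | m <- index_iota 1 M.+1]) f n * (1 - n%:R / x%:R))).
  rewrite big_map.
  apply: (@le_trans _ _ (\sum_(1 <= m < M.+1) 2^-1)).
    by rewrite sumr_const_nat subn1 /= -[_ *+ M]mulr_natr /M natrM natrX; lra.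
  apply: ler_sum_nat => m /andP[m0 mM].
  have h1 := f_sqr m0.
  have h2 : 2^-1 <= 1 - (m * m)%:R / x%:R :> R.
    suff : (m * m)%:R / x%:R <= 2^-1 :> R by lra.
    rewrite ler_pdivrMr // -ler_pdivrMl ?invr_gt0 // invrK -natrM ler_nat -MM.
    by rewrite leq_mul2l /= leq_mul.
  by rewrite -[2^-1]mul1r; apply: ler_pM => //; rewrite invr_ge0.
rewrite /weighted_sum; apply: (@le_sum_subset (fun n => f n * (1 - n%:R / x%:R))); rewrite ?iota_uniq //.
- by rewrite map_inj_uniq ?iota_uniq // => i j H; nia.
- move=> n /mapP[m]; rewrite !mem_index_iota => /andP[m0 mM] ->.
  rewrite muln_gt0 m0 /= ltnS -MM; apply: leq_trans (_ : M * M <= _)%N; last by lia.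
  by apply: leq_mul.
move=> n; rewrite mem_index_iota => /andP[n0 nx]; rewrite mulr_ge0 ?f_ge0 //.
by rewrite subr_ge0 ler_pdivrMr // mul1r ler_nat.
Qed.

(** A quadratic character has L(1) <> 0: the divisor sums of g are nonnegative
    and at least 1 on squares, so their sums over n <= y^3 with weights 1 - n / y^3
    exceed a multiple of y^(3/2), whereas L(1) = 0 would bound them by a multiple
    of y. The values y = 2 k^2 make the number of squares an exact power of k. *)
Lemma real_nonvanishing : False.
Proof.
pose k := (Num.truncn (8 * K + 4)).+1.
have hk : 8 * K + 4 < k%:R by rewrite /k truncnS_gt.
have k0 : (0 < k)%N by [].
have y0 : (0 < 2 * k ^ 2)%N by rewrite muln_gt0 expn_gt0 k0.
have := le_trans (lower k0) (upper y0); rewrite natrM natrX.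
have k1 : 1 <= k%:R :> R by rewrite ler1n.
move: (k%:R : R) hk k1 => z hz z1; have K0 := K_ge0.
have : (8 * K + 4) * z ^+ 2 < z * z ^+ 2 by rewrite ltr_pM2r // exprn_gt0; lra.
have : 1 <= z ^+ 2 by rewrite exprn_ege1.
have -> : z ^+ 3 = z * z ^+ 2 by rewrite exprS.
move: (z ^+ 2) => t t1.
have : K <= K * t by rewrite ler_peMr.
lra.
Qed.
End RealCharacter.

(** * Dirichlet characters and their orthogonality *)

Section Characters.
Variables (R : realType) (W : nat).
Hypothesis W_gt1 : (1 < W)%N.

Record dchar (psi : nat -> R[i]) : Prop := DChar {
  dchar1 : psi 1%N = 1;
  dcharM : forall m n, psi (m * n)%N = psi m * psi n;
  dcharD : forall n, psi (n + W)%N = psi n;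
  dchar0 : forall n, ~~ coprime W n -> psi n = 0;
  dchar_nrm : forall n, coprime W n -> nrm (psi n) = 1
}.

Lemma dchar_le1 psi n : dchar psi -> nrm (psi n) <= 1.
Proof.
move=> ch; have [co|nco] := boolP (coprime W n); first by rewrite dchar_nrm.
by rewrite dchar0 // nrm0.
Qed.

Lemma dchar_mod psi n : dchar psi -> psi (n %% W)%N = psi n.
Proof.
move=> ch; rewrite {2}(divn_eq n W); elim: (n %/ W)%N => [|k IH]; first by rewrite mul0n.
by rewrite mulSn -addnA addnC dcharD.
Qed.

Lemma dchar_mul psi1 psi2 : dchar psi1 -> dchar psi2 -> dchar (fun n => psi1 n * psi2 n).
Proof.
move=> c1 c2; split=> [|m n|n|n co|n co].
- by rewrite !dchar1 ?mulr1.
- by rewrite (dcharM c1) (dcharM c2) mulrACA.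
- by rewrite (dcharD c1) (dcharD c2).
- by rewrite (dchar0 c1) // mul0r.
by rewrite nrmM !dchar_nrm ?mulr1.
Qed.

Lemma primitive_root_exists n : (0 < n)%N -> exists z : R[i], n.-primitive_root z.
Proof.
pose p : {poly R[i]} := 'X^n - 1; have [r Dp] := closed_field_poly_normal p.
move=> n_gt0; rewrite (monicP _) ?monicXnsubC // scale1r in Dp.
have rn1: all n.-unity_root r by apply/allP=> z; rewrite -root_prod_XsubC -Dp.
have sz_r: (n < (size r).+1)%N.
  by rewrite -(size_prod_XsubC r id) -Dp size_XnsubC.
have [|z] := hasP (has_prim_root n_gt0 rn1 _ sz_r); last by exists z.
by rewrite -separable_prod_XsubC -Dp separable_Xn_sub_1 // pnatr_eq0 -lt0n.
Qed.

Lemma nrm_unity_root n (z : R[i]) : (0 < n)%N -> z ^+ n = 1 -> nrm z = 1.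
Proof.
move=> n0 zn; apply/eqP; rewrite -(@pexpr_eq1 _ _ n) ?nrm_ge0 //.
by rewrite -nrmX zn nrm1.
Qed.

Local Notation G := {unit 'Z_W}.

Let N := (2 * #|[set: G]|)%N.

(** The dual group of (Z/W)^*, with exponents modulo N in place of N-th roots of
    unity: this makes it a finite type over which characters can be summed. *)
Definition homb (h : {ffun G -> 'Z_N}) :=
  [forall x, forall y, h (x * y)%g == h x + h y].

Let N_gt1 : (1 < N)%N.
Proof.
have : (0 < #|[set: G]|)%N by apply: cardG_gt0.
by rewrite /N; move: #|_| => k; lia.
Qed.

(** The irreducible characters of an abelian group are linear, and the intersection
    of their kernels is trivial. *)
Lemma homb_separates (u : G) : u != 1%g -> exists2 h, homb h & h u != 0.
Proof.
move=> u1.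
have [z zP] := C_prim_root_exists (ltnW N_gt1).
have abG : abelian [set: G] by exact: units_Zp_abelian.
have [i Hi] : exists i : Iirr [set: G], 'chi_i u != 1.
  apply/existsP; rewrite -[X in is_true X]negbK; apply/negP => /existsPn H.
  have : u \in \bigcap_(i : Iirr [set: G]) cfker 'chi[[set: G]]_i.
    apply/bigcapP => i _; rewrite cfkerEirr inE.
    have /eqP := negbNE (H i) => ->; rewrite lin_char1 //; exact: (char_abelianP _ abG).
  by rewrite TI_cfker_irr inE (negPf u1).
have lin := char_abelianP _ abG i.
have root x : exists k : 'I_N, 'chi_i x == z ^+ k.
  suff /(prim_rootP zP)[k Ek] : 'chi_i x ^+ N = 1 by exists k; apply/eqP; rewrite Ek.
  have /dvdnP[k ->] : (#[x]%g %| N)%N by rewrite dvdn_mull // order_dvdG ?inE.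
  by rewrite mulnC exprM lin_char_unity_root ?inE // expr1n.
pose e x := xchoose (root x).
have eP x : 'chi_i x = z ^+ e x by apply/eqP; exact: (xchooseP (root x)).
pose h : {ffun G -> 'Z_N} := [ffun x => inZp (e x)].
have hP x : 'chi_i x = z ^+ (h x).
  by rewrite eP ffunE /= Zp_cast // modn_small.
exists h; last by apply: contraNneq Hi => h0; rewrite hP h0.
apply/forallP => x; apply/forallP => y; apply/eqP/val_inj => /=.
have : z ^+ h (x * y)%g = z ^+ (h x + h y)%N by rewrite exprD -!hP lin_charM ?inE.
move/eqP; rewrite (eq_prim_root_expr zP) => /eqP.
rewrite [X in X = _]modn_small; last by rewrite -[X in (_ < X)%N](Zp_cast N_gt1).
by move=> ->; congr (_ %% _)%N; rewrite Zp_cast.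
Qed.

Lemma hombD h1 h2 : homb h1 -> homb (h1 + h2) = homb h2.
Proof.
move=> /forallP H1; apply/forallP/forallP => H2 x; apply/forallP => y; apply/eqP.
  have /eqP := forallP (H2 x) y; have /eqP := forallP (H1 x) y; rewrite !ffunE => ->.
  by rewrite addrACA => /addrI.
by rewrite !ffunE (eqP (forallP (H1 x) y)) (eqP (forallP (H2 x) y)) addrACA.
Qed.

Lemma homb0 : homb 0.
Proof. by apply/forallP => x; apply/forallP => y; rewrite !ffunE addr0. Qed.

Section Orthogonality.
Variables (zeta : R[i]).
Hypothesis zetaP : N.-primitive_root zeta.

Let zetaD (i j : 'Z_N) : zeta ^+ (i + j)%R = zeta ^+ i * zeta ^+ j.
Proof.
rewrite -exprD /= -(prim_expr_mod zetaP (i + j)%N); congr (_ ^+ (_ %% _)%N).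
by rewrite Zp_cast.
Qed.

Let zeta_nrm k : nrm (zeta ^+ k) = 1.
Proof.
rewrite nrmX (@nrm_unity_root N) ?expr1n ?(prim_expr_order zetaP) //; exact: ltnW.
Qed.

Definition unitW (n : nat) : G := odflt 1%g (insub (n%:R : 'Z_W) : option G).

Definition charW (h : {ffun G -> 'Z_N}) n : R[i] := if coprime W n then zeta ^+ h (unitW n) else 0.

Let unitWE n : coprime W n -> val (unitW n) = n%:R.
Proof. by move=> co; rewrite /unitW insubT // unitZpE. Qed.

Let unitWM m n : coprime W m -> coprime W n -> unitW (m * n) = (unitW m * unitW n)%g.
Proof.
move=> cm cn; apply: val_inj; rewrite unitWE ?coprimeMr ?cm //.
by rewrite /= -[RHS]/(val (unitW m) * val (unitW n)) !unitWE // natrM.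
Qed.

Lemma charW_dchar h : homb h -> dchar (charW h).
Proof.
move=> /forallP Hh; have hM x y : h (x * y)%g = h x + h y by apply/eqP/(forallP (Hh x)).
have h1 : h 1%g = 0 by have /eqP := hM 1%g 1%g; rewrite mulg1 -subr_eq subrr eq_sym => /eqP.
split=> [|m n|n|n co|n co].
- rewrite /charW coprimen1; suff -> : unitW 1 = 1%g by rewrite h1 expr0.
  by apply: val_inj; rewrite unitWE ?coprimen1.
- rewrite /charW coprimeMr; case: (boolP (coprime W m)) => [cm|]; last by rewrite mul0r.
  case: (boolP (coprime W n)) => [cn|]; last by rewrite mulr0.
  by rewrite /= unitWM // hM zetaD.
- have cE : coprime W (n + W) = coprime W n by rewrite /coprime gcdnDr.
  rewrite /charW cE; case: ifP => // co; congr (zeta ^+ h _); apply: val_inj.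
  by rewrite !unitWE ?cE // natrD (pchar_Zp W_gt1) addr0.
- by rewrite /charW (negPf co).
by rewrite /charW co zeta_nrm.
Qed.

(** If n is not 1 modulo W, translation by a homomorphism that does not vanish at n
    multiplies the sum by a factor different from 1. *)
Lemma charW_sum n : \sum_(h | homb h) charW h n =
  if (n == 1 %[mod W])%N then #|homb|%:R else 0.
Proof.
have [co|nco] := boolP (coprime W n); last first.
  rewrite big1 => [|h _]; last by rewrite /charW (negPf nco).
  case: eqP => // /eqP E; case/negP: nco.
  by rewrite -coprime_modr (eqP E) modn_small // coprimen1.
have Eu : (n == 1 %[mod W])%N = (unitW n == 1%g).
  by rewrite -val_eqE /= unitWE // -(inj_eq val_inj) /= !val_Zp_nat // Zp_cast.
under eq_bigr => h _ do rewrite /charW co.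
rewrite Eu; case: eqP => [->|/eqP u1].
  rewrite -sum1_card natr_sum; apply: eq_big => // h /forallP Hh.
  have /eqP/eqP := forallP (Hh 1%g) 1%g.
  by rewrite mulg1 -subr_eq subrr eq_sym => /eqP ->.
have [h0 Hh0 h0u] := homb_separates u1.
apply/eqP; have := subrr (\sum_(h | homb h) zeta ^+ h (unitW n)).
rewrite {1}(reindex_inj (addrI h0)) /=.
rewrite {1}(eq_bigl homb) => [|h]; last exact: hombD.
under eq_bigr => h _ do rewrite ffunE zetaD.
rewrite -mulr_sumr -[X in _ - X]mul1r -mulrBl => /eqP.
rewrite mulf_eq0 => /orP[|//]; rewrite subr_eq0 -(expr0 zeta) (eq_prim_root_expr zetaP).
rewrite mod0n modn_small; last by rewrite -[X in (_ < X)%N](Zp_cast N_gt1).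
by move=> /eqP h00; case/eqP: h0u; apply: val_inj.
Qed.
End Orthogonality.
End Characters.

(** * Prime power sums of Dirichlet characters *)

Section Bounded.
Variable R : realType.
Implicit Types f g : nat -> R[i].

Lemma bounded_ge0 f : bounded f ->
  exists2 K, 0 <= K & forall x, (0 < x)%N -> nrm (f x) <= K.
Proof.
move=> [K H]; exists K => //; exact: le_trans (nrm_ge0 _) (H 1%N isT).
Qed.

Lemma boundedD f g : bounded f -> bounded g -> bounded (fun x => f x + g x).
Proof.
move=> [K Hf] [L Hg]; exists (K + L) => x x0.
by apply: le_trans (nrmD _ _) _; rewrite lerD ?Hf ?Hg.
Qed.

Lemma boundedM c f : bounded f -> bounded (fun x => c * f x).
Proof.
move=> [K Hf]; exists (nrm c * K) => x x0.
by rewrite nrmM ler_wpM2l ?nrm_ge0 ?Hf.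
Qed.

Lemma bounded_sum (I : Type) (r : seq I) (P : pred I) (F : I -> nat -> R[i]) :
  (forall i, P i -> bounded (F i)) -> bounded (fun x => \sum_(i <- r | P i) F i x).
Proof.
move=> H; elim: r => [|i r IH].
  by exists 0 => x _; rewrite big_nil nrm0.
have [Pi|Pi] := boolP (P i).
  have [K HK] := boundedD (H i Pi) IH; exists K => x x0; rewrite big_cons Pi; exact: HK.
have [K HK] := IH; exists K => x x0; rewrite big_cons (negPf Pi); exact: HK.
Qed.

Lemma eq_bounded f g : (forall x, (0 < x)%N -> f x = g x) -> bounded f -> bounded g.
Proof. by move=> E [K H]; exists K => x x0; rewrite -E // H. Qed.

(** 3 + 4 cos + cos 2, in the form that applies to character values. *)
Lemma three_four_one (z : R[i]) : z = 0 \/ nrm z = 1 ->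
  0 <= 6 + 8 * complex.Re z + 2 * complex.Re (z ^+ 2).
Proof.
case=> [->|].
  by rewrite expr0n /= !mulr0 !addr0.
move=> H; have -> : complex.Re (z ^+ 2) = complex.Re z ^+ 2 - complex.Im z ^+ 2.
  by rewrite expr2; case: (z) => a b /=; rewrite -!expr2.
have E : complex.Re z ^+ 2 + complex.Im z ^+ 2 = 1.
  move: H; case: (z) => a b; rewrite /nrm /= => H.
  by have := sqr_sqrtr (addr_ge0 (sqr_ge0 a) (sqr_ge0 b)); rewrite H expr1n => <-.
have -> : 6 + 8 * complex.Re z + 2 * (complex.Re z ^+ 2 - complex.Im z ^+ 2) =
  4 * (complex.Re z + 1) ^+ 2 by lra.
by rewrite mulr_ge0 ?sqr_ge0.
Qed.
End Bounded.

Section DirichletSeries.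
Variables (R : realType) (lg : logarithm R) (W : nat).
Hypothesis W_gt1 : (1 < W)%N.
Local Notation rho := (rho R).
Local Notation vm := (vm lg).

Definition nonprincipal (psi : nat -> R[i]) := exists2 n, coprime W n & psi n != 1.

Lemma periodic_sum (f : nat -> R[i]) x : (forall n, f (n + W)%N = f n) ->
  \sum_(x <= i < x + W) f i = \sum_(0 <= i < W) f i.
Proof.
move=> fP; elim: x => [|x IH]; first by rewrite add0n.
have xW : (x < x + W)%N by lia.
by rewrite -IH [in RHS](big_ltn xW) addSn big_nat_recr //= fP addrC.
Qed.

Lemma dchar_sum0 psi : dchar W psi -> nonprincipal psi -> \sum_(0 <= i < W) psi i = 0.
Proof.
move=> ch [n0 co n01].
have W0 : (0 < W)%N by exact: ltnW.
pose s (i : 'I_W) : 'I_W := Ordinal (ltn_pmod (n0 * i) W0).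
have s_inj : injective s.
  have key (i j : 'I_W) : (i <= j)%N -> s i = s j -> i = j.
    move=> ij /(congr1 val) /= /esym/eqP; rewrite eqn_mod_dvd ?leq_mul2l ?ij ?orbT //.
    rewrite -mulnBr Gauss_dvdr // => dv; apply: val_inj => /=.
    have := ltn_ord j; have [|pos] := posnP (j - i); first by lia.
    have := dvdn_leq pos dv; lia.
  by move=> i j E; case/orP: (leq_total i j) => ij; [|apply/esym]; apply: key.
rewrite big_mkord; have := subrr (\sum_(i < W) psi i).
rewrite {1}(reindex_inj s_inj) /=.
under eq_bigr => i _ do rewrite (dchar_mod _ ch) (dcharM ch).
rewrite -mulr_sumr -[X in _ - X]mul1r -mulrBl => /eqP.
by rewrite mulf_eq0 subr_eq0 (negPf n01) => /eqP.
Qed.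

Lemma dchar_psum psi x : dchar W psi -> nonprincipal psi -> nrm (psum psi x) <= W%:R.
Proof.
move=> ch np; elim/ltn_ind: x => x IH.
have [xW|Wx] := ltnP x W.
  apply: le_trans (nrm_sum _ _ _) _.
  apply: (@le_trans _ _ (\sum_(1 <= i < x.+1) 1)).
    by apply: ler_sum => i _; exact: dchar_le1 ch.
  by rewrite sumr_const_nat subn1 /= ler_nat ltnW.
rewrite -(subnK Wx); set y := (x - W)%N.
have -> : psum psi (y + W) = psum psi y.
  apply/eqP; rewrite -subr_eq0 psum_tail ?leq_addr //.
  rewrite (@periodic_sum (fun i => psi i.+1)) => [|n]; last by rewrite -addSn (dcharD ch).
  have := periodic_sum 1 (dcharD ch); rewrite add1n big_add1 /= => ->.
  by rewrite dchar_sum0.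
by apply: IH; lia.
Qed.

Definition Echar (psi : nat -> R[i]) := psum (fun n => psi n * (vm n)%:C%C / n%:R).

(** The fourth root is unbounded because it dominates the logarithm. *)
Lemma rho_large (K e : R) : 0 <= K -> 0 < e -> exists2 n, (0 < n)%N & K / rho n ^+ 2 <= e.
Proof.
move=> K0 e0; have [n n0 Hn] := lg_unbounded lg (4 * (K / e)).
exists n => //; have := lg_rho lg n0 => H.
have Hr : K / e < rho n by lra.
have r1 := rho_ge1 R n0; have r0 := rho_gt0 R n0.
rewrite ler_pdivrMr ?exprn_gt0 // mulrC -ler_pdivrMr //.
apply: le_trans (ltW Hr) _; by rewrite expr2 ler_peMl // ltW.
Qed.

Lemma nrm_mu n : nrm (mu R[i] n) <= 1.
Proof.
rewrite /mu /multf; elim/big_rec: _ => [|p y _ IH]; first by rewrite nrm1.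
rewrite nrmM; apply: mulr_ile1; rewrite ?nrm_ge0 //.
by case: (logn p n) => [|[|k]]; rewrite ?nrmN ?nrm1 ?nrm0.
Qed.

(** The dichotomy with a = psi, lam = psi vm and m = psi mu. In the second case the
    rate of convergence to L = 0 is kept, for use with quadratic characters. *)
Lemma dchar_dichotomy psi : dchar W psi -> nonprincipal psi ->
  exists2 K, 0 <= K & bounded (Echar psi) \/
    (forall n, (0 < n)%N -> nrm (psum (fun n => psi n / n%:R) n) <= K / rho n ^+ 2) /\
    bounded (fun x => Echar psi x + (lg x)%:C%C).
Proof.
move=> ch np; pose K := W%:R + 6 : R.
have K0 : 0 <= K by rewrite addr_ge0.
have psiM : forall m n, (0 < m)%N -> (0 < n)%N -> psi (m * n)%N = psi m * psi n.
  by move=> m n _ _; rewrite (dcharM ch).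
have [||||||| L HL HE] := @dichotomy R lg psi (fun n => psi n * (vm n)%:C%C)
  (fun n => psi n * mu R[i] n) vm (fun _ => 1) K.
- move=> x; have [->|x0] := posnP x.
    by rewrite psum0 nrm0 mulr_ge0 ?exprn_ge0 ?rho_ge0.
  apply: le_trans (dchar_psum x ch np) _.
  apply: (@le_trans _ _ (K * 1)); first by rewrite /K mulr1 lerDl.
  by rewrite ler_wpM2l // exprn_ege1 // rho_ge1.
- move=> n n0; rewrite -(sum_vm lg n0) rmorph_sum /=.
  have := conv_cmul psiM (fun d => (vm d)%:C%C) (fun=> 1) n0.
  rewrite [X in _ = _ * X -> _](_ : _ = \sum_(d <- divisors n) (vm d)%:C%C); last first.
    by apply: eq_bigr => d _; rewrite mulr1.
  by move=> <-; apply: eq_bigr => d _; rewrite mulr1.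
- move=> n n0; have := conv_cmul psiM (mu R[i]) (fun=> 1) n0.
  rewrite conv_mu1 // => E.
  transitivity (psi n * deltaf R[i] n).
    by rewrite -E; apply: eq_bigr => d _; rewrite mulr1.
  by rewrite /deltaf; case: eqP => [->|_]; rewrite ?(dchar1 ch) ?mulr1 ?mulr0.
- move=> n; rewrite nrmM nrmR ger0_norm ?vm_ge0 //.
  by rewrite ler_piMl ?vm_ge0 ?(dchar_le1 _ ch).
- move=> x; apply: le_trans (chebyshev lg x) _.
  by rewrite ler_wpM2r // /K lerDr.
- move=> n; rewrite nrmM; apply: mulr_ile1; rewrite ?nrm_ge0 ?nrm_mu //.
  exact: dchar_le1 ch.
- move=> x; rewrite /psum sumr_const_nat subn1 /= -[_ *+ x]mulr_natr mul1r.
  by rewrite ler_peMl // /K; have : 0 <= W%:R :> R by []; lra.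
exists (8 * K); first by rewrite mulr_ge0.
case: HE => [|[L0 HE]]; [by left | right; split=> // n n0].
by have := HL n n0; rewrite L0 subr0.
Qed.

Lemma Re_inj (x : R) : complex.Re x%:C%C = x. Proof. by []. Qed.

Lemma Re_scale (x : R) (z : R[i]) : complex.Re (x%:C%C * z) = x * complex.Re z.
Proof. by case: z => a b /=; rewrite mul0r subr0. Qed.

Lemma ReD (z1 z2 : R[i]) : complex.Re (z1 + z2) = complex.Re z1 + complex.Re z2.
Proof. by case: z1 z2 => [a b] [c d]. Qed.

Lemma Re_sum (I : Type) (r : seq I) (F : I -> R[i]) :
  complex.Re (\sum_(i <- r) F i) = \sum_(i <- r) complex.Re (F i).
Proof. exact: (big_morph (@complex.Re R) ReD). Qed.

Lemma EcharE psi x : Echar psi x = psum (fun n => (vm n / n%:R)%:C%C * psi n) x.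
Proof.
by apply: eq_bigr => n _; rewrite rmorphM fmorphV rmorph_nat; ring.
Qed.

Lemma Re_Echar psi x : complex.Re (Echar psi x) = psum (fun n => vm n / n%:R * complex.Re (psi n)) x.
Proof.
by rewrite EcharE /psum Re_sum; apply: eq_bigr => n _; rewrite Re_scale.
Qed.

(** If Echar psi followed - lg x, then 3-4-1 would give
    6 lg x - 8 lg x + O(1) >= 0: since psi^2 is nonprincipal, its own sum is bounded
    above. *)
Lemma Echar_nonreal psi : dchar W psi -> nonprincipal psi ->
  nonprincipal (fun n => psi n ^+ 2) -> bounded (Echar psi).
Proof.
move=> ch np np2.
have ch2 : dchar W (fun n => psi n ^+ 2).
  by have := dchar_mul ch ch; under [fun n => _]funext => n do rewrite -expr2.
have [K K0 [//|[_ /bounded_ge0[C C0 HC]]]] := dchar_dichotomy ch np.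
have [C2 C20 HC2] : exists2 C2, 0 <= C2 & forall x, (0 < x)%N ->
    complex.Re (Echar (fun n => psi n ^+ 2) x) <= C2.
  have [K2 K20 [/bounded_ge0[C2 C20 H]|[_ /bounded_ge0[C2 C20 H]]]] := dchar_dichotomy ch2 np2.
    by exists C2 => // x x0; apply: le_trans (Re_le_nrm _) (H x x0).
  exists C2 => // x x0; have := le_trans (Re_le_nrm _) (H x x0).
  rewrite ReD Re_inj; have := lg_ge0 lg x0; lra.
exfalso.
have [x x0 Hx] := lg_unbounded lg (36 + 8 * C + 2 * C2).
have : 0 <= psum (fun n => vm n / n%:R * (6 + 8 * complex.Re (psi n) + 2 * complex.Re (psi n ^+ 2))) x.
  apply: sumr_ge0 => n _; rewrite mulr_ge0 ?divr_ge0 ?vm_ge0 // three_four_one //.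
  have [co|nco] := boolP (coprime W n); [right|left]; [exact: (dchar_nrm ch) | exact: (dchar0 ch)].
have -> : psum (fun n => vm n / n%:R * (6 + 8 * complex.Re (psi n) + 2 * complex.Re (psi n ^+ 2))) x
   = 6 * psum (fun n => vm n / n%:R) x + 8 * complex.Re (Echar psi x) +
     2 * complex.Re (Echar (fun n => psi n ^+ 2) x).
  rewrite !Re_Echar /psum !mulr_sumr -!big_split /=; apply: eq_bigr => n _; ring.
have /andP[_ m2] := mertens lg x0; have h2 := HC2 x x0.
have := le_trans (Re_le_nrm _) (HC x x0); rewrite ReD Re_inj => h1.
lra.
Qed.

(** Here psi^2 is principal and 3-4-1 gives nothing; [real_nonvanishing] excludes
    L(1) = 0. It needs the tails of sum psi(n) / n to be O(1 / D), which comes from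
    the boundedness of the sums of psi. *)
Lemma Echar_real psi : dchar W psi -> nonprincipal psi ->
  (forall n, coprime W n -> psi n ^+ 2 = 1) -> bounded (Echar psi).
Proof.
move=> ch np psi2; have [K K0 [//|[HB _]]] := dchar_dichotomy ch np.
exfalso; pose g n : R := complex.Re (psi n).
have val n : psi n = 0 \/ psi n = 1 \/ psi n = -1.
  have [co|nco] := boolP (coprime W n); last by left; exact: (dchar0 ch).
  right; have /eqP := psi2 n co.
  by rewrite sqrf_eq1 => /orP[/eqP|/eqP]; [left|right].
have gE n : psi n = (g n)%:C%C.
  by rewrite /g; case: (val n) => [->|[->|->]] //=; apply/eqP; rewrite eq_complex /= ?oppr0 !eqxx.
have psum_g x : psum psi x = (psum g x)%:C%C.
  by rewrite /psum rmorph_sum; apply: eq_bigr => n _.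
have Hg x : `|psum g x| <= W%:R by rewrite -nrmR -psum_g dchar_psum.
have Wpos : 0 < W%:R :> R by rewrite ltr0n ltnW.
apply: (@real_nonvanishing R g (2 * W%:R)).
- by rewrite /g (dchar1 ch).
- move=> m n _ _; have := gE (m * n)%N; rewrite (dcharM ch) (gE m) (gE n) -rmorphM.
  by move=> /complexI <-.
- move=> n _; rewrite /g; case: (val n) => [->|[->|->]] /=; rewrite ?oppr0; auto.
- by move=> x; apply: le_trans (Hg x) _; lra.
move=> D D0; apply/ler_addgt0Pr => e e0.
have D0' : 0 < D%:R :> R by rewrite ltr0n.
have tail N : (D <= N)%N ->
   `|psum (fun n => g n / n%:R) N - psum (fun n => g n / n%:R) D| <= 2 * W%:R / D%:R.
  move=> DN; have N0' : 0 < N%:R :> R by rewrite ltr0n (leq_trans D0).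
  rewrite psum_tail // (abel_summation g (fun n => n%:R^-1)) //.
  have h1 : `|psum g N / N%:R| <= W%:R / N%:R.
    by rewrite normrM [`|N%:R^-1|]gtr0_norm ?invr_gt0 // ler_wpM2r ?invr_ge0.
  have h2 : `|psum g D / D%:R| <= W%:R / D%:R.
    by rewrite normrM [`|D%:R^-1|]gtr0_norm ?invr_gt0 // ler_wpM2r ?invr_ge0.
  have h3 : `|\sum_(D <= i < N) psum g i * (i.+1%:R^-1 - i%:R^-1)| <= W%:R / D%:R - W%:R / N%:R.
    apply: le_trans (ler_norm_sum _ _ _) _.
    have -> : W%:R / D%:R - W%:R / N%:R = \sum_(D <= i < N) (- (W%:R / i.+1%:R) - - (W%:R / i%:R)) :> R.
      by rewrite telescope_sumr // opprK addrC.
    apply: ler_sum_nat => i /andP[Di _]; rewrite normrM.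
    have i0 : 0 < i%:R :> R by rewrite ltr0n (leq_trans D0).
    have dle : i.+1%:R^-1 <= i%:R^-1 :> R by rewrite lef_pV2 ?posrE ?ltr0n ?ler_nat //; lia.
    rewrite [X in _ * X <= _]ler0_norm ?subr_le0 //.
    have -> : - (W%:R / i.+1%:R) - - (W%:R / i%:R) = W%:R * - (i.+1%:R^-1 - i%:R^-1) :> R by ring.
    by apply: ler_wpM2r; rewrite ?oppr_ge0 ?subr_le0.
  have t1 := ler_normB (psum g N / N%:R - psum g D / D%:R) (\sum_(D <= i < N) psum g i * (i.+1%:R^-1 - i%:R^-1)).
  have t2 := ler_normB (psum g N / N%:R) (psum g D / D%:R).
  have -> : 2 * W%:R / D%:R = W%:R / D%:R + W%:R / D%:R :> R by ring.
  lra.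
have [N0 N00 HN0] := rho_large K0 e0.
pose N := maxn N0 D; have ND : (D <= N)%N by rewrite leq_maxr.
have NN : (N0 <= N)%N by rewrite leq_maxl.
have N_gt0 := leq_trans D0 ND.
have HN : `|psum (fun n => g n / n%:R) N| <= e.
  have := HB N N_gt0.
  have -> : psum (fun n => psi n / n%:R) N = (psum (fun n => g n / n%:R) N)%:C%C.
    by rewrite /psum rmorph_sum; apply: eq_bigr => n _; rewrite gE rmorphM fmorphV rmorph_nat.
  rewrite nrmR => H; apply: le_trans H _; apply: le_trans HN0.
  rewrite ler_wpM2l // lef_pV2 ?posrE ?exprn_gt0 ?rho_gt0 //.
  by rewrite lerXn2r ?nnegrE ?rho_ge0 // le_rho.
have := tail N ND; have := ler_normD (psum (fun n => g n / n%:R) D - psum (fun n => g n / n%:R) N) (psum (fun n => g n / n%:R) N).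
rewrite subrK distrC; lra.
Qed.

Lemma Echar_bounded psi : dchar W psi -> nonprincipal psi -> bounded (Echar psi).
Proof.
move=> ch np; have [[n co n1]|H] := pselect (nonprincipal (fun n => psi n ^+ 2)).
  by apply: Echar_nonreal => //; exists n.
apply: Echar_real => // n co; apply/eqP; case: eqP => // n1; exfalso.
by apply: H; exists n => //; apply/eqP.
Qed.

End DirichletSeries.

(** * Euler products with two factors at each prime *)

Section Complete.
Variable V : comNzRingType.
Implicit Types u v : V.

(** Complete symmetric functions of two variables: the coefficient of T^k in
    1 / ((1 - u T) (1 - v T)). *)
Definition hsym u v k : V := \sum_(i < k.+1) u ^+ i * v ^+ (k - i).

Lemma hsym0 u v : hsym u v 0 = 1.
Proof. by rewrite /hsym big_ord1 !expr0 mulr1. Qed.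

Lemma hsymSl u v k : hsym u v k.+1 = u * hsym u v k + v ^+ k.+1.
Proof.
rewrite /hsym big_ord_recl expr0 mul1r subn0 addrC; congr (_ + _).
by rewrite mulr_sumr; apply: eq_bigr => i _; rewrite /= /bump /= add1n subSS exprS mulrA.
Qed.

Lemma hsym1 u v : hsym u v 1 = u + v.
Proof. by rewrite hsymSl hsym0 mulr1 expr1. Qed.

Lemma hsym_rec u v k : hsym u v k.+2 = (u + v) * hsym u v k.+1 - u * v * hsym u v k.
Proof. rewrite (hsymSl u v k.+1) (hsymSl u v k) [v ^+ k.+2]exprS; ring. Qed.

Lemma hsym2 u v : hsym u v 2 = (u + v) ^+ 2 - u * v.
Proof. by rewrite hsym_rec hsym0 hsym1 mulr1 expr2. Qed.

Lemma hsymC u v k : hsym u v k = hsym v u k.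
Proof.
rewrite /hsym (reindex_inj rev_ord_inj) /=; apply: eq_bigr => i _.
by rewrite mulrC subSS subKn // -ltnS.
Qed.

Let weighted u v k : \sum_(i < k) u ^+ i.+1 * hsym u v (k - i.+1)%N =
  \sum_(i < k.+1) (u ^+ i * v ^+ (k - i)) *+ i.
Proof.
elim: k => [|k IH]; first by rewrite big_ord0 big_ord1 mulr0n.
rewrite big_ord_recl /= subSS subn0 expr1.
under eq_bigr => i _ do rewrite /bump /= add1n subSS exprS -mulrA.
rewrite -mulr_sumr IH [RHS]big_ord_recl mulr0n add0r /hsym -mulrDr -big_split mulr_sumr /=.
apply: eq_bigr => i _; rewrite /bump /= add1n subSS -mulrS -mulrnAr exprS -mulrA mulrnAr.
by rewrite -mulrnAr.
Qed.

(** Newton's identity for two variables. *)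
Lemma newton u v k :
  \sum_(i < k) (u ^+ i.+1 + v ^+ i.+1) * hsym u v (k - i.+1)%N = hsym u v k *+ k.
Proof.
under eq_bigr => i _ do rewrite mulrDl.
rewrite big_split /= weighted.
under [X in _ + X]eq_bigr => i _ do rewrite hsymC.
rewrite weighted (reindex_inj rev_ord_inj) /= -big_split /= [in RHS]hsymC /hsym -sumrMnl.
apply: eq_bigr => i _; rewrite subSS.
have ik : (i <= k)%N by rewrite -ltnS.
by rewrite subKn // [u ^+ _ * _]mulrC -mulrnDr subnK.
Qed.

(** Coefficients of (1 - u T) (1 - v T). *)
Definition hinv u v k : V :=
  match k with 0 => 1 | 1 => - (u + v) | 2 => u * v | _ => 0 end.

Lemma hinv_hsym u v k : \sum_(i < k.+1) hinv u v i * hsym u v (k - i) = (k == 0%N)%:R.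
Proof.
case: k => [|[|k]].
- by rewrite big_ord1 hsym0 mulr1.
- by rewrite !big_ord_recl big_ord0 /= hsym1 hsym0 mulr1 mul1r addr0 subrr.
rewrite !big_ord_recl big1 => [|i _]; last by rewrite mul0r.
by rewrite /= !subSS !subn0 hsym_rec; ring.
Qed.
End Complete.

Section EulerProduct.
Variables (R : realType) (lg : logarithm R).
Local Notation rho := (rho R).

Definition Psum (f : nat -> R[i]) x :=
  \sum_(1 <= p < x.+1 | prime p) f p * (lg p / p%:R)%:C%C.

(** Proper prime powers contribute O(1) by [sum_vm_nonprime]. *)
Lemma prime_powers_bounded (lam : nat -> R[i]) c : 0 <= c ->
  (forall n, nrm (lam n) <= c * vm lg n) ->
  bounded (fun x => psum (fun n => lam n / n%:R) x
             - \sum_(1 <= p < x.+1 | prime p) lam p / p%:R).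
Proof.
move=> c0 H; exists (c * 32) => x x0.
rewrite /psum (bigID prime) /= addrAC subrr add0r.
apply: le_trans (nrm_sum _ _ _) _.
apply: le_trans (ler_wpM2l c0 (sum_vm_nonprime lg x)); rewrite mulr_sumr.
apply: ler_sum => n _; rewrite nrmM nrmV nrm_nat mulrA.
by rewrite ler_wpM2r ?invr_ge0.
Qed.

Variables (u v : nat -> R[i]) (c : nat -> nat -> R) (K : R).
Hypothesis u1 : forall p, nrm (u p) <= 1.
Hypothesis v1 : forall p, nrm (v p) <= 1.
Hypothesis c0 : forall p, c p 0%N = 1.
Hypothesis c1 : forall p, prime p -> nrm (u p + v p) <= c p 1%N.
Hypothesis c2 : forall p, prime p -> nrm (u p * v p) <= c p 2%N.
Hypothesis c_ge0 : forall p k, 0 <= c p k.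
Hypothesis Hc : forall x, psum (multf c) x <= K * x%:R.
Let a := multf (fun p k => hsym (u p) (v p) k).
Hypothesis Ha : forall x, nrm (psum a x) <= K * rho x ^+ 2.

(** The Euler product of the (1 - u_p T)^(-1) (1 - v_p T)^(-1) has logarithmic
    derivative (u_p^k + v_p^k) lg p at p^k by Newton's identity, and inverse [hinv].
    The majorant c of the inverse is only assumed to have linear sums. *)
Lemma euler_dichotomy :
  bounded (Psum (fun p => u p + v p)) \/
  bounded (fun x => Psum (fun p => u p + v p) x + (lg x)%:C%C).
Proof.
pose lam : nat -> R[i] := ppf (fun p k => (u p ^+ k + v p ^+ k) * (lg p)%:C%C).
pose m := multf (fun p k => hinv (u p) (v p) k).
have lam_le n : nrm (lam n) <= 2 * vm lg n.
  rewrite /lam /vm /ppf; case E: (primes n) => [|p [|q s]]; rewrite ?nrm0 ?mulr0 //.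
  have p0 : (0 < p)%N.
    have : p \in primes n by rewrite E inE.
    by rewrite mem_primes => /and3P[/prime_gt0].
  rewrite nrmM nrmR ger0_norm ?lg_ge0 // ler_wpM2r ?lg_ge0 //.
  apply: le_trans (nrmD _ _) _; rewrite !nrmX.
  have h (z : R[i]) k : nrm z <= 1 -> nrm z ^+ k <= 1 by move=> z1; rewrite exprn_ile1 ?nrm_ge0.
  have := h _ (logn p n) (u1 p); have := h _ (logn p n) (v1 p); lra.
have m_le n : nrm (m n) <= multf c n.
  rewrite /m /multf big_seq [leRHS]big_seq.
  elim/big_rec2: _ => [|p y1 y2]; first by rewrite nrm1.
  rewrite mem_primes => /and3P[p_pr _ _] IH; rewrite nrmM; apply: ler_pM; rewrite ?nrm_ge0 //.
  case: (logn p n) => [|[|[|k]]] /=; rewrite ?nrm1 ?nrmN ?nrm0 ?c0 //; [exact: c1|exact: c2].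
pose K2 := `|K| + 12.
have K20 : 0 <= K2 by rewrite addr_ge0.
have KK2 : K <= K2 by have := ler_norm K; rewrite /K2; lra.
have [||||||| L _ HE] := @dichotomy R lg a lam m (fun n => 2 * vm lg n) (multf c) K2.
- by move=> x; apply: le_trans (Ha x) _; rewrite ler_wpM2r ?exprn_ge0 ?rho_ge0.
- move=> n n0; rewrite /lam /a.
  rewrite (@conv_ppf_multf R[i] (fun n => (lg n)%:C%C)) //.
  + by move=> i j i0 j0; rewrite lgM // rmorphD.
  + by move=> p; rewrite hsym0.
  move=> p k _; rewrite -newton mulr_suml; apply: eq_bigr => i _; ring.
- move=> n n0; rewrite /m /a -multf_delta //; apply: conv_multf => //.
  + by move=> p; rewrite hsym0.
  by move=> p k _; rewrite hinv_hsym.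
- exact: lam_le.
- move=> x; rewrite /psum -mulr_sumr; have := chebyshev lg x.
  rewrite -/(psum _ _) => H; apply: (@le_trans _ _ (12 * x%:R)); first by lra.
  by rewrite ler_wpM2r // /K2 lerDr.
- exact: m_le.
- by move=> x; apply: le_trans (Hc x) _; rewrite ler_wpM2r.
have Hpp := @prime_powers_bounded lam 2 (ler0n _ _) lam_le.
have EP x : Psum (fun p => u p + v p) x = \sum_(1 <= p < x.+1 | prime p) lam p / p%:R.
  apply: eq_bigr => p p_pr; rewrite /lam ppf_prime // !expr1.
  by rewrite rmorphM fmorphV rmorph_nat mulrA.
case: HE => [HE|[_ HE]]; [left|right].
  apply: eq_bounded (boundedD HE (boundedM (-1) Hpp)) => x _.
  by rewrite EP; ring.
apply: eq_bounded (boundedD HE (boundedM (-1) Hpp)) => x _.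
by rewrite EP; ring.
Qed.
End EulerProduct.

(** * Eisenstein integers *)

(** The Eisenstein integer a + b w, with w ^ 2 = - 1 - w, as the pair (a, b). *)
Definition eis := (int * int)%type.
Definition emul (x y : eis) : eis :=
  (x.1 * y.1 - x.2 * y.2, x.1 * y.2 + x.2 * y.1 - x.2 * y.2).
Definition enorm (x : eis) : int := x.1 ^+ 2 - x.1 * x.2 + x.2 ^+ 2.
Definition econj (x : eis) : eis := (x.1 - x.2, - x.2).
Definition eint (n : int) : eis := (n, 0).

(** The residue class 1 modulo 3 contains exactly one associate of every
    Eisenstein integer prime to 3. *)
Definition primary (x : eis) := (3 %| x.1 - 1)%Z && (3 %| x.2)%Z.

Lemma eisP (x y : eis) : x.1 = y.1 -> x.2 = y.2 -> x = y.
Proof. by case: x y => [a b] [c d] /= -> ->. Qed.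

Lemma emulC x y : emul x y = emul y x.
Proof. by apply: eisP => /=; ring. Qed.
Lemma emulA x y z : emul x (emul y z) = emul (emul x y) z.
Proof. by apply: eisP => /=; ring. Qed.
Lemma enormM x y : enorm (emul x y) = enorm x * enorm y.
Proof. by rewrite /enorm /=; ring. Qed.
Lemma econjK x : econj (econj x) = x.
Proof. by apply: eisP => /=; ring. Qed.
Lemma enorm_conj x : enorm (econj x) = enorm x.
Proof. by rewrite /enorm /=; ring. Qed.
Lemma emul_conj x : emul x (econj x) = eint (enorm x).
Proof. by apply: eisP; rewrite /enorm /=; ring. Qed.
Lemma emul_int n x : emul (eint n) x = (n * x.1, n * x.2).
Proof. by apply: eisP => /=; ring. Qed.
Lemma enorm_int n : enorm (eint n) = n ^+ 2.
Proof. by rewrite /enorm /=; ring. Qed.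
Lemma enorm4 x : 4 * enorm x = (2 * x.1 - x.2) ^+ 2 + 3 * x.2 ^+ 2.
Proof. by rewrite /enorm; ring. Qed.
Lemma enorm4' x : 4 * enorm x = (2 * x.2 - x.1) ^+ 2 + 3 * x.1 ^+ 2.
Proof. by rewrite /enorm; ring. Qed.

Lemma enorm_ge0 x : 0 <= enorm x.
Proof.
have := enorm4 x; have := sqr_ge0 (2 * x.1 - x.2); have := sqr_ge0 x.2; lia.
Qed.

Lemma enorm_eq0 x : enorm x = 0 -> x = (0, 0).
Proof.
move=> N0; have h1 := enorm4 x; have h2 := enorm4' x.
have s1 := sqr_ge0 (2 * x.1 - x.2); have s2 := sqr_ge0 (2 * x.2 - x.1).
have /eqP : x.2 ^+ 2 = 0 by have := sqr_ge0 x.2; lia.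
have /eqP : x.1 ^+ 2 = 0 by have := sqr_ge0 x.1; lia.
by rewrite !sqrf_eq0 => /eqP e1 /eqP e2; apply: eisP.
Qed.

Lemma emul_int_inj n : n != 0 -> injective (emul (eint n)).
Proof.
move=> n0 x y; rewrite !emul_int => -[e1 e2].
by apply: eisP; apply: (mulfI n0).
Qed.

Lemma emul_inj x : enorm x != 0 -> injective (emul x).
Proof.
move=> N0 y z E; apply: (emul_int_inj N0).
by rewrite -emul_conj ![emul x (econj x)]emulC -!emulA E.
Qed.

Lemma primaryM x y : primary x -> primary y -> primary (emul x y).
Proof.
case: x y => [a b] [c d] /andP[/= h1 h2] /andP[/= h3 h4].
have [a' ea] : exists a', a = 3 * a' + 1 by exists ((a - 1) %/ 3)%Z; lia.
have [b' eb] : exists b', b = 3 * b' by exists (b %/ 3)%Z; lia.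
have [c' ec] : exists c', c = 3 * c' + 1 by exists ((c - 1) %/ 3)%Z; lia.
have [d' ed] : exists d', d = 3 * d' by exists (d %/ 3)%Z; lia.
rewrite /primary /= ea eb ec ed; apply/andP; split; apply/dvdzP.
  by exists (3 * a' * c' + a' + c' - 3 * b' * d'); ring.
by exists (3 * a' * d' + d' + 3 * b' * c' + b' - 3 * b' * d'); ring.
Qed.

Lemma primary_conj x : primary x -> primary (econj x).
Proof. by case: x => a b /andP[/= h1 h2]; rewrite /primary /=; apply/andP; split; lia. Qed.

Lemma primary_cancel x y : primary x -> primary (emul x y) -> primary y.
Proof.
case: x y => [a b] [c d] /andP[/= h1 h2] /andP[/= h3 h4].
have [a' ea] : exists a', a = 3 * a' + 1 by exists ((a - 1) %/ 3)%Z; lia.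
have [b' eb] : exists b', b = 3 * b' by exists (b %/ 3)%Z; lia.
have /dvdzP[k ek] := h3; have /dvdzP[l el] := h4.
rewrite /primary /=; apply/andP; split; apply/dvdzP.
  exists (k - a' * c + b' * d); move: ek; rewrite ea eb => ek; lia.
exists (l - a' * d - b' * c + b' * d); move: el; rewrite ea eb => el; lia.
Qed.

Lemma primary_norm x : primary x -> (enorm x = 1 %[mod 3])%Z.
Proof.
case: x => a b /andP[/= h1 h2].
have [a' ea] : exists a', a = 3 * a' + 1 by exists ((a - 1) %/ 3)%Z; lia.
have [b' eb] : exists b', b = 3 * b' by exists (b %/ 3)%Z; lia.
apply/eqP; rewrite eqz_mod_dvd /enorm /= ea eb; apply/dvdzP.
by exists (3 * a' ^+ 2 + 2 * a' - 3 * a' * b' - b' + 3 * b' ^+ 2); ring.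
Qed.

Definition zrange (B : nat) : seq int := [seq i%:Z - B%:Z | i <- iota 0 B.*2.+1].

Lemma mem_zrange B z : (z \in zrange B) = (`|z| <= B%:Z).
Proof.
apply/mapP/idP => [[k] | h].
  by rewrite mem_iota => /andP[_ h] ->; lia.
exists (absz (z + B%:Z)); first by rewrite mem_iota; lia.
lia.
Qed.

Lemma zrange_uniq B : uniq (zrange B).
Proof. by rewrite map_inj_uniq ?iota_uniq // => i j /= h; lia. Qed.

Definition ebox B : seq eis := [seq (a, b) | a <- zrange B, b <- zrange B].

Lemma mem_ebox B x : (x \in ebox B) = (`|x.1| <= B%:Z) && (`|x.2| <= B%:Z).
Proof.
case: x => a b; rewrite -!mem_zrange; apply/allpairsP/andP => [[[c d] /= [h1 h2 [-> ->]]] // | [h1 h2]].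
by exists (a, b).
Qed.

Lemma ebox_uniq B : uniq (ebox B).
Proof. by apply: allpairs_uniq; rewrite ?zrange_uniq // => -[? ?] [? ?] _ _ [-> ->]. Qed.

Lemma enorm_box x n : (0 < n)%N -> enorm x <= n%:Z -> x \in ebox n.
Proof.
move=> n0 Nx; rewrite mem_ebox.
have h1 := enorm4 x; have h2 := enorm4' x.
have s1 := sqr_ge0 (2 * x.1 - x.2); have s2 := sqr_ge0 (2 * x.2 - x.1).
have key (z : int) : 3 * z ^+ 2 <= 4 * n%:Z -> `|z| <= n%:Z.
  rewrite -(real_normK (num_real z)) expr2.
  have : 0 <= `|z| by []; move: `|z| => w; nia.
have N4 : 4 * enorm x <= 4 * n%:Z by lia.
apply/andP; split; apply: key; apply: le_trans N4.
  by rewrite h2 lerDr.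
by rewrite h1 lerDr.
Qed.

(** The ideals of norm n, through their primary generators. *)
Definition esphere (n : nat) := [seq x <- ebox n | (enorm x == n%:Z) && primary x].

Lemma mem_esphere n x : (0 < n)%N -> (x \in esphere n) = (enorm x == n%:Z) && primary x.
Proof.
move=> n0; rewrite mem_filter; case: eqP => //= Nx; rewrite enorm_box ?Nx // andbT //.
Qed.

Lemma esphere_uniq n : uniq (esphere n).
Proof. by rewrite filter_uniq // ebox_uniq. Qed.

Section SplitPrime.
Variables (p : nat) (pi : eis).
Hypotheses (p_pr : prime p) (p_mod : (p %% 3 = 1)%N).
Hypotheses (pi_prim : primary pi) (pi_norm : enorm pi = p%:Z).

Let p0 : (0 < p)%N := prime_gt0 p_pr.

Let dvdpM (x y : int) : (p%:Z %| x * y)%Z = (p%:Z %| x)%Z || (p%:Z %| y)%Z.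
Proof. by rewrite !dvdzE abszM Euclid_dvdM. Qed.

Definition edvdp (x : eis) := (p%:Z %| x.1)%Z && (p%:Z %| x.2)%Z.

Let edvd_norm x : edvdp (emul x (econj pi)) = (p%:Z %| (emul x (econj pi)).2)%Z && (p%:Z %| enorm x)%Z.
Proof.
apply/andP/andP => [[h1 h2]|[h2 h3]]; split=> //.
  have : (p%:Z %| p%:Z * enorm x %/ p%:Z)%Z.
    have E : enorm (emul x (econj pi)) = p%:Z * enorm x by rewrite enormM enorm_conj pi_norm mulrC.
    have /dvdzP[k ek] := h1; have /dvdzP[l el] := h2.
    rewrite -E /enorm ek el.
    have -> : (k * p%:Z) ^+ 2 - k * p%:Z * (l * p%:Z) + (l * p%:Z) ^+ 2 =
       p%:Z * (k ^+ 2 - k * l + l ^+ 2) * p%:Z by ring.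
    by rewrite mulzK ?dvdz_mulr //; lia.
  by rewrite mulrC mulzK //; lia.
have E : enorm (emul x (econj pi)) = p%:Z * enorm x by rewrite enormM enorm_conj pi_norm mulrC.
have : (p%:Z %| (emul x (econj pi)).1 ^+ 2)%Z.
  move: E; rewrite {1}/enorm; set y := emul _ _ => E.
  have -> : y.1 ^+ 2 = p%:Z * enorm x + y.2 * (y.1 - y.2) by lia.
  by rewrite rpredD ?dvdz_mulr.
by rewrite expr2 dvdpM orbb.
Qed.

(** Since p divides the norms of x pi and of x pi' (pi' the conjugate), divisibility of
    these elements by p is decided by their second coordinates, whose product is
    x.2^2 p - pi.2^2 N(x). *)
Lemma split_dvd x : (p%:Z %| enorm x)%Z ->
  edvdp (emul x (econj pi)) || edvdp (emul x pi).
Proof.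
move=> dv.
have E2 : edvdp (emul x pi) = (p%:Z %| (emul x pi).2)%Z.
  apply/andP/idP => [[] //|h]; split=> //.
  have E : enorm (emul x pi) = p%:Z * enorm x by rewrite enormM pi_norm mulrC.
  have : (p%:Z %| (emul x pi).1 ^+ 2)%Z.
    move: E; rewrite {1}/enorm; set y := emul _ _ in h * => E.
    have -> : y.1 ^+ 2 = p%:Z * enorm x + y.2 * (y.1 - y.2) by lia.
    by rewrite rpredD ?dvdz_mulr.
  by rewrite expr2 dvdpM orbb.
rewrite edvd_norm dv andbT E2 -dvdpM.
have -> : (emul x (econj pi)).2 * (emul x pi).2 = x.2 ^+ 2 * p%:Z - pi.2 ^+ 2 * enorm x.
  by rewrite -pi_norm /enorm /=; ring.
by rewrite rpredB ?dvdz_mull ?dvdz_mulr.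
Qed.

(** The sum of the two elements is x times the trace of pi. If p divided the trace, it
    would divide pi, and p^2 would divide the norm p. *)
Lemma split_both x : edvdp (emul x (econj pi)) -> edvdp (emul x pi) -> edvdp x.
Proof.
move=> /andP[h1 h2] /andP[h3 h4].
have nt : ~~ (p%:Z %| 2 * pi.1 - pi.2)%Z.
  apply/negP => h.
  have h5 : (p%:Z %| 3 * pi.2 ^+ 2)%Z.
    have -> : 3 * pi.2 ^+ 2 = 4 * p%:Z - (2 * pi.1 - pi.2) ^+ 2 by rewrite -pi_norm enorm4; ring.
    by rewrite rpredB ?dvdz_mull // expr2 dvdz_mulr.
  have p3 : ~~ (p%:Z %| 3)%Z.
    rewrite dvdzE /= dvdn_prime2 //; by apply/negP => /eqP E; move: p_mod; rewrite E.
  move: h5; rewrite dvdpM (negPf p3) /= expr2 dvdpM orbb => h5.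
  have h6 : (p%:Z %| 2 * pi.1)%Z by rewrite -(subrK pi.2 (2 * pi.1)) rpredD.
  have p2 : ~~ (p%:Z %| 2)%Z.
    rewrite dvdzE /= dvdn_prime2 //; by apply/negP => /eqP E; move: p_mod; rewrite E.
  move: h6; rewrite dvdpM (negPf p2) /= => h6.
  have /dvdzP[k ek] := h6; have /dvdzP[l el] := h5.
  have : p%:Z = (k ^+ 2 - k * l + l ^+ 2) * p%:Z * p%:Z.
    by rewrite -{1}pi_norm /enorm ek el; ring.
  move: (_ - _ + _) => z E.
  have E1 : 1 = z * p%:Z by apply: (@mulIf _ p%:Z); [lia | rewrite mul1r].
  have : (p%:Z %| (1%R : int))%Z by rewrite E1 dvdz_mull.
  by rewrite dvdzE /= dvdn1; have := prime_gt1 p_pr; lia.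
have e1 : x.1 * (2 * pi.1 - pi.2) = (emul x (econj pi)).1 + (emul x pi).1 by rewrite /=; ring.
have e2 : x.2 * (2 * pi.1 - pi.2) = (emul x (econj pi)).2 + (emul x pi).2 by rewrite /=; ring.
have g1 : (p%:Z %| x.1 * (2 * pi.1 - pi.2))%Z by rewrite e1 rpredD.
have g2 : (p%:Z %| x.2 * (2 * pi.1 - pi.2))%Z by rewrite e2 rpredD.
by move: g1 g2; rewrite !dvdpM (negPf nt) !orbF /edvdp => -> ->.
Qed.
End SplitPrime.

(** Otherwise y^2 - y + 1 = 0 for some y in F_p. Then y^3 = -1, and as p is 2 modulo 3
    the equation y^p = y forces y to be 1 or -1. *)
Lemma inert_dvd p x : prime p -> (p %% 3 = 2)%N -> (p%:Z %| enorm x)%Z -> edvdp p x.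
Proof.
move=> p_pr p_mod dv.
have pF : p \in [pchar 'F_p] by rewrite pchar_Fp.
have Fp z : (p%:Z %| z)%Z = (z%:~R == 0 :> 'F_p).
  exact: dvdz_pcharf.
have E : x.1%:~R ^+ 2 - x.1%:~R * x.2%:~R + x.2%:~R ^+ 2 = 0 :> 'F_p.
  by apply/eqP; move: dv; rewrite Fp /enorm !(rmorphD, rmorphN, rmorphM, rmorphXn).
rewrite /edvdp !Fp; move: (x.1%:~R : 'F_p) (x.2%:~R : 'F_p) E => a b E.
have [b0|b0] := eqVneq b 0.
  by move: E; rewrite b0 mulr0 subr0 expr0n addr0 => /eqP; rewrite sqrf_eq0 => ->.
exfalso; pose y := a / b.
have y1 : y ^+ 2 - y + 1 = 0.
  have -> : y ^+ 2 - y + 1 = (a ^+ 2 - a * b + b ^+ 2) / b ^+ 2 by rewrite /y; field.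
  by rewrite E mul0r.
have y3 : y ^+ 3 = -1.
  have -> : y ^+ 3 = (y ^+ 2 - y + 1) * (y + 1) - 1 by ring.
  by rewrite y1 mul0r sub0r.
have yp : y ^+ p = y.
  by rewrite -[in X in _ ^+ X](card_Fp p_pr) expf_card.
have y0 : y != 0 by rewrite mulf_neq0 ?invr_eq0 //; apply: contra_eqN y1 => /eqP; rewrite /y => ->; rewrite !mul0r expr0n subr0 add0r oner_eq0.
have Ep : p = (3 * (p %/ 3) + 2)%N by lia.
have yk : (-1) ^+ (p %/ 3) * y = 1.
  have : y ^+ (3 * (p %/ 3) + 2) = y by rewrite -Ep.
  rewrite exprD exprM y3 expr2 mulrA => H.
  by apply: (mulIf y0); rewrite mul1r.
have : y = 1 \/ y = -1.
  move: yk; rewrite -signr_odd; case: (odd _); rewrite ?expr0 ?expr1 ?mul1r ?mulN1r => H.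
    by right; rewrite -[y]opprK H.
  by left.
have n3 : (3%:R : 'F_p) != 0.
  rewrite -(dvdn_pcharf pF) dvdn_prime2 //; by apply/negP => /eqP e; move: p_mod; rewrite e.
case=> e; move: y1; rewrite e.
  by rewrite expr1n subrr add0r => /eqP; rewrite oner_eq0.
have E3 : 3%:R = 1 + 1 + 1 :> 'F_p by rewrite !mulrS mulr0n addr0 addrA.
by rewrite sqrrN expr1n opprK -E3 => /eqP; rewrite (negPf n3).
Qed.

(** * Euler products over primary Eisenstein integers *)

Lemma primary_int n : (n = 1 %[mod 3])%Z -> primary (eint n).
Proof. by move=> h; rewrite /primary /= dvdz0 andbT -eqz_mod_dvd; apply/eqP. Qed.

Lemma edvdpP p x : (0 < p)%N -> reflect (exists y, x = emul (eint p%:Z) y) (edvdp p x).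
Proof.
move=> p0; apply: (iffP andP) => [[/dvdzP[k ek] /dvdzP[l el]]|[y ->]].
  by exists (k, l); rewrite emul_int; apply: eisP; rewrite /= ?ek ?el mulrC.
by rewrite emul_int /= !dvdz_mulr.
Qed.

Section Rep.
Variable p : nat.
Hypothesis p_pr : prime p.
Let p0 : (0 < p)%N := prime_gt0 p_pr.

(** Since pi times its conjugate is p, the multiples of pi are the x for which p
    divides x times the conjugate. *)
Lemma perm_edvdp rho m : primary rho -> enorm rho = p%:Z -> (0 < m)%N ->
  perm_eq [seq x <- esphere (p * m) | edvdp p (emul x (econj rho))]
          [seq emul rho y | y <- esphere m].
Proof.
move=> rho_prim rho_norm m0; have pm0 : (0 < p * m)%N by rewrite muln_gt0 p0.
have rho_inj : injective (emul rho) by apply: emul_inj; rewrite rho_norm; lia.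
apply: uniq_perm; first by rewrite filter_uniq // esphere_uniq.
  by rewrite map_inj_uniq // esphere_uniq.
move=> x; rewrite mem_filter mem_esphere //; apply/andP/mapP.
  move=> [/(edvdpP _ p0)[y ey] /andP[/eqP Nx Px]].
  have Ex : x = emul rho y.
    apply: (@emul_int_inj p%:Z); first by lia.
    rewrite emulA [emul _ rho]emulC -emulA -ey emulA [emul rho x]emulC -emulA emul_conj.
    by rewrite rho_norm emulC.
  exists y => //; rewrite mem_esphere //; move: Nx Px; rewrite Ex enormM rho_norm.
  move=> Nx Px; rewrite (primary_cancel rho_prim Px) andbT.
  by apply/eqP/(@mulfI _ p%:Z); [lia | rewrite Nx PoszM].
move=> [y]; rewrite mem_esphere // => /andP[/eqP Ny Py] ->.
rewrite enormM rho_norm Ny PoszM eqxx primaryM //; split=> //.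
apply/edvdpP => //; exists y.
by rewrite emulC emulA [emul (econj _) _]emulC emul_conj rho_norm.
Qed.

Lemma perm_edvdp_int u m : primary (eint u) -> (u = p%:Z \/ u = - p%:Z) -> (0 < m)%N ->
  perm_eq [seq x <- esphere (p * m) | edvdp p x]
          (if (p %| m)%N then [seq emul (eint u) y | y <- esphere (m %/ p)] else [::]).
Proof.
move=> u_prim up m0; have pm0 : (0 < p * m)%N by rewrite muln_gt0 p0.
have u2 : u ^+ 2 = p%:Z ^+ 2 by case: up => ->; rewrite ?sqrrN.
have u0 : u != 0 by case: up => ->; lia.
have key x : edvdp p x -> enorm x = (p * m)%:Z -> (p %| m)%N.
  move=> /(edvdpP _ p0)[y ->]; rewrite enormM enorm_int PoszM expr2 -mulrA => E.
  have E' : p%:Z * enorm y = m%:Z by apply: (@mulfI _ p%:Z); [lia | rewrite E].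
  by have : (p%:Z %| m%:Z)%Z by rewrite -E' dvdz_mulr.
apply: uniq_perm; first by rewrite filter_uniq // esphere_uniq.
  by case: ifP => // _; rewrite map_inj_uniq ?esphere_uniq //; exact: emul_int_inj.
move=> x; rewrite mem_filter mem_esphere //.
case: ifP => [dv|ndv]; last first.
  by rewrite in_nil; apply/negbTE/negP => /andP[h /andP[/eqP Nx _]]; rewrite (key x h Nx) in ndv.
have m'0 : (0 < m %/ p)%N by rewrite divn_gt0 // dvdn_leq.
have Em : m%:Z = p%:Z * (m %/ p)%N%:Z by rewrite -PoszM mulnC divnK.
apply/andP/mapP.
  move=> [/(edvdpP _ p0)[y ey] /andP[/eqP Nx Px]].
  have [z ez] : exists z, x = emul (eint u) z.
    case: up => eu; first by exists y; rewrite eu.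
    by exists (emul (eint (-1)) y); rewrite ey eu; apply: eisP => /=; ring.
  exists z => //; rewrite mem_esphere //; move: Nx Px; rewrite ez enormM enorm_int u2.
  move=> Nx Px; rewrite (primary_cancel u_prim Px) andbT.
  apply/eqP/(@mulfI _ (p%:Z ^+ 2)); first by rewrite expf_neq0 //; lia.
  by rewrite Nx PoszM Em expr2 mulrA.
move=> [y]; rewrite mem_esphere // => /andP[/eqP Ny Py] ->.
rewrite enormM enorm_int u2 Ny primaryM // PoszM Em expr2 mulrA eqxx; split=> //.
apply/edvdpP => //; case: up => eu; first by exists y; rewrite eu.
by exists (emul (eint (-1)) y); rewrite eu; apply: eisP => /=; ring.
Qed.

Section Values.
Variables (V : comNzRingType) (chi : eis -> V).
Hypothesis chi1 : chi (eint 1) = 1.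
Hypothesis chiM : forall x y, chi (emul x y) = chi x * chi y.

Definition rep n := \sum_(x <- esphere n) chi x.

Let sum_emul rho s : \sum_(x <- [seq emul rho y | y <- s]) chi x = chi rho * \sum_(y <- s) chi y.
Proof. by rewrite big_map mulr_sumr; apply: eq_bigr => y _. Qed.

(** Elements of norm p m are multiples of pi or of its conjugate; those that are
    multiples of both are multiples of p and have been counted twice. *)
Lemma rep_split pi m : (p %% 3 = 1)%N -> primary pi -> enorm pi = p%:Z -> (0 < m)%N ->
  rep (p * m) = (chi pi + chi (econj pi)) * rep m -
    chi pi * chi (econj pi) * (if (p %| m)%N then rep (m %/ p) else 0).
Proof.
move=> p_mod pi_prim pi_norm m0; have pm0 : (0 < p * m)%N by rewrite muln_gt0 p0.
pose d1 x := edvdp p (emul x (econj pi)); pose d2 x := edvdp p (emul x pi).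
have -> : rep (p * m) = \sum_(x <- esphere (p * m) | d1 x) chi x +
   \sum_(x <- esphere (p * m) | d2 x) chi x - \sum_(x <- esphere (p * m) | d1 x && d2 x) chi x.
  rewrite /rep !(big_mkcond d1) !(big_mkcond d2) !(big_mkcond (fun x => d1 x && d2 x)) /=.
  rewrite -big_split -sumrB /=; apply: eq_big_seq => x; rewrite mem_esphere // => /andP[/eqP Nx _].
  have : d1 x || d2 x.
    by rewrite /d1 /d2; apply: split_dvd => //; rewrite Nx PoszM dvdz_mulr.
  by case: (d1 x); case: (d2 x) => //= _; rewrite ?addr0 ?add0r ?subr0 ?addrK.
have h1 : \sum_(x <- esphere (p * m) | d1 x) chi x = chi pi * rep m.
  by rewrite -big_filter (perm_big _ (perm_edvdp pi_prim pi_norm m0)) sum_emul.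
have h2 : \sum_(x <- esphere (p * m) | d2 x) chi x = chi (econj pi) * rep m.
  have := perm_edvdp (primary_conj pi_prim) (etrans (enorm_conj pi) pi_norm) m0.
  rewrite econjK => h; by rewrite -big_filter (perm_big _ h) sum_emul.
have pE : chi (eint p%:Z) = chi pi * chi (econj pi) by rewrite -chiM emul_conj pi_norm.
have h3 : \sum_(x <- esphere (p * m) | d1 x && d2 x) chi x =
   chi pi * chi (econj pi) * (if (p %| m)%N then rep (m %/ p) else 0).
  have pp : primary (eint p%:Z).
    by apply: primary_int; rewrite modz_nat p_mod.
  transitivity (\sum_(x <- esphere (p * m) | edvdp p x) chi x).
    apply: eq_bigl => x; apply/andP/idP => [[]|h]; first exact: split_both.
    have [y ->] := edvdpP x p0 h.
    by rewrite /d1 /d2 -!emulA; split; apply/edvdpP => //; eexists.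
  rewrite -big_filter (perm_big _ (perm_edvdp_int pp _ m0)); last by left.
  by case: ifP => _; rewrite ?sum_emul ?pE // big_nil mulr0.
by rewrite h1 h2 h3 mulrDl.
Qed.

Lemma rep_inert m : (p %% 3 = 2)%N -> (0 < m)%N ->
  rep (p * m) = chi (eint (- p%:Z)) * (if (p %| m)%N then rep (m %/ p) else 0).
Proof.
move=> p_mod m0; have pm0 : (0 < p * m)%N by rewrite muln_gt0 p0.
have pp : primary (eint (- p%:Z)) by rewrite /primary /=; apply/andP; split; lia.
transitivity (\sum_(x <- esphere (p * m) | edvdp p x) chi x).
  rewrite [RHS]big_mkcond; apply: eq_big_seq => x; rewrite mem_esphere // => /andP[/eqP Nx _].
  by rewrite inert_dvd // Nx PoszM dvdz_mulr.
rewrite -big_filter (perm_big _ (perm_edvdp_int pp _ m0)); last by right.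
by case: ifP => _; rewrite ?sum_emul // big_nil mulr0.
Qed.

Lemma rep_three m : (p %% 3 = 0)%N -> (0 < m)%N -> rep (p * m) = 0.
Proof.
move=> p_mod m0; have pm0 : (0 < p * m)%N by rewrite muln_gt0 p0.
rewrite /rep big_seq big1 // => x; rewrite mem_esphere // => /andP[/eqP Nx /primary_norm].
by rewrite Nx modz_nat -modnMml p_mod.
Qed.
End Values.
End Rep.

Section RepMult.
Variables (V : comNzRingType) (chi : eis -> V) (pi : nat -> eis) (u v : nat -> V).
Hypothesis chi1 : chi (eint 1) = 1.
Hypothesis chiM : forall x y, chi (emul x y) = chi x * chi y.
Hypothesis pi_prim : forall p, prime p -> (p %% 3 = 1)%N -> primary (pi p).
Hypothesis pi_norm : forall p, prime p -> (p %% 3 = 1)%N -> enorm (pi p) = p%:Z.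
Hypothesis uv_split : forall p, prime p -> (p %% 3 = 1)%N ->
  u p = chi (pi p) /\ v p = chi (econj (pi p)).
Hypothesis uv_inert : forall p, prime p -> (p %% 3 = 2)%N ->
  u p + v p = 0 /\ u p * v p = - chi (eint (- p%:Z)).
Hypothesis uv_three : forall p, prime p -> (p %% 3 = 0)%N -> u p = 0 /\ v p = 0.

Lemma rep1 : rep chi 1 = 1.
Proof.
by rewrite /rep (perm_big [:: eint 1]) ?big_seq1.
Qed.

Lemma rep_rec p m : prime p -> (0 < m)%N ->
  rep chi (p * m) = (u p + v p) * rep chi m -
    u p * v p * (if (p %| m)%N then rep chi (m %/ p) else 0).
Proof.
move=> p_pr m0.
have : ((p %% 3 = 0) \/ (p %% 3 = 1) \/ (p %% 3 = 2))%N by lia.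
case=> [h|[h|h]].
- by rewrite rep_three //; have [-> ->] := uv_three p_pr h; rewrite addr0 !mul0r subrr.
- by have [-> ->] := uv_split p_pr h; apply: rep_split; auto.
by rewrite rep_inert //; have [-> ->] := uv_inert p_pr h; rewrite mul0r add0r mulNr opprK.
Qed.

(** Unique factorization, as an identity between character sums: the recursion in
    [rep_rec] is that of [hsym], so it determines the Euler factor at p. *)
Lemma rep_multf n : (0 < n)%N -> rep chi n = multf (fun p k => hsym (u p) (v p) k) n.
Proof.
move: n; apply: prime_power_ind => [|p k m p_pr k0 m0 co IH]; first by rewrite rep1 multf1.
rewrite multf_pfactor // => [|q]; last exact: hsym0.
rewrite -IH; have p0 := prime_gt0 p_pr.
have ndv : (p %| m)%N = false by apply/negbTE; rewrite -prime_coprime.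
suff H j : rep chi (p ^ j * m) = hsym (u p) (v p) j * rep chi m /\
           rep chi (p ^ j.+1 * m) = hsym (u p) (v p) j.+1 * rep chi m by case: (H k).
elim: j => [|j [IH1 IH2]].
  by rewrite expn0 mul1n expn1 hsym0 mul1r rep_rec // ndv mulr0 subr0 hsym1.
split=> //; rewrite expnS -mulnA rep_rec ?muln_gt0 ?expn_gt0 ?p0 //.
rewrite IH2 {1}expnS -mulnA dvdn_mulr // expnS -mulnA mulKn // IH1 hsym_rec; ring.
Qed.
End RepMult.

(** * Character sums over discs *)

Section Lattice.
Variable R : realType.
Local Notation rho := (rho R).

(** The indices satisfying P form an interval, on which the differences telescope. *)
Lemma convex_telescope (P : pred nat) (f : nat -> R[i]) n :
  (forall i j k, (i <= j <= k)%N -> P i -> P k -> P j) ->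
  (forall i, nrm (f i) <= 1) ->
  nrm (\sum_(0 <= i < n | P i) (f i.+1 - f i)) <= 2.
Proof.
move=> cvx f1.
have : (forall i, (i < n)%N -> ~~ P i) /\ \sum_(0 <= i < n | P i) (f i.+1 - f i) = 0 \/
   exists l r, [/\ (r < n)%N, P r, ((r.+1 < n)%N -> ~~ P r.+1) &
      \sum_(0 <= i < n | P i) (f i.+1 - f i) = f r.+1 - f l].
  elim: n => [|n IH]; first by left; rewrite big_geq.
  rewrite big_mkcond big_nat_recr //= -big_mkcond /=.
  case: IH => [[nP ->]|[l [r [rn Pr nPr ->]]]].
    have [Pn|nPn] := boolP (P n).
      by right; exists n, n; split=> //; rewrite ?ltnn // add0r.
    left; split; last by rewrite addr0.
    by move=> i; rewrite ltnS leq_eqVlt => /predU1P[->|/nP].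
  have [Pn|nPn] := boolP (P n); last first.
    right; exists l, r; rewrite addr0; split=> //; first exact: ltnW.
    move=> _; have [h'|h'] := ltnP r.+1 n; first exact: nPr.
    by have -> : r.+1 = n by lia.
  have [h|h] := ltnP r.+1 n.
    by case/negP: (nPr h); apply: (cvx r _ n) => //; rewrite leqnSn ltnW.
  have -> : r.+1 = n by lia.
  by right; exists l, n; split=> //; rewrite ?ltnn // addrC addrA subrK.
case=> [[_ ->]|[l [r [_ _ _ ->]]]]; first by rewrite nrm0.
by apply: le_trans (nrmB _ _) _; have := f1 r.+1; have := f1 l; lra.
Qed.

Lemma enorm_convex a1 a2 a3 b (x : int) : a1 <= a2 <= a3 ->
  enorm (a1, b) <= x -> enorm (a3, b) <= x -> enorm (a2, b) <= x.
Proof.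
rewrite /enorm /= => /andP[h1 h2] e1 e3.
have [e|/eqP e] := eqVneq a1 a3; first by have -> : a2 = a1 by lia.
have pos : 0 < a3 - a1 by lia.
rewrite -(ler_pM2l pos).
have : (a3 - a1) * (a2 ^+ 2 - a2 * b + b ^+ 2) =
  (a3 - a2) * (a1 ^+ 2 - a1 * b + b ^+ 2) + (a2 - a1) * (a3 ^+ 2 - a3 * b + b ^+ 2)
   - (a3 - a1) * ((a2 - a1) * (a3 - a2)) by ring.
have k1 : (a3 - a2) * (a1 ^+ 2 - a1 * b + b ^+ 2) <= (a3 - a2) * x by apply: ler_wpM2l; lia.
have k2 : (a2 - a1) * (a3 ^+ 2 - a3 * b + b ^+ 2) <= (a2 - a1) * x by apply: ler_wpM2l; lia.
have k3 : 0 <= (a3 - a1) * ((a2 - a1) * (a3 - a2)) by rewrite !mulr_ge0 //; lia.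
have : (a3 - a1) * x = (a3 - a2) * x + (a2 - a1) * x by ring.
by move: k1 k2 k3; lia.
Qed.

Lemma enorm_sym a b : enorm (a, b) = enorm (b, a).
Proof. by rewrite /enorm /=; ring. Qed.

Variable x : nat.
Hypothesis x0 : (0 < x)%N.

(** The coordinates of an element of norm at most x are at most sqrt(4 x / 3). *)
Definition Tbox := Num.truncn (2 * rho x ^+ 2).

Lemma Tbox_le : Tbox%:R <= 2 * rho x ^+ 2.
Proof. by rewrite truncn_le // mulr_ge0 ?exprn_ge0 ?rho_ge0. Qed.

Lemma Tbox_mem y : enorm y <= x%:Z -> y \in ebox Tbox.
Proof.
move=> Ny; rewrite mem_ebox.
have key (z : int) : 3 * z ^+ 2 <= 4 * x%:Z -> `|z| <= Tbox%:Z.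
  move=> hz; have hz2 : (absz z ^ 2 <= 4 * x)%N.
    have : z ^+ 2 <= 4 * x%:Z by have := sqr_ge0 z; lia.
    have <- : (absz z)%:Z ^+ 2 = z ^+ 2 by rewrite abszE real_normK ?num_real.
    by rewrite -lez_nat -mulnn !PoszM expr2.
  rewrite -abszE lez_nat truncn_ge_nat; last by rewrite mulr_ge0 ?exprn_ge0 ?rho_ge0.
  rewrite -(@ler_pXn2r _ 2) ?nnegrE ?mulr_ge0 ?exprn_ge0 ?rho_ge0 //.
  rewrite exprMn -exprM rho4 -!natrX -natrM ler_nat //.
have h1 := enorm4 y; have h2 := enorm4' y.
have s1 := sqr_ge0 (2 * y.1 - y.2); have s2 := sqr_ge0 (2 * y.2 - y.1).
have N4 : 4 * enorm y <= 4 * x%:Z by lia.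
apply/andP; split; apply: key; apply: le_trans N4.
  by rewrite h2 lerDr.
by rewrite h1 lerDr.
Qed.

Lemma psum_rep (V : comNzRingType) (chi : eis -> V) :
  psum (rep chi) x = \sum_(y <- ebox Tbox | (enorm y <= x%:Z) && primary y) chi y.
Proof.
rewrite -[RHS]big_filter.
have -> : psum (rep chi) x = \sum_(y <- flatten [seq esphere n | n <- index_iota 1 x.+1]) chi y.
  by rewrite big_flatten /= big_map.
apply: perm_big; apply: uniq_perm.
- have : uniq (index_iota 1 x.+1) by apply: iota_uniq.
  have : all (fun n => 0 < n)%N (index_iota 1 x.+1) by apply/allP => n; rewrite mem_index_iota => /andP[].
  elim: (index_iota _ _) => //= n s IH /andP[n0 s0] /andP[ns us].
  rewrite cat_uniq esphere_uniq IH // andbT; apply/hasPn => y /flatten_mapP[m ms].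
  have m0 := allP s0 _ ms; rewrite /= !mem_esphere // => /andP[/eqP -> _]; apply/negP => /andP[/eqP [E] _].
  by rewrite -E ms in ns.
- by rewrite filter_uniq // ebox_uniq.
move=> y; rewrite mem_filter; apply/flatten_mapP/idP => [[n]|].
  rewrite mem_index_iota => /andP[n0 nx]; rewrite mem_esphere // => /andP[/eqP Ny Py].
  have yx : enorm y <= x%:Z by rewrite Ny; lia.
  by rewrite yx Py Tbox_mem.
move=> /andP[/andP[yx Py] _].
have y0 : enorm y != 0.
  by apply/eqP => /enorm_eq0 E; move: Py; rewrite E.
have [n En] : exists n : nat, enorm y = n%:Z by exists (absz (enorm y)); have := enorm_ge0 y; lia.
exists n; first by rewrite mem_index_iota; lia.
by rewrite mem_esphere ?En ?eqxx ?Py //; lia.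
Qed.

Lemma psum_count : psum (rep (fun _ => 1 : R)) x <= 25 * x%:R.
Proof.
rewrite psum_rep; apply: (@le_trans _ _ (\sum_(y <- ebox Tbox) 1)).
  by rewrite big_mkcond /=; apply: ler_sum => y _; case: ifP.
rewrite big_const_seq count_predT iter_addr_0 size_allpairs !size_map !size_iota.
have Tb : (Tbox.*2.+1)%:R <= 5 * rho x ^+ 2.
  rewrite -natr1 -mul2n natrM; have := Tbox_le.
  have : 1 <= rho x ^+ 2 by rewrite exprn_ege1 // rho_ge1.
  lra.
rewrite natrM; apply: le_trans (ler_pM _ _ Tb Tb) _ => //.
by rewrite -(rho4 R x) le_eqVlt (_ : _ == _) //; apply/eqP; ring.
Qed.
Definition disc_sum (h : eis -> R[i]) := \sum_(y <- ebox Tbox | enorm y <= x%:Z) h y.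

Let disc_sumE h : disc_sum h =
  \sum_(b <- zrange Tbox) \sum_(a <- zrange Tbox | enorm (a, b) <= x%:Z) h (a, b).
Proof.
rewrite /disc_sum /ebox big_mkcond big_allpairs /= exchange_big /=.
by apply: eq_bigr => b _; rewrite [RHS]big_mkcond.
Qed.

Let disc_sumE' h : disc_sum h =
  \sum_(a <- zrange Tbox) \sum_(b <- zrange Tbox | enorm (a, b) <= x%:Z) h (a, b).
Proof.
rewrite /disc_sum /ebox big_mkcond big_allpairs /=.
by apply: eq_bigr => b _; rewrite [RHS]big_mkcond.
Qed.

Let row_bound (f : int -> R[i]) (P : pred int) :
  (forall a1 a2 a3, a1 <= a2 <= a3 -> P a1 -> P a3 -> P a2) ->
  (forall a, nrm (f a) <= 1) ->
  nrm (\sum_(a <- zrange Tbox | P a) (f (a + 1) - f a)) <= 2.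
Proof.
move=> cvx f1.
have -> : \sum_(a <- zrange Tbox | P a) (f (a + 1) - f a) =
   \sum_(0 <= i < Tbox.*2.+1 | P (i%:Z - Tbox%:Z)) (f (i.+1%:Z - Tbox%:Z) - f (i%:Z - Tbox%:Z)).
  rewrite /zrange big_map; apply: eq_bigr => i _.
  by congr (f _ - f _); lia.
apply: (@convex_telescope (fun i => P (i%:Z - Tbox%:Z)) (fun i => f (i%:Z - Tbox%:Z))) => //.
by move=> i j k ijk; apply: cvx; lia.
Qed.

Let rows : \sum_(b <- zrange Tbox) (2 : R) = 2 * (Tbox.*2.+1)%:R.
Proof. by rewrite big_const_seq count_predT size_map size_iota iter_addr_0 mulr_natr. Qed.

(** A line parallel to an axis meets the disc in an interval, and a unit shift along
    the line changes its contribution only at the two ends. *)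
Let shift1 h : (forall y, nrm (h y) <= 1) ->
  nrm (disc_sum (fun y => h (y.1 + 1, y.2)) - disc_sum h) <= 2 * (Tbox.*2.+1)%:R.
Proof.
move=> h1; rewrite !disc_sumE -sumrB; apply: le_trans (nrm_sum _ _ _) _.
rewrite -rows; apply: ler_sum => b _; rewrite -sumrB /=.
apply: (@row_bound (fun a => h (a, b))) => // a1 a2 a3; exact: enorm_convex.
Qed.

Let shift2 h : (forall y, nrm (h y) <= 1) ->
  nrm (disc_sum (fun y => h (y.1, y.2 + 1)) - disc_sum h) <= 2 * (Tbox.*2.+1)%:R.
Proof.
move=> h1; rewrite !disc_sumE' -sumrB; apply: le_trans (nrm_sum _ _ _) _.
rewrite -rows; apply: ler_sum => b _; rewrite -sumrB /=.
apply: (@row_bound (fun a => h (b, a))) => // a1 a2 a3.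
rewrite ![enorm (b, _)]enorm_sym; exact: enorm_convex.
Qed.

Let shift h i j : (forall y, nrm (h y) <= 1) ->
  nrm (disc_sum (fun y => h (y.1 + i%:Z, y.2 + j%:Z)) - disc_sum h)
    <= 2 * (Tbox.*2.+1)%:R * (i + j)%:R.
Proof.
move=> h1; elim: j => [|j IHj].
  elim: i => [|i IHi].
    rewrite (_ : disc_sum _ = disc_sum h) ?subrr ?nrm0 ?mulr0 //.
    by apply: eq_bigr => -[a b] _ /=; rewrite !addr0.
  rewrite -(subrK (disc_sum (fun y => h (y.1 + i%:Z, y.2 + 0%:Z))) (disc_sum _)) -addrA.
  apply: le_trans (nrmD _ _) _.
  have := @shift1 (fun y => h (y.1 + i%:Z, y.2 + 0%:Z)) (fun _ => h1 _) => /=.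
  rewrite (_ : disc_sum (fun y => h (y.1 + 1 + i%:Z, y.2 + 0%:Z)) =
               disc_sum (fun y => h (y.1 + i.+1%:Z, y.2 + 0%:Z))); last first.
    by apply: eq_bigr => -[a b] _ /=; congr (h (_, _)); lia.
  move: IHi; rewrite !addn0 -[i.+1%:R]natr1 mulrDr mulr1; lra.
rewrite -(subrK (disc_sum (fun y => h (y.1 + i%:Z, y.2 + j%:Z))) (disc_sum _)) -addrA.
apply: le_trans (nrmD _ _) _.
have := @shift2 (fun y => h (y.1 + i%:Z, y.2 + j%:Z)) (fun _ => h1 _) => /=.
rewrite (_ : disc_sum (fun y => h (y.1 + i%:Z, y.2 + 1 + j%:Z)) =
             disc_sum (fun y => h (y.1 + i%:Z, y.2 + j.+1%:Z))); last first.
  by apply: eq_bigr => -[a b] _ /=; congr (h (_, _)); lia.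
move: IHj; rewrite addnS -[(i + j).+1%:R]natr1 mulrDr mulr1; lra.
Qed.

Variable F : nat.
Hypothesis F0 : (0 < F)%N.

Lemma periodic_sum_int (g : int -> R[i]) z : (forall a, g (a + F%:Z) = g a) ->
  \sum_(0 <= i < F) g (z + i%:Z) = \sum_(0 <= i < F) g i%:Z.
Proof.
move=> gF.
have step w : \sum_(0 <= i < F) g (w + 1 + i%:Z) = \sum_(0 <= i < F) g (w + i%:Z).
  have e i : w + 1 + i%:Z = w + i.+1%:Z by lia.
  apply/eqP; rewrite -subr_eq0 -sumrB; under eq_bigr => i _ do rewrite e.
  by rewrite telescope_sumr // gF addr0 subrr.
have up (k : nat) : \sum_(0 <= i < F) g (k%:Z + i%:Z) = \sum_(0 <= i < F) g i%:Z.
  elim: k => [|k IH]; first by apply: eq_bigr => i _; rewrite add0r.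
  rewrite -IH -(step k%:Z); apply: eq_bigr => i _; congr g; lia.
have down (k : nat) w : \sum_(0 <= i < F) g (w + k%:Z + i%:Z) = \sum_(0 <= i < F) g (w + i%:Z).
  elim: k => [|k IH]; first by apply: eq_bigr => i _; rewrite addr0.
  rewrite -IH -(step (w + k%:Z)); apply: eq_bigr => i _; congr g; lia.
rewrite -(down (absz z)); have [k Ek] : exists k : nat, z + (absz z)%:Z = k%:Z.
  by exists (absz (z + (absz z)%:Z)); lia.
by rewrite Ek up.
Qed.

(** The translates of h by a full set of residues add up to 0, and a translation
    changes the sum over the disc only at the boundary, by O(sqrt x). *)
Lemma disc_sum_bound (h : eis -> R[i]) : (forall y, nrm (h y) <= 1) ->
  (forall a b, h (a + F%:Z, b) = h (a, b)) -> (forall a b, h (a, b + F%:Z) = h (a, b)) ->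
  \sum_(0 <= i < F) \sum_(0 <= j < F) h (i%:Z, j%:Z) = 0 ->
  nrm (disc_sum h) <= 20 * F%:R * rho x ^+ 2.
Proof.
move=> h1 hF1 hF2 h0.
have zero : \sum_(0 <= i < F) \sum_(0 <= j < F) disc_sum (fun y => h (y.1 + i%:Z, y.2 + j%:Z)) = 0.
  under eq_bigr => i _ do rewrite exchange_big /=.
  rewrite exchange_big /= big1 // => -[a b] _ /=.
  under eq_bigr => i _ do rewrite (@periodic_sum_int (fun z => h (a + i%:Z, z))) //.
  rewrite exchange_big /=.
  under eq_bigr => j _ do rewrite (@periodic_sum_int (fun z => h (z, j%:Z))) //.
  by rewrite exchange_big.
have F0' : 0 < F%:R :> R by rewrite ltr0n.
have E : F%:R * F%:R * disc_sum h = \sum_(0 <= i < F) \sum_(0 <= j < F)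
   (disc_sum h - disc_sum (fun y => h (y.1 + i%:Z, y.2 + j%:Z))).
  under [RHS]eq_bigr => i _ do rewrite sumrB sumr_const_nat subn0.
  rewrite sumrB zero subr0 sumr_const_nat subn0 -mulrnA -[_ *+ (F * F)]mulr_natl natrM //.
have B : F%:R * F%:R * nrm (disc_sum h) <= F%:R * F%:R * (2 * (Tbox.*2.+1)%:R * (2 * F%:R)).
  have -> : F%:R * F%:R * nrm (disc_sum h) = nrm (F%:R * F%:R * disc_sum h).
    by rewrite !nrmM !nrm_nat.
  rewrite E; apply: le_trans (nrm_sum _ _ _) _.
  have -> : F%:R * F%:R * (2 * (Tbox.*2.+1)%:R * (2 * F%:R)) =
    \sum_(0 <= i < F) \sum_(0 <= j < F) (2 * (Tbox.*2.+1)%:R * (2 * F%:R)) :> R.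
    under [RHS]eq_bigr => i _ do rewrite sumr_const_nat subn0.
    by rewrite sumr_const_nat subn0 -mulrnA -[RHS]mulr_natl natrM.
  apply: ler_sum_nat => i /andP[_ iF]; apply: le_trans (nrm_sum _ _ _) _.
  apply: ler_sum_nat => j /andP[_ jF]; rewrite nrmBC.
  apply: le_trans (shift i j h1) _; rewrite ler_wpM2l ?mulr_ge0 //.
  by rewrite -natrM ler_nat; lia.
move: B; rewrite ler_pM2l ?mulr_gt0 // => B; apply: le_trans B _.
have Tb : (Tbox.*2.+1)%:R <= 5 * rho x ^+ 2.
  rewrite -natr1 -mul2n natrM; have := Tbox_le.
  have : 1 <= rho x ^+ 2 by rewrite exprn_ege1 // rho_ge1.
  lra.
have -> : 20 * F%:R * rho x ^+ 2 = 4 * F%:R * (5 * rho x ^+ 2) by ring.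
have -> : 2 * (Tbox.*2.+1)%:R * (2 * F%:R) = 4 * F%:R * (Tbox.*2.+1)%:R :> R by ring.
by rewrite ler_wpM2l // mulr_ge0 // ltW.
Qed.

(** [disc_sum_bound] for the function chi cut down to primary elements, which is
    periodic modulo F because 3 divides F. *)
Lemma psum_rep_bound (chi : eis -> R[i]) : (forall y, nrm (chi y) <= 1) ->
  (3 %| F)%N ->
  (forall a b, chi (a + F%:Z, b) = chi (a, b)) -> (forall a b, chi (a, b + F%:Z) = chi (a, b)) ->
  \sum_(0 <= i < F) \sum_(0 <= j < F | primary (i%:Z, j%:Z)) chi (i%:Z, j%:Z) = 0 ->
  nrm (psum (rep chi) x) <= 20 * F%:R * rho x ^+ 2.
Proof.
move=> chi1 F3 chiF1 chiF2 chi0; rewrite psum_rep.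
pose h y := if primary y then chi y else 0.
have -> : \sum_(y <- ebox Tbox | (enorm y <= x%:Z) && primary y) chi y = disc_sum h.
  rewrite /disc_sum [RHS]big_mkcond [LHS]big_mkcond; apply: eq_bigr => y _.
  by rewrite /h; case: (_ <= _).
have [k Fk] := dvdnP F3.
have p1 a b : primary (a + F%:Z, b) = primary (a, b).
  by rewrite /primary /= Fk PoszM; congr (_ && _); apply/idP/idP; lia.
have p2 a b : primary (a, b + F%:Z) = primary (a, b).
  by rewrite /primary /= Fk PoszM; congr (_ && _); apply/idP/idP; lia.
apply: disc_sum_bound => [y|a b|a b|].
- by rewrite /h; case: ifP => _; rewrite ?nrm0.
- by rewrite /h p1 chiF1.
- by rewrite /h p2 chiF2.
rewrite -[RHS]chi0; apply: eq_bigr => i _; by rewrite [RHS]big_mkcond.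
Qed.

End Lattice.

(** * Gauss and Jacobi sums of cubic characters *)

Lemma sqr_mod3 q : (q %% 3 != 0)%N -> exists k, (q ^ 2 = (3 * k).+1)%N.
Proof.
move=> q3; have : (q %% 3 = 1 \/ q %% 3 = 2)%N by lia.
have := divn_eq q 3; set a := (q %/ 3)%N; move=> Eq [h|h]; rewrite Eq h.
  by exists (a * (3 * a + 2))%N; ring.
by exists (a * (3 * a + 4) + 1)%N; ring.
Qed.

Section GaussSums.
Variables (s : nat) (L : fieldType) (zeta : L).
Hypothesis s_pr : prime s.
Hypothesis zeta_prim : s.-primitive_root zeta.
Local Notation F := 'F_s.
(** The additive character of F_s given by zeta. *)
Definition add_char (t : F) : L := zeta ^+ (t : nat).

Lemma add_charD t u : add_char (t + u) = add_char t * add_char u.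
Proof.
rewrite /add_char -exprD -(prim_expr_mod zeta_prim (t + u)%N) /=.
congr (_ ^+ _); apply: (congr1 (modn _)); exact: Fp_cast.
Qed.

Lemma add_char0 : add_char 0 = 1. Proof. by rewrite /add_char expr0. Qed.

Lemma add_charMn t n : add_char (t *+ n) = add_char t ^+ n.
Proof. by elim: n => [|n IH]; rewrite ?mulr0n ?add_char0 // mulrS add_charD IH exprS. Qed.

Lemma sum_add_char : \sum_t add_char t = 0.
Proof.
have e1 : add_char 1 != 1.
  have -> : add_char 1 = zeta ^+ 1 by [].
  by rewrite -(prim_order_dvd zeta_prim) dvdn1 neq_ltn prime_gt1 ?orbT.
have E : \sum_t add_char t = add_char 1 * \sum_t add_char t.
  rewrite {1}(reindex_inj (addrI 1)) /= mulr_sumr.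
  by apply: eq_bigr => t _; rewrite add_charD.
apply/eqP; have : (1 - add_char 1) * (\sum_t add_char t) == 0 by rewrite mulrBl mul1r -E subrr.
by rewrite mulf_eq0 subr_eq0 eq_sym (negbTE e1).
Qed.

Definition gauss_sum (f : F -> L) := \sum_t f t * add_char t.
Definition jacobi_sum (f h : F -> L) := \sum_t f t * h (1 - t).

Section Product.
Variables f h : F -> L.
Hypothesis f0 : f 0 = 0.
Hypothesis fM : {morph f : x y / x * y}.
Hypothesis hM : {morph h : x y / x * y}.

(** Group the terms of the double sum by v = t + u: the sum over t + u = v is f(v)
    h(v) times the one over t + u = 1, when v is not 0. *)
Lemma gauss_sum_mul : gauss_sum f * gauss_sum h =
  \sum_t f t * h (- t) + jacobi_sum f h * gauss_sum (fun t => f t * h t).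
Proof.
have E1 : gauss_sum f * gauss_sum h = \sum_v add_char v * \sum_t f t * h (v - t).
  rewrite /gauss_sum big_distrlr /=.
  under [RHS]eq_bigr => v _ do rewrite mulr_sumr.
  rewrite [RHS]exchange_big /=; apply: eq_bigr => t _.
  rewrite (reindex_inj (addIr (- t))) /=; apply: eq_bigr => v _.
  have -> : add_char v = add_char (v - t) * add_char t by rewrite -add_charD subrK.
  ring.
rewrite E1 (bigD1 0) //= add_char0 mul1r; congr (_ + _).
  by apply: eq_bigr => t _; rewrite sub0r.
rewrite [gauss_sum _](bigD1 0) //= f0 !mul0r add0r mulr_sumr; apply: eq_bigr => v v0.
rewrite (reindex_inj (mulfI v0)) /= /jacobi_sum mulr_suml mulr_sumr; apply: eq_bigr => t _.
have -> : v - v * t = v * (1 - t) by ring.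
by rewrite fM hM; ring.
Qed.
End Product.

Section SumCubic.
Variable f : F -> L.
Hypothesis fM : {morph f : x y / x * y}.
Variable z : F.
Hypothesis z0 : z != 0.
Hypothesis fz : f z != 1.

Lemma sum_cubic : \sum_t f t = 0.
Proof.
have E : \sum_t f t = f z * \sum_t f t.
  rewrite {1}(reindex_inj (mulfI z0)) /= mulr_sumr.
  by apply: eq_bigr => t _; rewrite fM.
apply/eqP; have : (1 - f z) * (\sum_t f t) == 0 by rewrite mulrBl mul1r -E subrr.
by rewrite mulf_eq0 subr_eq0 eq_sym (negbTE fz).
Qed.
End SumCubic.

Section Cubic.
Variable f : F -> L.
Hypothesis f0 : f 0 = 0.
Hypothesis fM : {morph f : x y / x * y}.
Hypothesis f3 : forall t, t != 0 -> f t ^+ 3 = 1.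
Variable z : F.
Hypothesis z0 : z != 0.
Hypothesis fz : f z != 1.

Local Notation f2 := (fun t => f t ^+ 2).

Let f1 : f 1 = 1.
Proof.
have := f3 (oner_neq0 F); have : f 1 = f 1 * f 1 by rewrite -fM mulr1.
move=> e; rewrite exprS expr2 -!e //.
Qed.

Let fN1 : f (-1) = 1.
Proof.
have e : f (-1) ^+ 2 = 1 by rewrite expr2 -fM mulrNN mulr1.
have := f3 (_ : -1 != 0); rewrite oppr_eq0 oner_neq0 exprS e mulr1; exact.
Qed.

Let fN t : f (- t) = f t. Proof. by rewrite -mulN1r fM fN1 mul1r. Qed.

Let f20 : f2 0 = 0. Proof. by rewrite /= f0 expr0n. Qed.
Let f2M : {morph f2 : x y / x * y}. Proof. by move=> x y; rewrite /= fM exprMn. Qed.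
Let f23 t : t != 0 -> f2 t ^+ 3 = 1. Proof. by move=> t0; rewrite /= exprAC f3 // expr1n. Qed.
Let f2z : f2 z != 1.
Proof.
apply: contraNneq fz => /= e; have := f3 z0; rewrite exprS e mulr1 => ->; exact.
Qed.

Lemma gauss_sum_sqr : gauss_sum f * gauss_sum f = jacobi_sum f f * gauss_sum f2.
Proof.
rewrite gauss_sum_mul //; under eq_bigr => t _ do rewrite fN -expr2.
rewrite (sum_cubic f2M z0 f2z) add0r; congr (_ * _).
Qed.

(** The terms are f^2((1 - t) / t), and (1 - t) / t takes every value except -1. *)
Lemma jacobi_sum_inv : jacobi_sum f f2 = -1.
Proof.
rewrite /jacobi_sum (bigD1 0) //= f0 mul0r add0r.
have -> : \sum_(t | t != 0) f t * f (1 - t) ^+ 2 = \sum_(t | t != 0) f2 (t^-1 - 1).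
  apply: eq_bigr => t t0 /=; have tV : f t * f t^-1 = 1 by rewrite -fM mulfV.
  have -> : t^-1 - 1 = t^-1 * (1 - t) by rewrite mulrBr mulr1 mulVf.
  have tV3 : f t^-1 ^+ 3 = 1 by rewrite f3 // invr_eq0.
  rewrite fM exprMn; congr (_ * _).
  by rewrite -[LHS]mulr1 -tV3 exprS mulrA tV mul1r.
rewrite (reindex_inj invr_inj) /=.
under eq_bigl => t do rewrite invr_eq0.
under eq_bigr => t _ do rewrite invrK.
have E : \sum_t f2 (t - 1) = 0.
  by rewrite -[RHS](sum_cubic f2M z0 f2z) [RHS](reindex_inj (addIr (- 1))).
rewrite (bigD1 0) //= sub0r fN1 expr1n in E.
by apply/eqP; rewrite -addr_eq0 addrC; apply/eqP.
Qed.

Lemma gauss_sum_norm : gauss_sum f * gauss_sum f2 = s%:R.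
Proof.
rewrite gauss_sum_mul // jacobi_sum_inv; have fff t : f t * f2 t = (t != 0)%:R.
  have [->|t0] := eqVneq t 0; first by rewrite f0 mul0r.
  by rewrite -exprS f3.
under eq_bigr => t _ do rewrite fN fff.
rewrite (_ : gauss_sum _ = -1); last first.
  rewrite /gauss_sum (bigD1 0) //= fff eqxx mul0r add0r.
  have := sum_add_char; rewrite (bigD1 0) //= add_char0 => /eqP; rewrite addrC addr_eq0 => /eqP <-.
  by apply: eq_bigr => t t0; rewrite fff t0 mul1r.
rewrite mulrNN mulr1 (bigD1 0) //= add0r.
have -> : \sum_(t : F | t != 0) (t != 0)%:R = \sum_(t in predC1 (0 : F)) 1 :> L.
  by apply: eq_big => // t ->.
by rewrite sumr_const cardC1 card_Fp // natr1 prednK ?prime_gt0.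
Qed.

Lemma gauss_sum_cube : gauss_sum f ^+ 3 = s%:R * jacobi_sum f f.
Proof. by rewrite exprS expr2 gauss_sum_sqr mulrCA gauss_sum_norm mulrC. Qed.

Section Frobenius.
Variable q : nat.
Hypothesis q_char : q \in [pchar L].
Hypothesis q_s : q != s.
Hypothesis q3 : (q %% 3 != 0)%N.

Let q_pr : prime q := pcharf_prime q_char.

(** Apply the Frobenius map twice to the Gauss sum g. It fixes the values of f and
    multiplies the exponents of zeta by q^2, so g^(q^2) = f(q) g; and g^3 is s times
    the Jacobi sum. This is the half of cubic reciprocity that is needed. *)
Lemma jacobi_expr : (s%:R * jacobi_sum f f) ^+ ((q ^ 2).-1 %/ 3) = f q%:R.
Proof.
have [k Ek] := sqr_mod3 q3.
rewrite Ek /= mulKn // -gauss_sum_cube -exprM.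
have qF : q%:R != 0 :> F.
  by rewrite -(dvdn_pcharf (pchar_Fp s_pr)) dvdn_prime2 // eq_sym.
have sL : s%:R != 0 :> L by rewrite -(dvdn_pcharf q_char) dvdn_prime2.
have g0 : gauss_sum f != 0 by apply: contraNneq sL => g0; rewrite -gauss_sum_norm g0 mul0r.
apply: (mulfI g0); rewrite -exprS -Ek.
have -> : gauss_sum f ^+ (q ^ 2) = \sum_t f t * add_char (t *+ (q ^ 2)).
  rewrite expnS expn1 exprM -!(pFrobenius_autE q_char) /gauss_sum !rmorph_sum /=.
  apply: eq_bigr => t _; rewrite !pFrobenius_autE -exprM mulnn add_charMn exprMn; congr (_ * _).
  have [->|t0] := eqVneq t 0; first by rewrite f0 expr0n expn_eq0 eqn0Ngt prime_gt0.
  by rewrite Ek exprS exprM f3 // expr1n mulr1.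
have Q0 : (q ^ 2)%:R != 0 :> F by rewrite natrX expf_neq0.
rewrite (reindex_inj (mulfI (invr_neq0 Q0))) /= mulrC /gauss_sum mulr_sumr.
apply: eq_bigr => t _; rewrite -[(_ * t) *+ _]mulr_natl mulrA mulfV // mul1r fM -mulrA.
congr (_ * _); have e1 : f (q ^ 2)%:R * f (q ^ 2)%:R^-1 = 1 by rewrite -fM mulfV.
have e2 : f (q ^ 2)%:R * f q%:R = 1 by rewrite natrX expr2 fM -expr2 -exprSr f3.
have fQ : f (q ^ 2)%:R != 0 by apply: contra_eq_neq e1 => ->; rewrite mul0r eq_sym oner_neq0.
by apply: (mulfI fQ); rewrite e1 e2.
Qed.
End Frobenius.
End Cubic.

(** Combine g g' = s with g^2 = J g' and g'^2 = J' g. *)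
Lemma jacobi_norm f z : f 0 = 0 -> {morph f : x y / x * y} ->
  (forall t, t != 0 -> f t ^+ 3 = 1) -> z != 0 -> f z != 1 -> s%:R != 0 :> L ->
  jacobi_sum f f * jacobi_sum (fun t => f t ^+ 2) (fun t => f t ^+ 2) = s%:R.
Proof.
move=> f0 fM f3 z0 fz sL; set f2 := fun t => f t ^+ 2.
have f20 : f2 0 = 0 by rewrite /f2 f0 expr0n.
have f2M : {morph f2 : x y / x * y} by move=> x y; rewrite /f2 fM exprMn.
have f23 t : t != 0 -> f2 t ^+ 3 = 1 by move=> t0; rewrite /f2 exprAC f3 // expr1n.
have f2z : f2 z != 1.
  by apply: contraNneq fz => e; have := f3 _ z0; rewrite exprS -[f z ^+ 2]/(f2 z) e mulr1 => ->.
have g1 := gauss_sum_sqr f0 fM f3 z0 fz; have g2 := gauss_sum_sqr f20 f2M f23 z0 f2z.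
have gg := gauss_sum_norm f0 fM f3 z0 fz.
have E : gauss_sum (fun t => f2 t ^+ 2) = gauss_sum f.
  apply: eq_bigr => t _; congr (_ * _); rewrite /f2 -exprM.
  have [->|t0] := eqVneq t 0; first by rewrite f0 expr0n.
  by rewrite exprS f3 // mulr1.
rewrite E in g2; apply: (mulfI sL); rewrite -{1}gg.
have -> : gauss_sum f * gauss_sum f2 * (jacobi_sum f f * jacobi_sum f2 f2) = (jacobi_sum f f * gauss_sum f2) * (jacobi_sum f2 f2 * gauss_sum f) by ring.
by rewrite -g1 -g2 -gg; ring.
Qed.
End GaussSums.

(** * Finite fields and evaluation of Eisenstein integers *)

(** The map sg generates a group of order 1 or 3 acting on A. *)
Lemma card_mod3 (T : finType) (sg : T -> T) (A : {set T}) :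
  (forall t, sg (sg (sg t)) = t) -> (forall t, t \in A -> sg t \in A) ->
  #|A| = #|[set t in A | sg t == t]| %[mod 3].
Proof.
move=> sg3 sgA.
have sgI : injective sg by apply: (can_inj (g := fun t => sg (sg t))) => t; exact: sg3.
pose x := perm sgI.
have x3 : (x ^+ 3 = 1)%g by apply/permP => t; rewrite !expgS expg0 !permM !permE /= sg3.
have xG : (3.-group <[x]>)%g.
  by rewrite /pgroup -orderE; apply: (pnat_dvd (n := 3)); rewrite ?order_dvdn ?x3 // pnat_id.
have nA : x \in ('N(A | 'P))%g.
  apply/astabsP => t /=; rewrite /aperm permE.
  by apply/idP/idP => [h|]; [rewrite -(sg3 t); exact: (sgA _ (sgA _ h)) | exact: sgA].
have acts : [acts <[x]>, on A | 'P]%g by rewrite cycle_subG.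
rewrite (pgroup_fix_mod xG acts); congr (_ %% _)%N; apply: eq_card => t.
rewrite finset.in_setI afix_cycle ?finset.in_setT //; rewrite [RHS]finset.in_set; congr (_ && _).
by apply/afix1P/eqP => /=; rewrite /aperm permE.
Qed.

Lemma finField_prim_root (L : finFieldType) : exists z : L, #|L|.-1.-primitive_root z.
Proof.
have L1 : (1 < #|L|)%N by apply: finNzRing_gt1.
have : has #|L|.-1.-primitive_root [seq x <- enum L | x != 0].
  apply: has_prim_root.
  - by rewrite -subn1 subn_gt0.
  - apply/allP => x; rewrite mem_filter => /andP[x0 _].
    rewrite unity_rootE; apply/eqP/(mulfI x0).
    by rewrite -exprS prednK ?(ltnW L1) // expf_card mulr1.
  - by rewrite filter_uniq // enum_uniq.
  - rewrite -(cardC1 (0 : L)) cardE; apply: uniq_leq_size; first exact: enum_uniq.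
    by move=> x; rewrite mem_enum mem_filter mem_enum andbT.
by case/hasP => z _ zp; exists z.
Qed.

(** The field with q^(totient n) elements, by Euler's theorem. *)
Lemma prime_power_field (q n : nat) : prime q -> (0 < n)%N -> coprime q n ->
  exists (L : finFieldType) (z : L), q \in [pchar L] /\ n.-primitive_root z.
Proof.
move=> q_pr n0 co.
have t0 : (0 < totient n)%N by rewrite totient_gt0.
have [L Lq cL] := pPrimePowerField q_pr t0.
have nQ : (n %| #|L|.-1)%N.
  rewrite -subn1 -eqn_mod_dvd ?(ltnW (finNzRing_gt1 L)) //.
  by rewrite cL; apply/eqP; exact: Euler_exp_totient.
have [z zp] := finField_prim_root L.
exists L, (z ^+ (#|L|.-1 %/ n)); split=> //.
exact: (dvdn_prim_root zp nQ).
Qed.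

Lemma pow_cube_root_neq1 (V : nzRingType) (z : V) k :
  z ^+ 3 = 1 -> z != 1 -> (k %% 3 != 0)%N -> z ^+ k != 1.
Proof.
move=> z3 z1 k3; have Ek := divn_eq k 3; apply: contraNneq z1.
rewrite Ek exprD mulnC exprM z3 expr1n mul1r; have : (k %% 3 < 3)%N by rewrite ltn_mod.
case: (k %% 3)%N k3 => [|[|[|//]]] // _ _; first by rewrite expr1 => ->.
by move=> e; move: z3; rewrite exprS e mulr1 => ->.
Qed.

Lemma cube_root_neq1 (L : fieldType) (w : L) : 3.-primitive_root w -> w != 1.
Proof. by move=> wp; rewrite -[w]expr1 -(prim_order_dvd wp). Qed.

Lemma cube_root_sum (L : fieldType) (w : L) : 3.-primitive_root w -> w ^+ 2 + w + 1 = 0.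
Proof.
move=> wp; have w1 := cube_root_neq1 wp.
have w3 := prim_expr_order wp.
have : (w - 1) * (w ^+ 2 + w + 1) == 0.
  have -> : (w - 1) * (w ^+ 2 + w + 1) = w ^+ 3 - 1 by ring.
  by rewrite w3 subrr.
by rewrite mulf_eq0 subr_eq0 (negbTE w1) => /eqP.
Qed.

(** The ring homomorphism to L that sends the cube root of unity to w. *)
Definition ev (L : fieldType) (w : L) (x : eis) : L := x.1%:~R + x.2%:~R * w.

Fixpoint epow (x : eis) n : eis := if n is m.+1 then emul x (epow x m) else (1, 0).

Section Ev.
Variables (L : fieldType) (w : L).
Hypothesis wp : 3.-primitive_root w.

Lemma evM x y : ev w (emul x y) = ev w x * ev w y.
Proof.
have e : w ^+ 2 = - w - 1 by have := cube_root_sum wp; rewrite -addrA => /eqP; rewrite addr_eq0 opprD => /eqP.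
rewrite /ev /emul /= !(intrD, intrB, intrM, rmorphB, rmorphD, rmorphM).
have -> : (x.1%:~R + x.2%:~R * w) * (y.1%:~R + y.2%:~R * w) =
  x.1%:~R * y.1%:~R + (x.1%:~R * y.2%:~R + x.2%:~R * y.1%:~R) * w + x.2%:~R * y.2%:~R * w ^+ 2 by ring.
rewrite e; ring.
Qed.

Lemma ev_pow x n : ev w (epow x n) = ev w x ^+ n.
Proof.
elim: n => [|n IH]; first by rewrite /ev /= mul0r addr0.
by rewrite /= evM IH exprS.
Qed.

Lemma ev_int n : ev w (eint n) = n%:~R.
Proof. by rewrite /ev /= mul0r addr0. Qed.

Lemma prim_root2 : 3.-primitive_root (w ^+ 2).
Proof. by rewrite (prim_root_exp_coprime 2 wp). Qed.

Lemma ev_conj x : ev (w ^+ 2) x = ev w (econj x).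
Proof.
have e : w ^+ 2 = - w - 1 by have := cube_root_sum wp; rewrite -addrA => /eqP; rewrite addr_eq0 opprD => /eqP.
by rewrite e /ev /= rmorphB rmorphN /=; ring.
Qed.

(** The difference of the two evaluations is x.2 (w - w^2), and w is not w^2. *)
Lemma ev_edvdp q x : q \in [pchar L] -> ev w x = 0 -> ev (w ^+ 2) x = 0 -> edvdp q x.
Proof.
move=> qL e1 e2.
have d : w - w ^+ 2 != 0.
  by rewrite -[X in X - _]expr1 subr_eq0 (eq_prim_root_expr wp).
have x2 : x.2%:~R = 0 :> L.
  apply/eqP; have : x.2%:~R * (w - w ^+ 2) == 0.
    have -> : x.2%:~R * (w - w ^+ 2) = ev w x - ev (w ^+ 2) x by rewrite /ev; ring.
    by rewrite e1 e2 subrr.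
  by rewrite mulf_eq0 (negbTE d) orbF.
have x1 : x.1%:~R = 0 :> L by move: e1; rewrite /ev x2 mul0r addr0.
by rewrite /edvdp !(dvdz_pcharf qL) x1 x2 eqxx.
Qed.

Lemma edvdp_ev q x : q \in [pchar L] -> edvdp q x -> ev w x = 0.
Proof.
move=> qL; rewrite /edvdp !(dvdz_pcharf qL) => /andP[/eqP e1 /eqP e2].
by rewrite /ev e1 e2 mul0r addr0.
Qed.
End Ev.

(** * The Jacobi sum as a primary Eisenstein integer *)

Section CubicIndex.
Variable s : nat.
Hypothesis s_pr : prime s.
Hypothesis s3 : (s %% 3 = 1)%N.
Local Notation F := 'F_s.
Variable z : F.
Hypothesis zp : s.-1.-primitive_root z.
Let n3 := (s.-1 %/ 3)%N.
Let w0 := z ^+ n3.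

Let n3E : (s.-1 = n3 * 3)%N. Proof. rewrite /n3; lia. Qed.

Let w0p : 3.-primitive_root w0.
Proof.
have d : (3 %| s.-1)%N by rewrite n3E dvdn_mull.
have := dvdn_prim_root zp d; rewrite -/(3%N) /w0.
by [].
Qed.

Let w03 : w0 ^+ 3 = 1 := prim_expr_order w0p.

Let fermat (t : F) : t != 0 -> t ^+ s.-1 = 1.
Proof.
move=> t0; apply: (mulfI t0); rewrite -exprS prednK ?prime_gt0 // mulr1.
have := expf_card t; rewrite card_Fp //.
Qed.

Lemma gen_neq0 : z != 0.
Proof.
apply/eqP => e; have := prim_expr_order zp; rewrite e expr0n.
have -> : (s.-1 == 0)%N = false by rewrite -subn1 subn_eq0 leqNgt prime_gt1.
by move/eqP; rewrite eq_sym oner_eq0.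
Qed.

(** Logarithm to base w0 of the cubic residue symbol; keeping the exponent allows
    the character to take its values in any field with a cube root of unity. *)
Definition cubic_index (t : F) : nat :=
  if t ^+ n3 == 1 then 0%N else if t ^+ n3 == w0 then 1%N else 2%N.

Lemma cubic_indexP t : t != 0 -> t ^+ n3 = w0 ^+ cubic_index t.
Proof.
move=> t0; rewrite /cubic_index; case: eqP => [->|/eqP h1]; first by rewrite expr0.
case: eqP => [->|/eqP h2]; first by rewrite expr1.
have e : w0 ^+ 2 = - w0 - 1 by have := cube_root_sum w0p; rewrite -addrA => /eqP; rewrite addr_eq0 opprD => /eqP.
have : (t ^+ n3 - 1) * (t ^+ n3 - w0) * (t ^+ n3 - w0 ^+ 2) == 0.
  have -> : (t ^+ n3 - 1) * (t ^+ n3 - w0) * (t ^+ n3 - w0 ^+ 2) = (t ^+ n3) ^+ 3 - w0 ^+ 3.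
    have := cube_root_sum w0p; move: (t ^+ n3) => y h.
    have -> : w0 ^+ 2 = (w0 ^+ 2 + w0 + 1) - w0 - 1 by ring.
    have -> : w0 ^+ 3 = (w0 - 1) * (w0 ^+ 2 + w0 + 1) + 1 by ring.
    rewrite h.
    have -> : (y - 1) * (y - w0) * (y - (0 - w0 - 1)) = y ^+ 3 - y * (w0 ^+ 2 + w0 + 1) + (w0 ^+ 2 + w0 + 1) - 1 by ring.
    rewrite h; ring.
  by rewrite -exprM -n3E fermat // w03 subrr.
by rewrite !mulf_eq0 !subr_eq0 (negbTE h1) (negbTE h2) /= => /eqP.
Qed.

Lemma cubic_index_lt3 t : (cubic_index t < 3)%N.
Proof. by rewrite /cubic_index; case: eqP => // _; case: eqP. Qed.

Lemma cubic_indexM (t u : F) : t != 0 -> u != 0 -> (cubic_index (t * u)%R = cubic_index t + cubic_index u %[mod 3])%N.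
Proof.
move=> t0 u0; apply/eqP; rewrite -(eq_prim_root_expr w0p) exprD -(cubic_indexP t0) -(cubic_indexP u0) -(cubic_indexP (mulf_neq0 t0 u0)).
by rewrite exprMn.
Qed.

Let cidx1 : cubic_index 1 = 0%N. Proof. by rewrite /cubic_index expr1n eqxx. Qed.

Let cidxz : cubic_index z = 1%N.
Proof.
by rewrite /cubic_index -/w0 eqxx (negbTE (cube_root_neq1 w0p)).
Qed.

Let cidxV t : t != 0 -> (cubic_index t^-1 + cubic_index t = 0 %[mod 3])%N.
Proof. by move=> t0; rewrite -cubic_indexM ?invr_eq0 // mulVf // cidx1. Qed.

Let cidxN1 : cubic_index (-1) = 0%N.
Proof.
have := cubic_indexM (_ : -1 != 0) (_ : -1 != 0); rewrite oppr_eq0 oner_neq0 mulrNN mulr1 cidx1.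
move=> /(_ isT isT); have := cubic_index_lt3 (-1); lia.
Qed.

(* The summand of the Jacobi sum at t is the m(t)-th power of the cube root of
   unity. It is invariant under the map sg of order 3, t -> 1 / (1 - t); the fixed
   points are the two roots of t (1 - t) = 1, where m vanishes. Hence the numbers
   c(0), c(1), c(2) of t with given m(t) are 2, 0, 0 modulo 3. *)
Let m (t : F) := ((cubic_index t + cubic_index (1 - t)%R) %% 3)%N.
Let S := [set t : F | (t != 0) && (t != 1)].
Let c (j : nat) := #|[set t in S | m t == j]|.

Let sg (t : F) := if t \in S then (1 - t)^-1 else t.

Let SP t : t \in S -> t != 0 /\ 1 - t != 0.
Proof. by rewrite inE => /andP[t0 t1]; split=> //; rewrite subr_eq0 eq_sym. Qed.

Let sgS t : t \in S -> sg t \in S.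
Proof.
move=> tS; have [t0 t1] := SP tS; rewrite /sg tS inE invr_eq0 t1 /=.
by rewrite invr_eq1 subr_eq addrC -subr_eq subrr eq_sym.
Qed.

Let sg3 t : sg (sg (sg t)) = t.
Proof.
have [tS|tS] := boolP (t \in S); last by rewrite /sg !(negbTE tS).
have s1 := sgS tS; have s2 := sgS s1; have [t0 t1] := SP tS; have [_ u1] := SP s1.
rewrite {1}/sg s2; move: u1; rewrite /sg tS => u1.
have s1' : (1 - t)^-1 \in S by move: s1; rewrite /sg tS.
rewrite s1'; have -> : 1 - (1 - t)^-1 = - t / (1 - t) by field.
have -> : 1 - (- t / (1 - t))^-1 = t^-1 by field; rewrite ?oppr_eq0 t0 t1.
by rewrite invrK.
Qed.

Let m_sg t : t \in S -> m (sg t) = m t.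
Proof.
move=> tS; have [t0 t1] := SP tS; rewrite /sg tS /m.
have -> : 1 - (1 - t)^-1 = (-1) * (t * (1 - t)^-1) by field.
have e1 := cidxV t1.
have t1V : (1 - t)^-1 != 0 by rewrite invr_eq0.
have N0 : -1 != 0 :> F by rewrite oppr_eq0 oner_neq0.
have e2 := cubic_indexM N0 (mulf_neq0 t0 t1V); have e3 := cubic_indexM t0 t1V.
move: e1 e2 e3; rewrite cidxN1.
move: (cubic_index _) (cubic_index _) (cubic_index _) (cubic_index _) (cubic_index _) => a b c' d e; clear; lia.
Qed.

Let cfix j : (c j = #|[set t in S | (m t == j) && (sg t == t)]| %[mod 3])%N.
Proof.
rewrite /c (@card_mod3 _ sg) //; last first.
  by move=> t; rewrite inE => /andP[tS mt]; rewrite inE sgS // m_sg.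
by congr (_ %% _)%N; apply: eq_card => t; rewrite !inE andbA.
Qed.

Let sg_fix t : t \in S -> (sg t == t) = (t * (1 - t) == 1).
Proof.
move=> tS; have [t0 t1] := SP tS; rewrite /sg tS.
by rewrite -(inj_eq (mulIf t1)) mulVf // eq_sym.
Qed.

Let fix_m t : t \in S -> sg t == t -> m t = 0%N.
Proof.
move=> tS; have [t0 t1] := SP tS; rewrite sg_fix // => /eqP e.
by rewrite /m -cubic_indexM // e cidx1.
Qed.

Let c12 j : (0 < j)%N -> (c j %% 3 = 0)%N.
Proof.
move=> j0; rewrite cfix (_ : [set _ | _] = finset.set0) ?cards0 //.
apply/finset.setP => t; rewrite finset.in_set0 finset.in_set; apply/negP => /and3P[tS /eqP mt ft].
by move: (fix_m tS ft); rewrite mt; lia.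
Qed.

Let c0 : (c 0 %% 3 = 2)%N.
Proof.
rewrite cfix (_ : [set _ | _] = [set - w0; - w0 ^+ 2]).
  rewrite cards2 eqr_opp -[X in X == _]expr1 (eq_prim_root_expr w0p) //.
have w00 : w0 != 0 by rewrite expf_neq0 ?gen_neq0.
have h := cube_root_sum w0p.
have h3 : w0 ^+ 3 = 1 := w03.
have e : w0 ^+ 2 = - w0 - 1 by move: h; rewrite -addrA => /eqP; rewrite addr_eq0 opprD => /eqP.
apply/finset.setP => t; rewrite finset.in_set finset.in_set2.
have quad : (t * (1 - t) == 1) = (t == - w0) || (t == - w0 ^+ 2).
  rewrite -subr_eq0 -[t == - w0]subr_eq0 -[t == - _ ^+ 2]subr_eq0 -mulf_eq0 !opprK.
  rewrite -[LHS]oppr_eq0; congr (_ == 0).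
  rewrite e; have -> : (t + w0) * (t + (- w0 - 1)) = t ^+ 2 - t - (w0 ^+ 2 + w0 + 1) + 1 by ring.
  rewrite h; ring.
have [tS|tS] := boolP (t \in S); last first.
  rewrite -quad; move: tS; rewrite inE negb_and !negbK => /orP[] /eqP ->; apply/esym/eqP.
    by rewrite mul0r => /eqP; rewrite eq_sym oner_eq0.
  by rewrite subrr mulr0 => /eqP; rewrite eq_sym oner_eq0.
rewrite sg_fix // -quad; case: (t * (1 - t) =P 1) => [e1|]; rewrite ?andbF //.
by rewrite fix_m ?eqxx // sg_fix // e1.
Qed.

(** Minus the Jacobi sum of the cubic character with itself, from 1 + w + w^2 = 0.
    The sign makes it primary. *)
Definition jac : eis := ((c 2)%:Z - (c 0)%:Z, (c 2)%:Z - (c 1)%:Z).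

Lemma jac_primary : primary jac.
Proof.
have := c0; have := @c12 1 isT; have := @c12 2 isT.
by rewrite /primary /jac /= => h1 h2 h3; apply/andP; split; lia.
Qed.

Section Values.
Variables (L : fieldType) (w : L).
Hypothesis wp : 3.-primitive_root w.
Definition cchar (t : F) : L := if t == 0 then 0 else w ^+ cubic_index t.

Lemma cchar0 : cchar 0 = 0. Proof. by rewrite /cchar eqxx. Qed.
Lemma ccharM : {morph cchar : t u / t * u}.
Proof.
move=> t u; rewrite /cchar mulf_eq0.
have [->|t0] := eqVneq t 0; first by rewrite /= mul0r.
have [->|u0] := eqVneq u 0; first by rewrite /= mulr0.
by rewrite -exprD -(prim_expr_mod wp) cubic_indexM // (prim_expr_mod wp).
Qed.
Lemma cchar3 t : t != 0 -> cchar t ^+ 3 = 1.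
Proof. by move=> t0; rewrite /cchar (negbTE t0) exprAC (prim_expr_order wp) expr1n. Qed.
Lemma ccharz : cchar z != 1.
Proof.
by rewrite /cchar (negbTE gen_neq0) cidxz expr1 cube_root_neq1.
Qed.
Lemma cchar_cube t : t != 0 -> t ^+ n3 = 1 -> cchar t = 1.
Proof. by move=> t0 e; rewrite /cchar (negbTE t0) /cubic_index e eqxx expr0. Qed.

Lemma jacobi_sum_jac : jacobi_sum cchar cchar = - ev w jac.
Proof.
have -> : jacobi_sum cchar cchar = \sum_(t in S) w ^+ m t.
  rewrite /jacobi_sum [RHS]big_mkcond; apply: eq_bigr => t _.
  rewrite /cchar inE subr_eq0 [1 == t]eq_sym.
  case: eqP => _; first by rewrite mul0r.
  case: eqP => _; first by rewrite mulr0.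
  by rewrite -exprD /= -(prim_expr_mod wp).
have E t : w ^+ m t = (m t == 0%N)%:R + (m t == 1%N)%:R * w + (m t == 2)%:R * w ^+ 2.
  have : (m t < 3)%N by rewrite ltn_mod.
  by case: (m t) => [|[|[|//]]] _ /=; rewrite ?mul0r ?mul1r ?add0r ?addr0 ?expr0 ?expr1.
have C j : \sum_(t in S) (m t == j)%:R = (c j)%:R :> L.
  rewrite /c -sum1_card natr_sum big_mkcond [RHS]big_mkcond; apply: eq_bigr => t _.
  by rewrite [in RHS]finset.in_set; case: (t \in S) => //=; case: (m t == j).
rewrite (eq_bigr _ (fun t _ => E t)) !big_split /= -!mulr_suml !C.
rewrite /ev /jac /= !rmorphB /=.
have := cube_root_sum wp => h.
have -> : w ^+ 2 = (w ^+ 2 + w + 1) - w - 1 by ring.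
rewrite h -!pmulrn; ring.
Qed.
End Values.
End CubicIndex.

(** * Cubic reciprocity for Jacobi sums *)

Definition cexp q := ((q ^ 2).-1 %/ 3)%N.

Lemma cexpE q : (q %% 3 != 0)%N -> (q ^ 2 = (cexp q * 3).+1)%N.
Proof. by move=> /sqr_mod3[k Ek]; rewrite /cexp Ek /= mulKn // mulnC. Qed.

Lemma cexp_even q : odd q -> (q %% 3 != 0)%N -> exists h, (cexp q = h.*2)%N.
Proof.
move=> q_odd q3; exists (cexp q)./2; rewrite -[LHS]odd_double_half.
suff -> : odd (cexp q) = false by [].
have := cexpE q3; move/(congr1 odd); rewrite oddX q_odd /= oddM andbT.
by case: (odd _).
Qed.

(** The cubic residue character modulo q, with values in L. If y is the conjugate of
    x, then N(x) x is x^2 y. The factor N(x) makes the value at x y trivial, so that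
    the definition has the same form whether q splits or stays prime. *)
Definition cub (L : fieldType) (q : nat) (w : L) (x : eis) : L :=
  ((enorm x)%:~R * ev w x) ^+ cexp q.

(** The Jacobi sum J for s. Its norm s is computed in characteristic 0, and its
    power in a field of characteristic q that also contains s-th roots of unity.
    Both evaluations of (s J)^((q^2 - 1) / 3) are 1 there, which is a congruence
    modulo q of Eisenstein integers, and so passes to the given field L. *)
Lemma jacobi_exists s : prime s -> (s %% 3 = 1)%N ->
  exists pi, [/\ primary pi, enorm pi = s%:Z &
    forall q (L : fieldType) (w : L), 3.-primitive_root w -> q \in [pchar L] ->
      odd q -> (q %% 3 != 0)%N -> q != s -> (q ^ (s.-1 %/ 3) = 1 %[mod s])%N ->
      cub q w pi = 1].
Proof.
move=> s_pr s3; have [z] := finField_prim_root 'F_s; rewrite card_Fp // => zp; pose J := jac z.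
have JP : primary J := jac_primary s_pr s3 zp.
have JN : enorm J = s%:Z.
  have [w wp] := C_prim_root_exists (isT : (0 < 3)%N).
  have [zeta zetap] := C_prim_root_exists (prime_gt0 s_pr).
  have w2p := prim_root2 wp.
  have sL : s%:R != 0 :> algC by rewrite pnatr_eq0 -lt0n prime_gt0.
  have z0 := gen_neq0 s_pr zp.
  have := jacobi_norm s_pr zetap (cchar0 z w) (ccharM s_pr s3 zp wp) (cchar3 z wp) z0 (ccharz s_pr s3 zp wp) sL.
  have E2 t : cchar z w t ^+ 2 = cchar z (w ^+ 2) t.
    by rewrite /cchar; case: eqP; rewrite ?expr0n // exprAC.
  have -> : jacobi_sum (fun t => cchar z w t ^+ 2) (fun t => cchar z w t ^+ 2) =
            jacobi_sum (cchar z (w ^+ 2)) (cchar z (w ^+ 2)).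
    by apply: eq_bigr => t _; rewrite !E2.
  rewrite !jacobi_sum_jac // mulrNN ev_conj // -evM // emul_conj ev_int => /eqP.
  by rewrite -[s%:R]/(s%:Z%:~R) eqr_int => /eqP.
exists J; split=> // q L w wp qL q_odd q3 qs qs1.
have q_pr := pcharf_prime qL.
have co : coprime q (3 * s).
  by rewrite coprimeMr !prime_coprime // !dvdn_prime2 // qs andbT; apply: contraNneq q3 => ->.
have n0 : (0 < 3 * s)%N by rewrite muln_gt0 (prime_gt0 s_pr).
have [K [y [qK yp]]] := prime_power_field q_pr n0 co.
have [h Eh] := cexp_even q_odd q3.
pose X := epow (emul (eint s%:Z) J) (cexp q).
have evX (M : fieldType) (u : M) : 3.-primitive_root u -> ev u X = cub q u J.
  by move=> up; rewrite ev_pow // evM // ev_int /cub JN.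
have key (u : K) : 3.-primitive_root u -> ev u X = 1.
  move=> up; have zetap : s.-primitive_root (y ^+ 3).
    by have := dvdn_prim_root yp (dvdn_mull 3 (dvdnn s)); rewrite mulnK ?prime_gt0.
  have z0 := gen_neq0 s_pr zp.
  have := jacobi_expr s_pr zetap (cchar0 z u) (ccharM s_pr s3 zp up) (cchar3 z up) z0
    (ccharz s_pr s3 zp up) qK qs q3.
  rewrite jacobi_sum_jac // -/(cexp q) cchar_cube //; last 2 first.
  - by rewrite -(dvdn_pcharf (pchar_Fp s_pr)) dvdn_prime2 // eq_sym.
  - by rewrite -natrX -(Fp_nat_mod s_pr) qs1 (Fp_nat_mod s_pr).
  by rewrite mulrN Eh -mul2n !exprM sqrrN -!exprM mul2n -Eh evX // /cub JN.
have dv : edvdp q (X.1 - 1, X.2).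
  have wK : 3.-primitive_root (y ^+ s).
    by have := dvdn_prim_root yp (dvdn_mulr s (dvdnn 3)); rewrite mulKn.
  have evB (u : K) : ev u (X.1 - 1, X.2) = ev u X - 1.
    by rewrite /ev /= rmorphB /= addrAC.
  by apply: (ev_edvdp wK qK); rewrite evB key ?subrr //; apply: prim_root2.
have := edvdp_ev w qL dv; rewrite /ev /= rmorphB /= addrAC => /eqP.
by rewrite subr_eq0 -/(ev w X) evX // => /eqP.
Qed.

(** * The cubic residue character *)

Section CubicResidue.
Variables (L : fieldType) (q : nat) (w : L).
Hypothesis wp : 3.-primitive_root w.
Hypothesis qL : q \in [pchar L].
Hypothesis q_odd : odd q.
Hypothesis q3 : (q %% 3 != 0)%N.
Local Notation cubw := (cub q w).
Let q_pr : prime q := pcharf_prime qL.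

Lemma enorm_ev x : (enorm x)%:~R = ev w x * ev (w ^+ 2) x.
Proof. by rewrite ev_conj // -evM // emul_conj ev_int. Qed.

Lemma frob_int (n : int) : n%:~R ^+ q = n%:~R :> L.
Proof. by rewrite -(pFrobenius_autE qL) rmorph_int. Qed.

Lemma frob_ev (u : L) x : ev u x ^+ q = ev (u ^+ q) x.
Proof.
rewrite /ev -(pFrobenius_autE qL) rmorphD rmorphM /= !rmorph_int.
by rewrite pFrobenius_autE.
Qed.

Lemma cexp_gt0 : (0 < cexp q)%N.
Proof. by have := cexpE q3; have := prime_gt1 q_pr; case: (cexp q) => //; nia. Qed.

Lemma cubM x y : cubw (emul x y) = cubw x * cubw y.
Proof. by rewrite /cub enormM evM // rmorphM /= mulrACA exprMn. Qed.

Lemma cub0 x : (q%:Z %| enorm x)%Z -> cubw x = 0.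
Proof.
by rewrite (dvdz_pcharf qL) /cub => /eqP ->; rewrite mul0r expr0n gtn_eqF ?cexp_gt0.
Qed.

Lemma cub_period x y : (q%:Z %| x.1 - y.1)%Z -> (q%:Z %| x.2 - y.2)%Z -> cubw x = cubw y.
Proof.
rewrite !(dvdz_pcharf qL) !rmorphB /= !subr_eq0 => /eqP e1 /eqP e2.
by rewrite /cub !enorm_ev /ev e1 e2.
Qed.

Let q2_ev x : ev w x ^+ (q ^ 2) = ev w x.
Proof.
rewrite expnS expn1 exprM !frob_ev -exprM mulnn cexpE // exprS mulnC exprM.
by rewrite (prim_expr_order wp) expr1n mulr1.
Qed.

Lemma cub3 x : ~~ (q%:Z %| enorm x)%Z -> cubw x ^+ 3 = 1.
Proof.
rewrite (dvdz_pcharf qL) => N0; rewrite -exprM.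
have e0 : ev w x != 0 by apply: contraNneq N0 => e; rewrite enorm_ev e mul0r.
have y0 : (enorm x)%:~R * ev w x != 0 by rewrite mulf_neq0.
apply: (mulfI y0); rewrite -exprS -cexpE // mulr1 exprMn q2_ev; congr (_ * _).
by rewrite expnS expn1 exprM !frob_int.
Qed.

Lemma cub_conj x : ~~ (q%:Z %| enorm x)%Z -> cubw x * cubw (econj x) = 1.
Proof.
move=> nd; rewrite /cub -exprMn mulrACA -evM // emul_conj ev_int enorm_conj.
move: nd; rewrite (dvdz_pcharf qL); move: (enorm x) => n n0.
rewrite -!expr2 -exprSr -exprM mulnC; apply: (mulfI n0); rewrite -exprS -cexpE // mulr1.
by rewrite expnS expn1 exprM !frob_int.
Qed.

Lemma cub_int n : ~~ (q%:Z %| n)%Z -> cubw (eint n) = 1.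
Proof.
rewrite (dvdz_pcharf qL) => n0; rewrite /cub enorm_int ev_int rmorphXn /=.
rewrite -exprSr -exprM mulnC; apply: (mulfI n0); rewrite -exprS -cexpE // mulr1.
by rewrite expnS expn1 exprM !frob_int.
Qed.

Let wq : w ^+ q = w ^+ (q %% 3).
Proof. by rewrite (prim_expr_mod wp). Qed.

(** Suppose the character is trivial at x + w for all x in F_q for which it does not
    vanish, hence also at the conjugates. Then z = (x + w) / (x + w^2) satisfies
    z^((q^2 - 1) / 3) = 1. As the Frobenius map fixes or inverts z, the exponent can
    be lowered to 2 (q - 1) / 3 or 2 (q + 1) / 3; but there are at least q - 2,
    respectively q, values of z, which is more when q > 4. *)
Lemma cub_nontrivial : (4 < q)%N ->
  exists x : nat, ~~ (q%:Z %| enorm (x%:Z, 1))%Z /\ cubw (x%:Z, 1) != 1.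
Proof.
move=> q4.
pose good (x : nat) := (x%:R + w != 0) && (x%:R + w ^+ 2 != 0).
have NE (x : nat) : (enorm (x%:Z, 1))%:~R = (x%:R + w) * (x%:R + w ^+ 2) :> L.
  by rewrite enorm_ev /ev /= !mul1r -!pmulrn.
have goodP x : good x = ~~ (q%:Z %| enorm (x%:Z, 1))%Z.
  by rewrite (dvdz_pcharf qL) NE mulf_eq0 negb_or.
have [/hasP[x _ /andP[gx cx]]|] := boolP (has (fun x => good x && (cubw (x%:Z, 1) != 1)) (iota 0 q)).
  by exists x; rewrite -goodP.
move/hasPn => all1; exfalso.
have cub1 x : (x < q)%N -> good x -> cubw (x%:Z, 1) = 1.
  move=> xq gx; have /(all1 x) : x \in iota 0 q by rewrite mem_iota.
  by rewrite gx /= negbK => /eqP.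
pose zz (x : nat) := (x%:R + w) / (x%:R + w ^+ 2).
have zz1 x : (x < q)%N -> good x -> zz x ^+ cexp q = 1.
  move=> xq gx; have c1 := cub1 x xq gx; have [gx1 gx2] := andP gx.
  have c2 : cubw (econj (x%:Z, 1)) = 1.
    by have := @cub_conj (x%:Z, 1); rewrite -goodP c1 mul1r; exact.
  move: c1 c2; rewrite /cub enorm_conj NE -ev_conj // /ev /= !mul1r -!pmulrn => c1 c2.
  have -> : zz x = (x%:R + w) * (x%:R + w ^+ 2) * (x%:R + w) /
                  ((x%:R + w) * (x%:R + w ^+ 2) * (x%:R + w ^+ 2)).
    by rewrite /zz; field; rewrite gx1 gx2.
  by rewrite exprMn exprVn c1 c2 invr1 mulr1.
have charI x y : (x < q)%N -> (y < q)%N -> x%:R = y%:R :> L -> x = y.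
  wlog xy : x y / (x <= y)%N.
    by move=> W xq yq e; case: (leqP x y) => h; [apply: W | apply/esym/W => //; exact: ltnW].
  move=> xq yq /eqP; rewrite eq_sym -subr_eq0 -natrB // -(dvdn_pcharf qL) => d.
  by have [h|/dvdn_leq/(_ d)] := posnP (y - x); lia.
have w2w : w ^+ 2 - w != 0.
  by rewrite -[X in _ - X]expr1 subr_eq0 (eq_prim_root_expr wp).
have inj x y : (x < q)%N -> (y < q)%N -> good x -> good y -> zz x = zz y -> x = y.
  move=> xq yq /andP[_ gx] /andP[_ gy] e; apply: charI => //; apply/eqP.
  have : (x%:R - y%:R) * (w ^+ 2 - w) == 0.
    have -> : (x%:R - y%:R) * (w ^+ 2 - w) =
      (zz x - zz y) * (x%:R + w ^+ 2) * (y%:R + w ^+ 2).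
      by rewrite /zz; field; rewrite gx gy.
    by rewrite e subrr !mul0r.
  by rewrite mulf_eq0 (negbTE w2w) orbF subr_eq0.
have roots n : (0 < n)%N -> (forall x, (x < q)%N -> good x -> zz x ^+ n = 1) ->
    (count good (iota 0 q) <= n)%N.
  move=> n0 zzn; rewrite -size_filter -(size_map zz); apply: max_unity_roots n0 _ _.
    apply/allP => _ /mapP[x + ->]; rewrite mem_filter mem_iota /= => /andP[gx xq].
    by rewrite unity_rootE zzn.
  rewrite map_inj_in_uniq ?filter_uniq ?iota_uniq // => x y.
  by rewrite !mem_filter !mem_iota /= => /andP[gx xq] /andP[gy yq]; apply: inj.
have frob_nat (x : nat) : x%:R ^+ q = x%:R :> L by exact: (frob_int x%:Z).
have frobD (a b : L) : (a + b) ^+ q = a ^+ q + b ^+ q.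
  by rewrite -!(pFrobenius_autE qL) rmorphD.
have zzq x : zz x ^+ q = (x%:R + w ^+ q) / (x%:R + (w ^+ q) ^+ 2).
  by rewrite /zz exprMn exprVn !frobD frob_nat [(w ^+ 2) ^+ q]exprAC.
have w4 : (w ^+ 2) ^+ 2 = w by rewrite -exprM exprS (prim_expr_order wp) mulr1.
have Ee := cexpE q3; have Eq := divn_eq q 3; set a := (q %/ 3)%N in Eq.
have : (q %% 3 = 1 \/ q %% 3 = 2)%N by lia.
case=> h; rewrite h in Eq.
  have wE : w ^+ q = w by rewrite wq h.
  have z0 x : good x -> zz x != 0 by case/andP => h1 h2; rewrite mulf_neq0 // invr_eq0.
  have le2a : (count good (iota 0 q) <= a * 2)%N.
    apply: roots => [|x xq gx]; first by lia.
    have e2 : zz x ^+ q.+1 = zz x ^+ 2 by rewrite exprS zzq wE -/(zz x).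
    rewrite mulnC exprM -e2 -exprM -[RHS](zz1 x xq gx); congr (_ ^+ _).
    by apply/eqP; rewrite -(eqn_pmul2r (isT : 0 < 3)%N) -eqSS -Ee; apply/eqP; rewrite Eq; ring.
  have bad : (count (predC good) (iota 0 q) <= 2)%N.
    rewrite -size_filter -(size_map (fun x => x%:R : L)).
    apply: (@uniq_leq_size _ _ [:: - w; - w ^+ 2]).
      rewrite map_inj_in_uniq ?filter_uniq ?iota_uniq // => x y.
      by rewrite !mem_filter !mem_iota /= => /andP[_ xq] /andP[_ yq]; apply: charI.
    move=> _ /mapP[x + ->]; rewrite mem_filter /= /good negb_and !negbK => /andP[+ _].
    by rewrite !addr_eq0 !inE.
  have := count_predC good (iota 0 q); rewrite size_iota; lia.
have wE : w ^+ q = w ^+ 2 by rewrite wq h.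
have allgood x : good x.
  have F : (x%:R + w) ^+ q = x%:R + w ^+ 2 by rewrite frobD frob_nat wE.
  have G : (x%:R + w ^+ 2) ^+ q = x%:R + w.
    by rewrite frobD frob_nat [(w ^+ 2) ^+ q]exprAC wE w4.
  have q0 : (q == 0)%N = false by lia.
  apply/andP; split; apply/negP => /eqP e.
    move: F; rewrite e expr0n q0 => /esym e'.
    by case/negP: w2w; apply/eqP; rewrite -[w ^+ 2](addrK x%:R) -[X in _ - X](addrK x%:R) ![_ + x%:R]addrC e e' subrr.
  move: G; rewrite e expr0n q0 => /esym e'.
  by case/negP: w2w; apply/eqP; rewrite -[w ^+ 2](addrK x%:R) -[X in _ - X](addrK x%:R) ![_ + x%:R]addrC e e' subrr.
have le2a : (count good (iota 0 q) <= a.+1 * 2)%N.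
  apply: roots => // x xq gx; have [g1 g2] := andP gx.
  have e2 : zz x ^+ q * zz x = 1.
    by rewrite zzq wE w4 /zz; field; rewrite g1 g2.
  have e3 : zz x ^+ (q.-1) * zz x ^+ 2 = 1 by rewrite -exprD addn2 prednK ?prime_gt0 // exprSr.
  have : (zz x ^+ (q.-1) * zz x ^+ 2) ^+ a.+1 = 1 by rewrite e3 expr1n.
  rewrite exprMn -!exprM [(2 * _)%N]mulnC (_ : q.-1 * a.+1 = cexp q)%N ?zz1 ?mul1r //.
  apply/eqP; rewrite -(eqn_pmul2r (isT : 0 < 3)%N) -eqSS -Ee; apply/eqP; rewrite Eq.
  by rewrite addn2 /=; ring.
have : all good (iota 0 q) by apply/allP => x _.
by rewrite all_count size_iota => /eqP e; rewrite e in le2a; lia.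
Qed.
End CubicResidue.

(** * Complex valued cubic residue characters *)

(** The prime pi(s) must not depend on q, since two moduli q and r are used with the
    same s. *)
Definition jacobi_primes (pi : nat -> eis) := forall s, prime s -> (s %% 3 = 1)%N ->
  [/\ primary (pi s), enorm (pi s) = s%:Z &
    forall q (L : fieldType) (w : L), 3.-primitive_root w -> q \in [pchar L] ->
      odd q -> (q %% 3 != 0)%N -> q != s -> (q ^ (s.-1 %/ 3) = 1 %[mod s])%N ->
      cub q w (pi s) = 1].

Lemma jacobi_primes_exist : exists pi, jacobi_primes pi.
Proof.
have H s : exists y, prime s -> (s %% 3 = 1)%N ->
  [/\ primary y, enorm y = s%:Z &
    forall q (L : fieldType) (w : L), 3.-primitive_root w -> q \in [pchar L] ->
      odd q -> (q %% 3 != 0)%N -> q != s -> (q ^ (s.-1 %/ 3) = 1 %[mod s])%N ->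
      cub q w y = 1].
  have [s_pr|h] := boolP (prime s); last by exists (0, 0).
  have [/eqP s3|/eqP h] := boolP (s %% 3 == 1)%N; last by exists (0, 0).
  by have [y Hy] := jacobi_exists s_pr s3; exists y.
by have [pi Hpi] := boolp.choice H; exists pi.
Qed.

Section CubicLift.
Variables (R : realType) (L : fieldType) (w : L) (z : R[i]).
Hypothesis wp : 3.-primitive_root w.
Hypothesis zp : 3.-primitive_root z.

(** The isomorphism between the cube roots of unity of L and of R[i], extended by 0. *)
Definition clift (y : L) : R[i] :=
  if y == 1 then 1 else if y == w then z else if y == w ^+ 2 then z ^+ 2 else 0.

Lemma cliftX k : clift (w ^+ k) = z ^+ k.
Proof.
rewrite -(prim_expr_mod wp) -(prim_expr_mod zp).
have : (k %% 3 < 3)%N by rewrite ltn_mod.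
case: (k %% 3)%N => [|[|[|//]]] _; rewrite /clift ?expr0 ?expr1.
- by rewrite eqxx.
- by rewrite (negbTE (cube_root_neq1 wp)) eqxx.
have -> : (w ^+ 2 == 1) = false by rewrite -(prim_order_dvd wp).
have -> : (w ^+ 2 == w) = false by rewrite -[X in _ == X]expr1 (eq_prim_root_expr wp).
by rewrite eqxx.
Qed.

Lemma clift0 : clift 0 = 0.
Proof.
have w0 : w != 0.
  by apply/eqP => e; have := prim_expr_order wp; rewrite e expr0n => /eqP; rewrite eq_sym oner_eq0.
rewrite /clift eq_sym oner_eq0 [0 == w]eq_sym (negbTE w0) eq_sym expf_eq0 /=.
by rewrite (negbTE w0).
Qed.

Lemma cube_rootP (y : L) : y ^+ 3 = 1 -> exists k, y = w ^+ k.
Proof. by move=> y3; have [k ->] := prim_rootP wp y3; exists k. Qed.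

Lemma cliftM y1 y2 : y1 = 0 \/ y1 ^+ 3 = 1 -> y2 = 0 \/ y2 ^+ 3 = 1 ->
  clift (y1 * y2) = clift y1 * clift y2.
Proof.
case=> [->|/cube_rootP[k ->]]; first by rewrite mul0r clift0 mul0r.
case=> [->|/cube_rootP[l ->]]; first by rewrite mulr0 clift0 mulr0.
by rewrite -exprD !cliftX exprD.
Qed.

Lemma clift3 y : y ^+ 3 = 1 -> clift y ^+ 3 = 1.
Proof. by case/cube_rootP=> k ->; rewrite cliftX exprAC (prim_expr_order zp) expr1n. Qed.

Lemma clift_eq1 y : y ^+ 3 = 1 -> (clift y == 1) = (y == 1).
Proof. by case/cube_rootP=> k ->; rewrite cliftX -(prim_order_dvd zp) -(prim_order_dvd wp). Qed.
End CubicLift.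

(** What the analytic argument uses of the cubic residue character modulo q. The last
    field is cubic reciprocity: a cube modulo s is seen by the character at pi(s). *)
Record cres (R : realType) (pi : nat -> eis) (q : nat) (psi : eis -> R[i]) : Prop := CRes {
  cresM : forall x y, psi (emul x y) = psi x * psi y;
  cres_period : forall x y, (q%:Z %| x.1 - y.1)%Z -> (q%:Z %| x.2 - y.2)%Z -> psi x = psi y;
  cres0 : forall x, (q%:Z %| enorm x)%Z -> psi x = 0;
  cres3 : forall x, ~~ (q%:Z %| enorm x)%Z -> psi x ^+ 3 = 1;
  cres_conj : forall x, ~~ (q%:Z %| enorm x)%Z -> psi x * psi (econj x) = 1;
  cres_int : forall n, ~~ (q%:Z %| n)%Z -> psi (eint n) = 1;
  cres_nontrivial : exists2 x, ~~ (q%:Z %| enorm x)%Z & psi x != 1;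
  cres_recip : forall s, prime s -> (s %% 3 = 1)%N -> q != s ->
    (q ^ (s.-1 %/ 3) = 1 %[mod s])%N -> psi (pi s) = 1
}.

Lemma cres_exists (R : realType) pi q : jacobi_primes pi -> prime q -> (4 < q)%N ->
  exists psi : eis -> R[i], cres pi q psi.
Proof.
move=> Hpi q_pr q4.
have q_odd : odd q by case: (even_prime q_pr) => // e; rewrite e in q4.
have q3 : (q %% 3 != 0)%N.
  by apply/negP => h; have : (3 %| q)%N := h; rewrite dvdn_prime2 //; lia.
have co : coprime q 3 by rewrite prime_coprime // dvdn_prime2 //; lia.
have [L [w [qL wp]]] := prime_power_field q_pr (isT : 0 < 3)%N co.
have [z zp] := @primitive_root_exists R 3 isT.
have cubP x : cub q w x = 0 \/ cub q w x ^+ 3 = 1.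
  have [d|nd] := boolP (q%:Z %| enorm x)%Z; first by left; apply: cub0.
  by right; apply: cub3.
exists (fun x => clift w z (cub q w x)); split=> [x y|x y h1 h2|x d|x nd|x nd|n nd||s s_pr s3 qs e].
- by rewrite cubM // (cliftM wp zp).
- by rewrite (cub_period wp qL h1 h2).
- by rewrite cub0 // (clift0 _ wp).
- by apply: (clift3 wp zp); apply: cub3.
- by rewrite -(cliftM wp zp) // cub_conj // -(expr0 w) (cliftX wp zp).
- by rewrite cub_int // -(expr0 w) (cliftX wp zp).
- have [x [nd x1]] := cub_nontrivial wp qL q_odd q3 q4.
  by exists (x%:Z, 1) => //; rewrite (clift_eq1 wp zp) // cub3.
have [_ _ h] := Hpi s s_pr s3.
by rewrite h // -(expr0 w) (cliftX wp zp).
Qed.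

(** * Sums over rational primes *)

Section PrimeSums.
Variables (R : realType) (lg : logarithm R).

Lemma vm_prime p : prime p -> vm lg p = lg p.
Proof. by move=> p_pr; rewrite /vm ppf_prime. Qed.

Lemma Psum_dchar W psi : (1 < W)%N -> dchar W psi -> nonprincipal W psi -> bounded (Psum lg psi).
Proof.
move=> W1 ch np; have HE := Echar_bounded lg W1 ch np.
have := @prime_powers_bounded R lg (fun n => psi n * (vm lg n)%:C%C) 1 ler01.
case=> [n|Kp HK].
  by rewrite nrmM nrmR ger0_norm ?vm_ge0 // ler_wpM2r ?vm_ge0 // (dchar_le1 _ ch).
have Hpp : bounded (fun x => psum (fun n => psi n * (vm lg n)%:C%C / n%:R) x
   - \sum_(1 <= p < x.+1 | prime p) psi p * (vm lg p)%:C%C / p%:R) by exists Kp.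
apply: eq_bounded (boundedD HE (boundedM (-1) Hpp)) => x _.
rewrite /Echar mulN1r opprB addrC subrK; apply: eq_bigr => p p_pr.
by rewrite vm_prime // rmorphM fmorphV rmorph_nat mulrA.
Qed.

Lemma Psum_one : bounded (fun x => Psum lg (fun _ => 1) x - (lg x)%:C%C).
Proof.
exists 40 => x x0; have /andP[m1 m2] := mertens lg x0.
have -> : Psum lg (fun _ => 1) x = (\sum_(1 <= p < x.+1 | prime p) vm lg p / p%:R)%:C%C.
  rewrite rmorph_sum; apply: eq_bigr => p p_pr; by rewrite mul1r vm_prime.
rewrite -rmorphB nrmR.
have E : psum (fun n => vm lg n / n%:R) x = \sum_(1 <= p < x.+1 | prime p) vm lg p / p%:R +
   \sum_(1 <= p < x.+1 | ~~ prime p) vm lg p / p%:R by rewrite /psum (bigID prime).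
have := sum_vm_nonprime lg x.
have : 0 <= \sum_(1 <= p < x.+1 | ~~ prime p) vm lg p / p%:R.
  by apply: sumr_ge0 => n _; rewrite divr_ge0 ?vm_ge0.
rewrite E in m1 m2; move: m1 m2; move: (\sum_(_ <= _ < _ | prime _) _) => s1.
move: (\sum_(_ <= _ < _ | _) _) => s2 m1 m2 h1 h2.
by rewrite ler_norml; apply/andP; split; lra.
Qed.

Lemma eq_Psum (f g : nat -> R[i]) x : (forall p, prime p -> (p <= x)%N -> f p = g p) ->
  Psum lg f x = Psum lg g x.
Proof.
move=> E; rewrite /Psum big_nat_cond [RHS]big_nat_cond; apply: eq_bigr => p.
by case/andP=> /andP[_ px] p_pr; rewrite E.
Qed.

Lemma PsumD (f g : nat -> R[i]) x : Psum lg (fun p => f p + g p) x = Psum lg f x + Psum lg g x.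
Proof. by rewrite /Psum -big_split; apply: eq_bigr => p _; rewrite mulrDl. Qed.

Lemma PsumZ c (f : nat -> R[i]) x : Psum lg (fun p => c * f p) x = c * Psum lg f x.
Proof. by rewrite /Psum mulr_sumr; apply: eq_bigr => p _; rewrite mulrA. Qed.

Lemma Psum_sum (I : Type) (r : seq I) (P : pred I) (f : I -> nat -> R[i]) x :
  Psum lg (fun p => \sum_(i <- r | P i) f i p) x = \sum_(i <- r | P i) Psum lg (f i) x.
Proof. by rewrite /Psum exchange_big; apply: eq_bigr => p _; rewrite mulr_suml. Qed.

Lemma Re_Psum (f : nat -> R[i]) x :
  complex.Re (Psum lg f x) = \sum_(1 <= p < x.+1 | prime p) complex.Re (f p) * (lg p / p%:R).
Proof.
rewrite /Psum; elim/big_rec2: _ => [//|p y1 y2 _ <-].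
by rewrite ReD mulrC Re_scale mulrC.
Qed.

(** Add the sums of the trivial and of the nontrivial character modulo 3. *)
Lemma split_primes : exists C, forall x, (0 < x)%N ->
  \sum_(1 <= p < x.+1 | prime p) (p %% 3 == 1)%N%:R * (lg p / p%:R) <= lg x / 2 + C.
Proof.
pose psi (n : nat) : R[i] := (n %% 3 == 1)%N%:R - (n %% 3 == 2)%N%:R.
have co3 n : coprime 3 n = (n %% 3 != 0)%N by rewrite prime_coprime.
have ch : dchar 3 psi.
  split=> [|m n|n|n|n].
  - by rewrite /psi subr0.
  - rewrite /psi -modnMm.
    have : (m %% 3 < 3)%N by rewrite ltn_mod. have : (n %% 3 < 3)%N by rewrite ltn_mod.
    case: (m %% 3)%N => [|[|[|//]]]; case: (n %% 3)%N => [|[|[|//]]] _ _ /=;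
      rewrite ?subr0 ?sub0r ?mul0r ?mulr0 ?mulr1 ?mul1r ?mulrN1 ?opprK //.
  - by rewrite /psi modnDr.
  - by rewrite co3 negbK /psi => /eqP ->; rewrite subrr.
  rewrite co3 /psi; have : (n %% 3 < 3)%N by rewrite ltn_mod.
  by case: (n %% 3)%N => [|[|[|//]]] //= _ _; rewrite ?subr0 ?sub0r ?nrmN nrm1.
have np : nonprincipal 3 psi.
  exists 2%N => //; have -> : psi 2%N = -1 by rewrite /psi /= sub0r.
  by rewrite eq_sym -addr_eq0 -(natrD _ 1 1) pnatr_eq0.
have [K1 K10 HK1] := bounded_ge0 (Psum_dchar (isT : 1 < 3)%N ch np).
have [K2 K20 HK2] := bounded_ge0 Psum_one.
exists (K1 + K2) => x x0.
have h1 := le_trans (Re_le_nrm _) (HK1 x x0).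
have h2 := le_trans (Re_le_nrm _) (HK2 x x0).
have E : \sum_(1 <= p < x.+1 | prime p) (p %% 3 == 1)%N%:R * (lg p / p%:R) * 2 <=
  complex.Re (Psum lg psi x) + complex.Re (Psum lg (fun _ => 1) x).
  rewrite !Re_Psum -big_split /= big_nat_cond [leRHS]big_nat_cond; apply: ler_sum => p.
  case/andP=> /andP[p0 _] _; rewrite -mulrDl mulrAC ler_wpM2r ?divr_ge0 ?lg_ge0 //.
  rewrite /psi; have : (p %% 3 < 3)%N by rewrite ltn_mod.
  by case: (p %% 3)%N => [|[|[|//]]] //= _; lra.
move: E; rewrite -mulr_suml; move: h2.
rewrite -[Psum _ _ _ - _]/(Psum lg (fun _ => 1) x + - (lg x)%:C%C) -rmorphN ReD Re_inj.
lra.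
Qed.
End PrimeSums.

(** * Sums of Hecke characters over split primes *)

Definition eqe (F : nat) (x y : eis) := (F%:Z %| x.1 - y.1)%Z && (F%:Z %| x.2 - y.2)%Z.

Lemma eqe_mul F z x y : eqe F x y -> eqe F (emul z x) (emul z y).
Proof.
case/andP=> h1 h2; apply/andP; split=> /=.
  have -> : z.1 * x.1 - z.2 * x.2 - (z.1 * y.1 - z.2 * y.2) =
    z.1 * (x.1 - y.1) - z.2 * (x.2 - y.2) by ring.
  by rewrite rpredB // dvdz_mull.
have -> : z.1 * x.2 + z.2 * x.1 - z.2 * x.2 - (z.1 * y.2 + z.2 * y.1 - z.2 * y.2) =
  z.1 * (x.2 - y.2) + z.2 * (x.1 - y.1) - z.2 * (x.2 - y.2) by ring.
by rewrite rpredB ?rpredD // dvdz_mull.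
Qed.

Lemma eqe_sym F x y : eqe F x y -> eqe F y x.
Proof. by case/andP=> h1 h2; apply/andP; split; rewrite -opprB rpredN. Qed.

Lemma eqe_trans F x y z : eqe F x y -> eqe F y z -> eqe F x z.
Proof.
case/andP=> h1 h2 /andP[h3 h4]; apply/andP; split.
  by rewrite -(subrK y.1 x.1) -addrA rpredD.
by rewrite -(subrK y.2 x.2) -addrA rpredD.
Qed.

Lemma eqe_primary F x y : (3 %| F)%N -> eqe F x y -> primary x = primary y.
Proof.
move=> F3 /andP[h1 h2].
have d1 : (3 %| x.1 - y.1)%Z by apply: dvdz_trans h1.
have d2 : (3 %| x.2 - y.2)%Z by apply: dvdz_trans h2.
rewrite /primary; congr (_ && _).
  by rewrite -(subrK y.1 x.1) -addrA rpredDl.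
by rewrite -(subrK y.2 x.2) rpredDl.
Qed.

(** Multiplicative functions on Eisenstein integers modulo F. On primary elements they
    are characters of ideals; the element in the last field makes the character sum
    over primary residues vanish, and its norm 1 gives it an inverse, namely the
    conjugate. *)
Record hecke (R : realType) (F : nat) (chi : eis -> R[i]) : Prop := Hecke {
  hecke1 : chi (eint 1) = 1;
  heckeM : forall x y, chi (emul x y) = chi x * chi y;
  hecke01 : forall x, chi x = 0 \/ nrm (chi x) = 1;
  hecke_period : forall x y, eqe F x y -> chi x = chi y;
  hecke_nontrivial : exists x, [/\ primary x, (F%:Z %| enorm x - 1)%Z & chi x != 1]
}.

Section Hecke.
Variables (R : realType) (F : nat).
Hypothesis F0 : (0 < F)%N.
Hypothesis F3 : (3 %| F)%N.
Local Notation rho := (rho R).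

Lemma hecke_le1 (chi : eis -> R[i]) x : hecke F chi -> nrm (chi x) <= 1.
Proof. by move=> ch; case: (hecke01 ch x) => ->; rewrite ?nrm0. Qed.

Let emb (t : 'I_F * 'I_F) : eis := ((t.1 : nat)%:Z, (t.2 : nat)%:Z).

Let red_lt (z : int) : (absz (z %% F%:Z)%Z < F)%N.
Proof. have := @ltz_pmod z F%:Z; have := @modz_ge0 z F%:Z; lia. Qed.

Let red (x : eis) : 'I_F * 'I_F := (Ordinal (red_lt x.1), Ordinal (red_lt x.2)).

Let emb_red x : eqe F (emb (red x)) x.
Proof.
have H (z : int) : (F%:Z %| (absz (z %% F%:Z)%Z)%:Z - z)%Z.
  have -> : (absz (z %% F%:Z)%Z)%:Z = (z %% F%:Z)%Z by have := @modz_ge0 z F%:Z; lia.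
  by rewrite -eqz_mod_dvd modz_mod.
by rewrite /eqe !H.
Qed.

Let emb_inj t u : eqe F (emb t) (emb u) -> t = u.
Proof.
have H (i j : 'I_F) : (F%:Z %| i%:Z - j%:Z)%Z -> i = j.
  by rewrite -eqz_mod_dvd !modz_nat !modn_small // => /eqP[]; exact: val_inj.
by case/andP => /H e1 /H e2; case: t u e1 e2 => [a b] [c d] /= -> ->.
Qed.

(** Multiplication by y permutes the primary residues modulo F. *)
Lemma hecke_sum0 (chi : eis -> R[i]) : hecke F chi ->
  \sum_(0 <= i < F) \sum_(0 <= j < F | primary (i%:Z, j%:Z)) chi (i%:Z, j%:Z) = 0.
Proof.
move=> ch; have [y [yP yN y1]] := hecke_nontrivial ch.
rewrite big_mkord; under eq_bigr => i _ do rewrite big_mkord.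
rewrite pair_big_dep /= (eq_bigl (fun t => primary (emb t))) //.
set T := \sum_(_ | _) _.
pose mu t := red (emul y (emb t)).
have mu_emb t : eqe F (emb (mu t)) (emul y (emb t)) by apply: emb_red.
have inv t : eqe F (emul (econj y) (emul y (emb t))) (emb t).
  have H z : (F%:Z %| enorm y * z - z)%Z.
    by rewrite -[X in _ - X]mul1r -mulrBl dvdz_mulr.
  by rewrite emulA [emul (econj y) y]emulC emul_conj emul_int /eqe !H.
have mu_inj : injective mu.
  move=> t u e; apply: emb_inj.
  apply: eqe_trans (eqe_sym (inv t)) _; apply: eqe_trans _ (inv u).
  by apply: eqe_mul; apply: eqe_trans (eqe_sym (mu_emb t)) _; rewrite e.
have E : T = chi y * T.
  rewrite {1}/T (reindex_inj mu_inj) /= mulr_sumr; apply: eq_big => t.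
    rewrite (eqe_primary F3 (mu_emb t)); apply/idP/idP => [|h]; last exact: primaryM.
    exact: primary_cancel.
  by move=> _; rewrite (hecke_period ch (mu_emb t)) (heckeM ch).
apply/eqP; have : (1 - chi y) * T == 0 by rewrite mulrBl mul1r -E subrr.
by rewrite mulf_eq0 subr_eq0 eq_sym (negbTE y1).
Qed.

Variables (lg : logarithm R) (pi : nat -> eis).
Hypothesis pi_prim : forall p, prime p -> (p %% 3 = 1)%N -> primary (pi p).
Hypothesis pi_norm : forall p, prime p -> (p %% 3 = 1)%N -> enorm (pi p) = p%:Z.

Definition split_trace (chi : eis -> R[i]) p : R[i] :=
  if (p %% 3 == 1)%N then chi (pi p) + chi (econj (pi p)) else 0.

(** Euler factors of the number of primary elements of norm n. They dominate the
    coefficients of the inverse Euler product for any chi. *)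
Let count_loc (p k : nat) : R :=
  if (p %% 3 == 1)%N then hsym 1 1 k
  else if (p %% 3 == 2)%N then hsym 1 (-1) k else hsym 0 0 k.

Let count_sum x : psum (multf count_loc) x <= 25 * x%:R.
Proof.
case: x => [|x]; first by rewrite psum0 mulr0.
apply: le_trans (psum_count R (ltn0Sn x)); rewrite le_eqVlt; apply/orP; left; apply/eqP.
apply: eq_big_nat => n /andP[n0 _].
pose u p : R := if (p %% 3 == 0)%N then 0 else 1.
pose v p : R := if (p %% 3 == 1)%N then 1 else if (p %% 3 == 2)%N then -1 else 0.
rewrite (@rep_multf R (fun _ => 1) pi u v) //.
- apply: eq_multf => p k _ _; rewrite /count_loc /u /v.
  have : (p %% 3 < 3)%N by rewrite ltn_mod.
  by case: (p %% 3)%N => [|[|[|//]]].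
- by move=> ? ?; rewrite mulr1.
- by move=> p _ h; rewrite /u /v h.
- by move=> p _ h; rewrite /u /v h /= subrr mul1r.
- by move=> p _ h; rewrite /u /v h.
Qed.

(** At an inert prime p the Euler factor 1 / (1 - chi(-p) T^2) comes from the pair
    eta, - eta with eta^2 = chi(-p). Its trace is 0, so only split primes enter. *)
Lemma hecke_dichotomy chi : hecke F chi -> bounded (Psum lg (split_trace chi)) \/
  bounded (fun x => Psum lg (split_trace chi) x + (lg x)%:C%C).
Proof.
move=> ch.
pose eta (p : nat) := sqrtC (chi (eint (- p%:Z))).
have eta2 p : eta p ^+ 2 = chi (eint (- p%:Z)) by rewrite sqrtCK.
have eta1 p : nrm (eta p) <= 1.
  have := hecke_le1 (eint (- p%:Z)) ch; rewrite -eta2 nrmX.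
  by rewrite expr_le1 ?nrm_ge0.
pose u p := if (p %% 3 == 1)%N then chi (pi p) else if (p %% 3 == 2)%N then eta p else 0.
pose v p := if (p %% 3 == 1)%N then chi (econj (pi p)) else if (p %% 3 == 2)%N then - eta p else 0.
have m3 p : (p %% 3 < 3)%N by rewrite ltn_mod.
have uv p : u p + v p = split_trace chi p.
  by rewrite /u /v /split_trace; case: (p %% 3)%N (m3 p) => [|[|[|//]]] _ //=; rewrite ?addr0 ?subrr.
have := @euler_dichotomy R lg u v count_loc (20 * F%:R + 25).
have F20 : 0 <= 20 * F%:R :> R by rewrite mulr_ge0.
case.
- by move=> p; rewrite /u; case: ifP => _; [exact: hecke_le1 | case: ifP => _; rewrite ?nrm0].
- by move=> p; rewrite /v; case: ifP => _; [exact: hecke_le1 | case: ifP => _; rewrite ?nrm0 ?nrmN].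
- by move=> p; rewrite /count_loc !hsym0 !if_same.
- move=> p _; rewrite uv /split_trace /count_loc; case: ifP => _.
    by rewrite hsym1; apply: le_trans (nrmD _ _) _; apply: lerD; apply: hecke_le1.
  by rewrite nrm0; case: ifP => _; rewrite hsym1 ?subrr ?addr0.
- move=> p _; rewrite /u /v /count_loc !hsym2; case: ifP => _.
    rewrite nrmM; have := hecke_le1 (pi p) ch; have := hecke_le1 (econj (pi p)) ch.
    move=> h1 h2; apply: (@le_trans _ _ (1 * 1)); first by apply: ler_pM; rewrite ?nrm_ge0.
    by lra.
  case: ifP => _; last by rewrite !mul0r nrm0 addr0 expr0n subr0.
  rewrite mulrN nrmN nrmM subrr expr0n mulrN1 opprK add0r.
  by rewrite -[leRHS](mul1r 1) ler_pM ?nrm_ge0.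
- move=> p k; rewrite /count_loc; case: ifP => _.
    by apply: sumr_ge0 => i _; rewrite !expr1n mulr1.
  case: ifP => _; last by apply: sumr_ge0 => i _; rewrite mulr_ge0 ?exprn_ge0.
  suff [] : 0 <= hsym (1 : R) (-1) k /\ 0 <= hsym (1 : R) (-1) k.+1 by [].
  elim: k => [|k [h1 h2]]; first by rewrite hsym0 hsym1 subrr.
  split=> //; rewrite hsym_rec subrr mul0r mul1r mulN1r opprK add0r //.
- move=> x; apply: le_trans (count_sum x) _; rewrite ler_wpM2r //; lra.
- case=> [|x]; first by rewrite psum0 nrm0 mulr_ge0 ?exprn_ge0 ?rho_ge0 ?addr_ge0.
  rewrite (_ : psum _ _ = psum (rep chi) x.+1); last first.
    apply: eq_big_nat => n /andP[n0 _]; rewrite (@rep_multf _ chi pi u v) //.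
    + exact: hecke1 ch.
    + exact: heckeM ch.
    + by move=> p _ h; rewrite /u /v h.
    + by move=> p _ h; rewrite /u /v h /= subrr mulrN -expr2 eta2.
    + by move=> p _ h; rewrite /u /v h.
  apply: (@le_trans _ _ (20 * F%:R * rho x.+1 ^+ 2)).
    have per a b a' b' : (F%:Z %| a - a')%Z -> (F%:Z %| b - b')%Z -> chi (a, b) = chi (a', b').
      by move=> h1 h2; apply: (hecke_period ch); rewrite /eqe h1 h2.
    have dF (z : int) : (F%:Z %| z + F%:Z - z)%Z by rewrite addrAC subrr add0r.
    have d0 (z : int) : (F%:Z %| z - z)%Z by rewrite subrr.
    apply: psum_rep_bound => //.
    + by move=> y; apply: hecke_le1.
    + by move=> a b; apply: per; rewrite ?dF ?d0.
    + by move=> a b; apply: per; rewrite ?dF ?d0.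
    + exact: hecke_sum0.
  by rewrite ler_wpM2r ?exprn_ge0 ?rho_ge0 // lerDl.
- by move=> H; left; apply: eq_bounded H => x _; apply: eq_Psum => p _ _.
by move=> H; right; apply: eq_bounded H => x _; congr (_ + _); apply: eq_Psum => p _ _.
Qed.

(** Suppose the sum over split primes followed - lg x. Each split prime contributes
    two character values and half of the primes split, so 3-4-1 gives
    12 (lg x) / 2 - 8 lg x + O(1) >= 0; the term of chi^2 is bounded above in both
    cases of its dichotomy. *)
Lemma hecke_bounded chi : hecke F chi -> hecke F (fun x => chi x ^+ 2) ->
  bounded (Psum lg (split_trace chi)).
Proof.
move=> ch ch2; have [//|pole] := hecke_dichotomy ch.
have [K1 K10 HK1] := bounded_ge0 pole.
have [C HC] := split_primes lg.
have [K2 K20 HK2] : exists2 K2, 0 <= K2 & forall x, (0 < x)%N ->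
    complex.Re (Psum lg (split_trace (fun x => chi x ^+ 2)) x) <= K2.
  case: (hecke_dichotomy ch2) => /bounded_ge0[K2 K20 HK2]; exists K2 => // x x0.
    exact: le_trans (Re_le_nrm _) (HK2 x x0).
  have := le_trans (Re_le_nrm _) (HK2 x x0); rewrite ReD Re_inj.
  have := lg_ge0 lg x0; lra.
have [x x0 Hx] := lg_unbounded lg (12 * C + 8 * K1 + 2 * K2).
have h1 := le_trans (Re_le_nrm _) (HK1 x x0); rewrite ReD Re_inj in h1.
have h2 := HK2 x x0; have h3 := HC x x0.
have : 0 <= 12 * (\sum_(1 <= p < x.+1 | prime p) (p %% 3 == 1)%N%:R * (lg p / p%:R)) +
  8 * complex.Re (Psum lg (split_trace chi) x) +
  2 * complex.Re (Psum lg (split_trace (fun x => chi x ^+ 2)) x).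
  rewrite !Re_Psum !mulr_sumr -!big_split /= big_nat_cond; apply: sumr_ge0 => p.
  case/andP=> /andP[p0 _] _; rewrite !mulrA -!mulrDl mulr_ge0 ?invr_ge0 // mulr_ge0 ?lg_ge0 //.
  rewrite /split_trace; case: (p %% 3 == 1)%N; last by rewrite /= !mulr0 !addr0.
  have f1 := three_four_one (hecke01 ch (pi p)).
  have f2 := three_four_one (hecke01 ch (econj (pi p))).
  rewrite !ReD mulr1; lra.
move=> h4; exfalso.
have final (s a b l k1 k2 k3 : R) : 12 * k3 + 8 * k1 + 2 * k2 < l -> a + l <= k1 -> b <= k2 ->
  s <= l / 2 + k3 -> 0 <= 12 * s + 8 * a + 2 * b -> 0 <= l -> False by lra.
exact: (final _ _ _ _ _ _ _ Hx h1 h2 h3 h4 (lg_ge0 lg x0)).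
Qed.
End Hecke.

(** * Hecke characters built from cubic residues *)

Section MorePrimeSums.
Variables (R : realType) (lg : logarithm R).

Lemma Psum_finite (f : nat -> R[i]) B : (forall p, prime p -> (B <= p)%N -> f p = 0) ->
  bounded (Psum lg f).
Proof.
move=> f0; exists (\sum_(1 <= p < B) nrm (f p * (lg p / p%:R)%:C%C)) => x x0.
apply: le_trans (nrm_sum _ _ _) _.
pose G p := if (p < B)%N && prime p then nrm (f p * (lg p / p%:R)%:C%C) else 0.
have G0 p : 0 <= G p by rewrite /G; case: ifP => // _; apply: nrm_ge0.
have E m n : (\sum_(m <= p < n | prime p) nrm (f p * (lg p / p%:R)%:C%C) = \sum_(m <= p < n) G p).
  rewrite big_mkcond; apply: eq_bigr => p _; rewrite /G.
  case: (ltnP p B) => //= h; case: ifP => // p_pr.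
  by rewrite f0 // mul0r nrm0.
rewrite E; apply: (@le_trans _ _ (\sum_(1 <= p < maxn x.+1 B) G p)).
  rewrite (big_cat_nat (n := x.+1) (p := maxn x.+1 B)) ?leq_maxl //= lerDl.
  by apply: sumr_ge0 => p _.
have tail m n : (B <= m)%N -> \sum_(m <= p < n) G p = 0.
  move=> Bm; rewrite big_nat big1 // => p /andP[mp _].
  by rewrite /G ltnNge (leq_trans Bm mp).
have GE : \sum_(1 <= p < B) G p <= \sum_(1 <= p < B) nrm (f p * (lg p / p%:R)%:C%C).
  by apply: ler_sum => p _; rewrite /G; case: ifP => // _; apply: nrm_ge0.
have [h|h] := leqP B 1; first by rewrite tail // sumr_ge0 // => p _; apply: nrm_ge0.
apply: le_trans GE; rewrite [leLHS](big_cat_nat (n := B)) ?leq_maxr ?(ltnW h) //=.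
by rewrite (tail B) // addr0.
Qed.

(** psi differs from 1 only at the primes dividing W. *)
Lemma Psum_principal W psi : (0 < W)%N -> dchar W psi -> (forall n, coprime W n -> psi n = 1) ->
  bounded (fun x => Psum lg psi x - (lg x)%:C%C).
Proof.
move=> W0 ch psi1.
have H : bounded (Psum lg (fun p => psi p - 1)).
  apply: (@Psum_finite _ W.+1) => p p_pr pW; rewrite psi1 ?subrr // coprime_sym prime_coprime //.
  by apply/negP => /(dvdn_leq W0); lia.
apply: eq_bounded (boundedD H (Psum_one lg)) => x x0.
rewrite -[X in _ = X - _](_ : Psum lg (fun p => (psi p - 1) + 1) x = _).
  by rewrite (PsumD lg (fun p => psi p - 1) (fun _ => 1)); ring.
by apply: eq_Psum => p _ _; rewrite subrK.
Qed.
End MorePrimeSums.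

Lemma eqe_norm F x y : eqe F x y -> (F%:Z %| enorm x - enorm y)%Z.
Proof.
case/andP=> h1 h2.
have -> : enorm x - enorm y = (x.1 - y.1) * (x.1 + y.1 - x.2) +
   (x.2 - y.2) * (x.2 + y.2 - y.1) by rewrite /enorm; ring.
by rewrite rpredD // dvdz_mulr.
Qed.

Lemma eqe_dvd F G x y : (F %| G)%N -> eqe G x y -> eqe F x y.
Proof. by move=> FG /andP[h1 h2]; apply/andP; split; [apply: dvdz_trans h1|apply: dvdz_trans h2]. Qed.

Section CubicCharacters.
Variables (R : realType) (pi : nat -> eis) (W q r : nat) (psiq psir : eis -> R[i]).
Hypothesis W3 : (3 %| W)%N.
Hypothesis W0 : (0 < W)%N.
Hypothesis q_pr : prime q.
Hypothesis r_pr : prime r.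
Hypothesis qr : q != r.
Hypothesis q4 : (4 < q)%N.
Hypothesis r4 : (4 < r)%N.
Hypothesis qW : (q %| W)%N.
Hypothesis rW : (r %| W)%N.
Hypothesis coq : coprime q (W %/ q).
Hypothesis cor : coprime r (W %/ r).
Hypothesis Hq : cres pi q psiq.
Hypothesis Hr : cres pi r psir.

(** Take g with psi(g) <> 1. Then g^2 divided by its norm has norm 1 modulo l, and
    psi does not see the rational factor; the Chinese remainder theorem makes the
    element 1 modulo W / l. *)
Let special l (psi : eis -> R[i]) : prime l -> (4 < l)%N -> (l %| W)%N -> coprime l (W %/ l) ->
  cres pi l psi ->
  exists x, [/\ primary x, (W%:Z %| enorm x - 1)%Z, eqe (W %/ l) x (eint 1) & psi x != 1].
Proof.
move=> l_pr l4 lW col Hl; have [g ng g1] := cres_nontrivial Hl.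
have cg : coprime l (absz (enorm g)) by rewrite prime_coprime.
have [u [v uv]] : exists u v : int, u * l%:Z + v * enorm g = 1.
  have [u [v E]] := Bezoutz l%:Z (enorm g); exists u, v; rewrite E /gcdz.
  by move: cg; rewrite /coprime => /eqP /= ->.
have [a [b ab]] : exists a b : int, a * l%:Z + b * (W %/ l)%:Z = 1.
  have [a [b E]] := Bezoutz l%:Z (W %/ l)%:Z; exists a, b; rewrite E /gcdz.
  by move: col; rewrite /coprime => /eqP /= ->.
pose y := emul (eint v) (emul g g).
have nv : ~~ (l%:Z %| v)%Z.
  apply/negP => h; have : (l%:Z %| u * l%:Z + v * enorm g)%Z by apply: rpredD; [apply: dvdz_mull | apply: dvdz_mulr].
  by rewrite uv dvdz1 => h1; lia.
have y1 : psi y != 1.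
  rewrite !(cresM Hl) (cres_int Hl nv) mul1r; apply: contraNneq g1 => e.
  by have := cres3 Hl ng; rewrite !exprS expr0 mulr1 e mulr1 => ->.
have Ny : (l%:Z %| enorm y - 1)%Z.
  rewrite !enormM enorm_int.
  have -> : v ^+ 2 * (enorm g * enorm g) - 1 = - (u * (v * enorm g + 1)) * l%:Z.
    have -> : v ^+ 2 * (enorm g * enorm g) - 1 = (v * enorm g - 1) * (v * enorm g + 1) by ring.
    have -> : v * enorm g - 1 = - (u * l%:Z) by rewrite -[X in _ - X]uv; ring.
    ring.
  by rewrite dvdz_mull.
pose e := b * (W %/ l)%:Z.
have e1 : (l%:Z %| e - 1)%Z.
  have -> : e - 1 = - a * l%:Z by rewrite -ab /e; ring.
  by rewrite dvdz_mull.
pose x : eis := (1 + e * (y.1 - 1), e * y.2).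
have xy : eqe l x y.
  rewrite /eqe /x /=.
  have -> : 1 + e * (y.1 - 1) - y.1 = (e - 1) * (y.1 - 1) by ring.
  have -> : e * y.2 - y.2 = (e - 1) * y.2 by ring.
  by rewrite !dvdz_mulr.
have x1 : eqe (W %/ l) x (eint 1).
  rewrite /eqe /x /=.
  have -> : 1 + e * (y.1 - 1) - 1 = (b * (y.1 - 1)) * (W %/ l)%:Z by rewrite /e; ring.
  have -> : e * y.2 - 0 = (b * y.2) * (W %/ l)%:Z by rewrite /e; ring.
  by rewrite !dvdz_mull.
have Vl3 : (3 %| W %/ l)%N.
  have : (3 %| W %/ l * l)%N by rewrite divnK.
  by rewrite Gauss_dvdl // prime_coprime // dvdn_prime2 //; case: eqP l4 => // <-.
exists x; split=> //.
- by rewrite (eqe_primary Vl3 x1).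
- rewrite -(divnK lW) PoszM Gauss_dvdz; last by rewrite coprimezE /= coprime_sym.
  apply/andP; split; first by have := eqe_norm x1.
  have := eqe_norm xy => h; rewrite -(subrK (enorm y) (enorm x)) -addrA.
  by rewrite rpredD.
by have /andP[h1 h2] := xy; rewrite (cres_period Hl h1 h2).
Qed.

Definition cchi (psi : nat -> R[i]) i j (x : eis) : R[i] :=
  psi (absz (enorm x)) * psiq x ^+ i * psir x ^+ j.

Lemma cchi_hecke psi i j : dchar W psi -> ((i %% 3 != 0) || (j %% 3 != 0))%N ->
  hecke W (cchi psi i j).
Proof.
move=> ch ij.
have n1 l : prime l -> ~~ (l%:Z %| 1)%Z by move=> l_pr; rewrite dvdz1; have := prime_gt1 l_pr; lia.
have nrm3 (z : R[i]) k : z ^+ 3 = 1 -> nrm (z ^+ k) = 1.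
  by move=> z3; rewrite nrmX (@nrm_unity_root _ 3) ?expr1n.
split=> [|x y|x|x y xy|].
- by rewrite /cchi enorm_int expr1n /= (dchar1 ch) (cres_int Hq) ?n1 // (cres_int Hr) ?n1 // !expr1n !mulr1.
- rewrite /cchi enormM abszM (dcharM ch) (cresM Hq) (cresM Hr) !exprMn; ring.
- rewrite /cchi; have [co|nco] := boolP (coprime W (absz (enorm x))); last first.
    by left; rewrite (dchar0 ch) // !mul0r.
  right; have nd l : prime l -> (l %| W)%N -> ~~ (l%:Z %| enorm x)%Z.
    move=> l_pr lW; have := coprime_dvdl lW co; rewrite prime_coprime //.
  by rewrite !nrmM (dchar_nrm ch) // !nrm3 ?mulr1 ?(cres3 Hq) ?(cres3 Hr) ?nd.
- have /andP[a1 a2] := eqe_dvd qW xy; have /andP[b1 b2] := eqe_dvd rW xy.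
  rewrite /cchi (cres_period Hq a1 a2) (cres_period Hr b1 b2); congr (_ * _ * _).
  rewrite -(dchar_mod (absz (enorm x)) ch) -(dchar_mod (absz (enorm y)) ch); congr psi.
  have := eqe_norm xy; rewrite -eqz_mod_dvd => /eqP.
  have Ex : enorm x = (absz (enorm x))%:Z by rewrite gez0_abs // enorm_ge0.
  have Ey : enorm y = (absz (enorm y))%:Z by rewrite gez0_abs // enorm_ge0.
  by rewrite {1}Ex {1}Ey !modz_nat => -[].
have psiN1 x : (W%:Z %| enorm x - 1)%Z -> psi (absz (enorm x)) = 1.
  move=> h; rewrite -(dchar_mod (absz (enorm x)) ch) -(dchar1 ch) -(dchar_mod 1 ch); congr psi.
  move: h; rewrite -eqz_mod_dvd => /eqP.
  have Ex : enorm x = (absz (enorm x))%:Z by rewrite gez0_abs // enorm_ge0.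
  by rewrite {1}Ex -[X in _ = (X %% _)%Z -> _]/(1%N%:Z) !modz_nat => -[].
have dvdV l m : prime l -> prime m -> l != m -> (l %| W)%N -> (m %| W)%N -> (l %| W %/ m)%N.
  move=> l_pr m_pr lm lW mW; have : (l %| W %/ m * m)%N by rewrite divnK.
  by rewrite Gauss_dvdl // prime_coprime // dvdn_prime2.
case/orP: ij => h.
  have [x [xP xN xV x1]] := special q_pr q4 qW coq Hq; exists x; split=> //.
  have rq : r != q by rewrite eq_sym.
  have /andP[a1 a2] := eqe_dvd (dvdV r q r_pr q_pr rq rW qW) xV.
  rewrite /cchi psiN1 // (cres_period Hr a1 a2) (cres_int Hr) ?n1 // expr1n mulr1 mul1r.
  apply: pow_cube_root_neq1 => //; apply: (cres3 Hq).
  apply/negP => d; have : (q%:Z %| enorm x - 1)%Z by apply: dvdz_trans xN.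
  by rewrite rpredBl //; apply/negP/n1.
have [x [xP xN xV x1]] := special r_pr r4 rW cor Hr; exists x; split=> //.
have /andP[a1 a2] := eqe_dvd (dvdV q r q_pr r_pr qr qW rW) xV.
rewrite /cchi psiN1 // (cres_period Hq a1 a2) (cres_int Hq) ?n1 // expr1n !mul1r.
apply: pow_cube_root_neq1 => //; apply: (cres3 Hr).
apply/negP => d; have : (r%:Z %| enorm x - 1)%Z by apply: dvdz_trans xN.
by rewrite rpredBl //; apply/negP/n1.
Qed.
End CubicCharacters.

(** * Primes with prescribed cubic nonresidues *)

Lemma double_mod3 k : (k %% 3 != 0 -> (k * 2) %% 3 != 0)%N.
Proof. lia. Qed.

(** Weight the primes p = 1 modulo 3 by g(pi) + g(pi'), for pi and pi' the two primary
    primes above p, where g = (2 - psi_q - psi_q^2) (2 - psi_r - psi_r^2): a factor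
    vanishes where the cubic character is 1. Restrict to p = A modulo W by summing
    over the Dirichlet characters modulo W. The total f p vanishes for large p unless
    p is a prime as required. On the other hand the expansion of f involves the
    Hecke characters psi(N) psi_q^i psi_r^j. Those with (i, j) <> (0, 0) contribute
    O(1), and so do the nonprincipal psi with (i, j) = (0, 0); the principal psi
    contributes 8 lg x. *)
Lemma primes_with_cubic_nonresidues (R : realType) (lg : logarithm R) (W A q r : nat) :
  (0 < W)%N -> (3 %| W)%N -> prime q -> prime r -> q != r -> (4 < q)%N -> (4 < r)%N ->
  (q %| W)%N -> (r %| W)%N -> coprime q (W %/ q) -> coprime r (W %/ r) ->
  coprime W A -> (A %% 3 = 1)%N ->
  forall B, exists s, [/\ prime s, (B < s)%N, (s = A %[mod W])%N,
    (q ^ (s.-1 %/ 3) <> 1 %[mod s])%N & (r ^ (s.-1 %/ 3) <> 1 %[mod s])%N].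
Proof.
move=> W0 W3 q_pr r_pr qr q4 r4 qW rW coq cor coA A3 B; apply: contrapT => none.
have W1 : (1 < W)%N by have := dvdn_leq W0 W3; lia.
have [pi Hpi] := jacobi_primes_exist.
have [psiq Hq] := cres_exists R Hpi q_pr q4.
have [psir Hr] := cres_exists R Hpi r_pr r4.
have N0 : (0 < 2 * #|[set: {unit 'Z_W}]|)%N by rewrite muln_gt0 cardG_gt0.
have [zeta zetaP] := primitive_root_exists R N0.
pose ch := @charW R W zeta.
have chP h : homb h -> dchar W (ch h) by apply: charW_dchar.
pose A' := (A ^ (totient W).-1)%N.
have HA' : (A' * A = 1 %[mod W])%N.
  by rewrite /A' -expnSr prednK ?totient_gt0 // Euler_exp_totient // coprime_sym.
have coA' : coprime W A' by rewrite coprimeXr.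
have A'_inv p : (A' * p = 1 %[mod W])%N -> (p = A %[mod W])%N.
  move=> e; rewrite -[p]mul1n -modnMml -HA' modnMml -mulnA [(A * p)%N]mulnC mulnA.
  by rewrite -modnMml e modnMml mul1n.
pose c (i : nat) : R[i] := if i == 0%N then 2 else -1.
pose g (x : eis) := (2 - psiq x - psiq x ^+ 2) * (2 - psir x - psir x ^+ 2).
pose X (t : 'I_3 * 'I_3) x := c t.1 * c t.2 * (psiq x ^+ t.1 * psir x ^+ t.2).
pose t0 : 'I_3 * 'I_3 := (ord0, ord0).
have gE x : g x = 4 + \sum_(t | t != t0) X t x.
  have -> : g x = \sum_t X t x.
    rewrite -(pair_bigA _ (fun i j => X (i, j) x)) /=.
    by rewrite !big_ord_recl !big_ord0 /X /= /bump /= /c /= !expr0 !expr1 /g; ring.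
  rewrite (bigD1 t0) //=; congr (_ + _).
  by rewrite /X /c /= !expr0; ring.
pose S h t := split_trace pi (cchi psiq psir (ch h) (t : 'I_3 * 'I_3).1 t.2).
(* The term 8 ch h p stands for (i, j) = (0, 0), as p = A modulo W forces p to be
   1 modulo 3. *)
pose f p := \sum_(h | homb h) ch h A' *
  (8 * ch h p + \sum_(t | t != t0) c t.1 * c t.2 * S h t p).
have fE p : prime p -> f p = if (A' * p == 1 %[mod W])%N
   then (if (p %% 3 == 1)%N then g (pi p) + g (econj (pi p)) else 8) * #|@homb W|%:R else 0.
  move=> p_pr; rewrite -[RHS](_ : (if (p %% 3 == 1)%N then g (pi p) + g (econj (pi p)) else 8) *
    \sum_(h | homb h) ch h (A' * p)%N = _); last first.
    by rewrite /ch (charW_sum W1 zetaP); case: eqP => _; case: eqP => _; rewrite ?mulr0.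
  rewrite mulr_sumr; apply: eq_bigr => h Hh; rewrite (dcharM (chP h Hh)) mulrCA; congr (_ * _).
  rewrite /S /split_trace; case: eqP => p3; last first.
    by rewrite big1 ?addr0 // => t _; rewrite mulr0.
  have [_ Np _] := Hpi p p_pr p3; rewrite !gE.
  have -> : \sum_(t | t != t0) c t.1 * c t.2 *
      (cchi psiq psir (ch h) t.1 t.2 (pi p) + cchi psiq psir (ch h) t.1 t.2 (econj (pi p))) =
    (\sum_(t | t != t0) X t (pi p) + \sum_(t | t != t0) X t (econj (pi p))) * ch h p.
    rewrite -big_split mulr_suml /=; apply: eq_bigr => t _.
    by rewrite /cchi enorm_conj Np /X /=; ring.
  ring.
have f0 p : prime p -> (maxn q (maxn r B) < p)%N -> f p = 0.
  move=> p_pr; rewrite !gtn_max => /and3P[qp rp Bp]; rewrite fE //; case: eqP => // /A'_inv pA.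
  have p3 : (p %% 3 = 1)%N by have := modn_dvdm p W3; rewrite pA modn_dvdm // A3.
  rewrite p3 eqxx; have [_ Np _] := Hpi p p_pr p3.
  have triv l (psi : eis -> R[i]) : prime l -> (l < p)%N -> cres pi l psi ->
    (l ^ (p.-1 %/ 3) = 1 %[mod p])%N -> psi (pi p) = 1 /\ psi (econj (pi p)) = 1.
    move=> l_pr lp Hl e; have lNp : l != p by rewrite neq_ltn lp.
    have psi1 := cres_recip Hl p_pr p3 lNp e; split=> //.
    have := cres_conj Hl (x := pi p); rewrite Np psi1 mul1r; apply.
    by rewrite -[(_ %| _)%Z]/(l %| p)%N dvdn_prime2.
  have [e|e] := pselect (q ^ (p.-1 %/ 3) = 1 %[mod p])%N.
    have [h1 h2] := triv q psiq q_pr qp Hq e.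
    by rewrite /g h1 h2; ring.
  have [e'|e'] := pselect (r ^ (p.-1 %/ 3) = 1 %[mod p])%N.
    have [h1 h2] := triv r psir r_pr rp Hr e'.
    by rewrite /g h1 h2; ring.
  by case: none; exists p.
have fb : bounded (Psum lg f) by apply: (Psum_finite lg f0).
pose e (h : {ffun {unit 'Z_W} -> 'Z_(2 * #|[set: {unit 'Z_W}]|)}) : nat :=
  `[< forall n, coprime W n -> ch h n = 1 >].
have fx x : Psum lg f x = \sum_(h | homb h) ch h A' *
  (8 * Psum lg (ch h) x + \sum_(t | t != t0) c t.1 * c t.2 * Psum lg (S h t) x).
  rewrite /f Psum_sum; apply: eq_bigr => h _.
  rewrite (PsumZ lg (ch h A')); congr (_ * _).
  rewrite (PsumD lg (fun p => 8 * ch h p)) PsumZ Psum_sum; congr (_ + _).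
  by apply: eq_bigr => t _; rewrite (PsumZ lg (c t.1 * c t.2)).
have hb h : homb h -> bounded (fun x => ch h A' *
  (8 * Psum lg (ch h) x + \sum_(t | t != t0) c t.1 * c t.2 * Psum lg (S h t) x)
    - 8 * ((e h)%:R * (lg x)%:C%C)).
  move=> Hh.
  have B1 : bounded (fun x => \sum_(t | t != t0) c t.1 * c t.2 * Psum lg (S h t) x).
    apply: bounded_sum => t tt0; apply: boundedM.
    have pip p : prime p -> (p %% 3 = 1)%N -> primary (pi p) by move=> a b; case: (Hpi p a b).
    have pin p : prime p -> (p %% 3 = 1)%N -> enorm (pi p) = p%:Z by move=> a b; case: (Hpi p a b).
    have ij : ((t.1 %% 3 != 0) || (t.2 %% 3 != 0))%N.
      move: tt0; rewrite /t0 [t]surjective_pairing xpair_eqE negb_and -!val_eqE /=.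
      by rewrite !modn_small.
    have hecke_t psi i j : dchar W psi -> ((i %% 3 != 0) || (j %% 3 != 0))%N ->
        hecke W (cchi psiq psir psi i j).
      exact: (cchi_hecke W3 W0 q_pr r_pr qr q4 r4 qW rW coq cor Hq Hr).
    apply: (hecke_bounded W0 W3 lg pip pin); first by apply: hecke_t => //; apply: chP.
    have -> : (fun x => cchi psiq psir (ch h) t.1 t.2 x ^+ 2) =
        cchi psiq psir (fun n => ch h n * ch h n) (t.1 * 2) (t.2 * 2).
      by apply: funext => x; rewrite /cchi !exprMn !exprM expr2.
    apply: hecke_t; first by apply: dchar_mul; apply: chP.
    by case/orP: ij => /double_mod3 ->; rewrite ?orbT.
  have B2 : bounded (fun x => ch h A' * Psum lg (ch h) x - (e h)%:R * (lg x)%:C%C).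
    rewrite /e; case: asboolP => pr /=.
      have := Psum_principal lg W0 (chP h Hh) pr; apply: eq_bounded => x _.
      by rewrite pr // !mul1r.
    have np : nonprincipal W (ch h).
      apply: contrapT => np; apply: pr => n co; apply: contrapT => n1.
      by apply: np; exists n => //; apply/eqP.
    apply: eq_bounded (boundedM (ch h A') (Psum_dchar lg W1 (chP h Hh) np)) => x _.
    by rewrite mul0r subr0.
  apply: eq_bounded (boundedD (boundedM 8 B2) (boundedM (ch h A') B1)) => x _.
  ring.
have main : exists k : nat, bounded (fun x => Psum lg f x - 8 * (k.+1%:R * (lg x)%:C%C)).
  have e0 : e 0 = 1%N.
    rewrite /e; case: asboolP => // []; elim=> n co.
    by rewrite /ch /charW co ffunE expr0.
  exists (\sum_(h : {ffun {unit 'Z_W} -> 'Z_(2 * #|[set: {unit 'Z_W}]|)} | homb h && (h != 0%R)) e h)%N.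
  have := bounded_sum (index_enum _) hb.
  apply: eq_bounded => x _; rewrite fx sumrB; congr (_ - _).
  rewrite -mulr_sumr -mulr_suml; congr (_ * (_ * _)).
  by rewrite (bigD1 (0 : {ffun {unit 'Z_W} -> 'Z_(2 * #|[set: {unit 'Z_W}]|)})) ?homb0 //= e0 -[RHS]natr1 natr_sum addrC.
have [k Hk] := main; have [K K0 HK] := bounded_ge0 (boundedD fb (boundedM (-1) Hk)).
have [x x0 Hx] := lg_unbounded lg K.
have := HK x x0; rewrite mulN1r opprB addrC subrK.
have -> : 8 * (k.+1%:R * (lg x)%:C%C) = (8 * (k.+1%:R * lg x))%:C%C.
  by rewrite !rmorphM !rmorph_nat.
rewrite nrmR => /(le_trans (ler_norm _)).
have l0 := lg_ge0 lg x0; have : lg x <= k.+1%:R * lg x by rewrite ler_peMl // ler1n.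
lra.
Qed.

(** * From cubic nonresidues to quadruples *)

Definition natural_logarithm (R : realType) : logarithm R.
Proof.
have pos n : (0 < n)%N -> (n%:R : R) \is Num.pos by rewrite posrE ltr0n.
exists (fun n => ln n%:R).
- by move=> m n m0 n0; rewrite natrM lnM ?pos.
- move=> n n0; have n0' : 0 < n%:R :> R by rewrite ltr0n.
  have -> : ln n.+1%:R - ln n%:R = ln (1 + n%:R^-1) :> R.
    rewrite -ln_div ?pos //; congr ln; rewrite -natr1 mulrDl divff ?gt_eqF //.
    by rewrite mul1r.
  apply/andP; split; first by apply: ln_ge0; rewrite lerDl invr_ge0.
  by apply: le_ln1Dx; apply: lt_trans (_ : 0 < _); rewrite ?invr_gt0 // ltrN10.
- move=> n n0; rewrite -[in leLHS](rho4 R n) lnXn ?rho_gt0 // -[_ *+ 4]mulr_natl.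
  by rewrite ler_wpM2l // ltW // ln_sublinear ?rho_gt0.
move=> K; have l2 : 0 < ln 2 :> R by rewrite ln_gt0 // ltr1n.
exists (2 ^ Num.bound (`|K / ln 2|)%R)%N; first by rewrite expn_gt0.
rewrite natrX lnXn // -[_ *+ Num.bound _]mulr_natl -ltr_pdivrMr //.
by apply: le_lt_trans (ler_norm _) _; apply: archi_boundP; apply: normr_ge0.
Qed.

Lemma fermat_pow (l x k : nat) : prime l -> ~~ (l %| x)%N -> (l.-1 %| k)%N ->
  (x%:R : 'F_l) ^+ k = 1.
Proof.
move=> l_pr lx /dvdnP[j ->].
have -> : x%:R ^+ (j * l.-1) = (x ^ (j * l.-1))%:R :> 'F_l by rewrite natrX.
rewrite -(Fp_nat_mod l_pr) mulnC expnM -modnXm -(totient_prime l_pr).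
by rewrite Euler_exp_totient ?modnXm ?exp1n ?(Fp_nat_mod l_pr) // coprime_sym prime_coprime.
Qed.

(** Two primitive cube roots of unity are equal or inverse to each other. *)
Lemma cube_roots_cancel (F : fieldType) (z1 z2 : F) : z1 ^+ 3 = 1 -> z1 != 1 ->
  z2 ^+ 3 = 1 -> z2 != 1 -> exists2 j, (0 < j)%N & 1 + z1 + z2 ^+ j = 0.
Proof.
have quad (z : F) : z ^+ 3 = 1 -> z != 1 -> 1 + z + z ^+ 2 = 0.
  move=> z3 zn1; have : (z - 1) * (1 + z + z ^+ 2) == 0.
    have -> : (z - 1) * (1 + z + z ^+ 2) = z ^+ 3 - 1 by ring.
    by rewrite z3 subrr.
  by rewrite mulf_eq0 subr_eq0 (negbTE zn1) => /eqP.
move=> c1 n1 c2 n2; have q1 := quad z1 c1 n1; have q2 := quad z2 c2 n2.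
have : (z1 - z2) * (1 + z1 + z2) == 0.
  have -> : (z1 - z2) * (1 + z1 + z2) = (1 + z1 + z1 ^+ 2) - (1 + z2 + z2 ^+ 2) by ring.
  by rewrite q1 q2 subrr.
rewrite mulf_eq0 subr_eq0 => /orP[/eqP ->|/eqP h]; first by exists 2.
by exists 1%N; rewrite ?expr1.
Qed.

(** Let D = (p - 1) (q - 1) (r - 1) and write D = 3^K D' with D' prime to 3. If s is 1
    modulo 3^(K+1), then b = (s - 1) / 3 * D' is still a multiple of D, and q^b and r^b
    are primitive cube roots of unity modulo s when q and r are not cubes; so
    1 + q^b + r^(b j) = 0 for some j. Multiples of D as exponents give powers equal
    to 1 modulo p, q and r, and s = -2 then makes the sum 1 + 1 + s vanish there.
    When p = 3 the congruence s = -2 modulo p follows from s = 1 modulo 3. *)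
Lemma quadruples_away_from_3 (p q r : nat) : prime p -> prime q -> prime r -> odd p -> (4 < q)%N -> (4 < r)%N ->
  p != q -> p != r -> q != r -> forall B, exists s a b c D,
  [/\ [/\ prime s, (B < s)%N & (0 < a)%N], [/\ (0 < b)%N, (0 < c)%N & (0 < D)%N] &
   forall k, (p * q * r * s %| p ^ a + q ^ b + r ^ c + s ^ (k * D).+1)%N].
Proof.
move=> p_pr q_pr r_pr p_odd q4 r4 pq pr qr B.
have odd5 l : prime l -> (4 < l)%N -> odd l.
  by move=> l_pr l4; case: (even_prime l_pr) => // e; rewrite e in l4.
have p1 := prime_gt1 p_pr; have q1 := prime_gt1 q_pr; have r1 := prime_gt1 r_pr.
pose D := (p.-1 * q.-1 * r.-1)%N.
have D0 : (0 < D)%N by rewrite !muln_gt0 -!subn1 !subn_gt0 p1 q1.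
have [D' coD' ED] := pfactor_coprime (isT : prime 3) D0.
set K := logn 3 D in ED.
(* the residue of s modulo 3 is prescribed through m1 *)
pose P := if p == 3 then 1%N else p.
pose m1 := (3 ^ K.+1)%N; pose m2 := (P * q * r)%N.
have co3 l : prime l -> (l != 3) -> coprime m1 l.
  by move=> l_pr l3; rewrite coprimeXl // prime_coprime // dvdn_prime2 // eq_sym.
have q3 : q != 3 by case: eqP q4 => // ->.
have r3 : r != 3 by case: eqP r4 => // ->.
have coP l : prime l -> l != p -> coprime l P.
  by move=> l_pr lp; rewrite /P; case: eqP => _; rewrite ?coprimen1 // prime_coprime // dvdn_prime2.
have co12 : coprime m1 m2.
  rewrite !coprimeMr (co3 q) // (co3 r) // !andbT /P; case: eqP => [_|/eqP p3]; first exact: coprimen1.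
  exact: co3.
have m2odd : odd m2.
  by rewrite !oddM (odd5 q) // (odd5 r) // !andbT /P; case: ifP.
have m20 : (2 < m2)%N.
  have P0 : (0 < P)%N by rewrite /P; case: ifP => // _; apply: prime_gt0.
  by rewrite /m2; nia.
pose A := chinese m1 m2 1 (m2 - 2).
have A1 : (A = 1 %[mod m1])%N by apply: chinese_modl.
have A2 : (A = m2 - 2 %[mod m2])%N by apply: chinese_modr.
have coA : coprime (m1 * m2) A.
  rewrite coprimeMl -(coprime_modr m1) A1 coprime_modr coprimen1 /=.
  rewrite -coprime_modr A2 coprime_modr coprime_sym.
  rewrite -{2}(subnK (ltnW m20)) /coprime gcdnDl -/(coprime _ _) coprimen2.
  by rewrite oddB ?m2odd // ltnW.
have dq : (q %| m1 * m2)%N by rewrite /m2 dvdn_mull // dvdn_mulr // dvdn_mull.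
have dr : (r %| m1 * m2)%N by rewrite /m2 dvdn_mull // dvdn_mull.
have cq : coprime q (m1 * m2 %/ q).
  have -> : (m1 * m2 = m1 * (P * r) * q)%N by rewrite /m2; ring.
  rewrite mulnK ?prime_gt0 // !coprimeMr coprime_sym co3 //= coP 1?eq_sym //=.
  by rewrite prime_coprime // dvdn_prime2.
have cr : coprime r (m1 * m2 %/ r).
  have -> : (m1 * m2 = m1 * (P * q) * r)%N by rewrite /m2; ring.
  rewrite mulnK ?prime_gt0 // !coprimeMr coprime_sym co3 //= coP 1?eq_sym //=.
  by rewrite prime_coprime // dvdn_prime2 // eq_sym.
have A3 : (A %% 3 = 1)%N.
  by rewrite -(modn_dvdm A (_ : 3 %| m1)%N) ?A1 ?modn_dvdm // /m1 expnS dvdn_mulr.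
have W0 : (0 < m1 * m2)%N by rewrite muln_gt0 expn_gt0 (ltn_trans _ m20).
have W3 : (3 %| m1 * m2)%N by rewrite dvdn_mulr // /m1 expnS dvdn_mulr.
have [s [s_pr sB sA sq sr]] := primes_with_cubic_nonresidues (natural_logarithm Rdefinitions.R)
  W0 W3 q_pr r_pr qr q4 r4 dq dr cq cr coA A3 (maxn B (maxn p (maxn q r))).
move: sB; rewrite !gtn_max => /and4P[sB sp sq' sr'].
have s1 := prime_gt1 s_pr.
have s1m : (3 ^ K.+1 %| s.-1)%N.
  rewrite -subn1 -eqn_mod_dvd ?prime_gt0 //.
  by rewrite -(modn_dvdm s (dvdn_mulr m2 (dvdnn m1))) sA modn_dvdm ?dvdn_mulr // A1.
have s2m : (m2 %| s + 2)%N.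
  rewrite /dvdn -modnDml -(modn_dvdm s (dvdn_mull m1 (dvdnn m2))) sA modn_dvdm; last exact: dvdn_mull.
  by rewrite A2 modnDml subnK ?modnn // ltnW.
have s2 l : l \in [:: p; q; r] -> (l %| s + 2)%N.
  rewrite !inE => /or3P[]/eqP->; last 2 first.
  - by apply: (dvdn_trans _ s2m); rewrite dvdn_mulr // dvdn_mull.
  - by apply: (dvdn_trans _ s2m); rewrite dvdn_mull.
  have [p3|p3] := eqVneq p 3; last first.
    by apply: (dvdn_trans _ s2m); rewrite /m2 /P (negbTE p3) -mulnA dvdn_mulr.
  have : (3 %| s.-1)%N by apply: (dvdn_trans _ s1m); rewrite expnS dvdn_mulr.
  move=> h; have -> : (s + 2 = s.-1 + 3)%N by clear -s1; lia.
  by rewrite p3 dvdn_addl.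
pose n3 := (s.-1 %/ 3)%N.
have n3E : (s.-1 = n3 * 3)%N.
  by rewrite divnK //; apply: (dvdn_trans _ s1m); rewrite expnS dvdn_mulr.
have K3 : (3 ^ K %| n3)%N.
  by move: s1m; rewrite n3E expnS mulnC dvdn_pmul2r.
have Dn : (D %| n3 * D')%N by rewrite ED mulnC dvdn_mul.
have D'3 : (D' %% 3 != 0)%N.
  by move: coD'; rewrite prime_coprime.
have root l : prime l -> (l < s)%N -> (l ^ (s.-1 %/ 3) <> 1 %[mod s])%N ->
    ((l%:R : 'F_s) ^+ (n3 * D')) ^+ 3 = 1 /\ (l%:R : 'F_s) ^+ (n3 * D') != 1.
  move=> l_pr ls lnc.
  have c1 : ((l%:R : 'F_s) ^+ n3) ^+ 3 = 1.
    by rewrite -exprM -n3E fermat_pow // dvdn_prime2 // neq_ltn ls orbT.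
  split; first by rewrite exprM exprAC c1 expr1n.
  rewrite exprM; apply: pow_cube_root_neq1 => //.
  apply/eqP => e; apply: lnc; rewrite -!(val_Fp_nat s_pr) natrX -/n3 e.
  by [].
have [cq1 cq2] := root q q_pr sq' sq; have [cr1 cr2] := root r r_pr sr' sr.
have [j j0 ej] := cube_roots_cancel cq1 cq2 cr1 cr2.
have n30 : (0 < n3)%N by rewrite -(ltn_pmul2r (isT : 0 < 3)%N) mul0n -n3E -subn1 subn_gt0.
have D'0 : (0 < D')%N by case: (D') D'3.
exists s, (D * s.-1)%N, (n3 * D')%N, (n3 * D' * j)%N, D; split.
- by split=> //; rewrite muln_gt0 D0 -subn1 subn_gt0.
- by split=> //; rewrite !muln_gt0 n30 D'0.
move=> k.
have Fdvd l n : prime l -> (l %| n)%N = ((n%:R : 'F_l) == 0).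
  by move=> l_pr; rewrite (dvdn_pcharf (pchar_Fp l_pr)).
have dD l : l \in [:: p; q; r] -> (l.-1 %| D)%N.
  rewrite !inE => /or3P[]/eqP->.
  - by rewrite /D -mulnA dvdn_mulr.
  - by rewrite /D dvdn_mulr // dvdn_mull.
  - by rewrite /D dvdn_mull.
have sl l : l \in [:: p; q; r] -> prime l /\ l != s.
  by rewrite !inE => /or3P[]/eqP->; split=> //; rewrite neq_ltn ?sp ?sq' ?sr'.
have one l x e : l \in [:: p; q; r] -> prime x -> l != x -> (D %| e)%N ->
    (x%:R : 'F_l) ^+ e = 1.
  move=> lin x_pr lx De; have [l_pr _] := sl l lin.
  by apply: fermat_pow => //; [rewrite dvdn_prime2 | apply: dvdn_trans (dD l lin) De].
have zero l e : prime l -> (0 < e)%N -> (l%:R : 'F_l) ^+ e = 0.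
  by move=> l_pr e0; rewrite (pchar_Fp_0 l_pr) expr0n gtn_eqF.
have two l : l \in [:: p; q; r] -> 1 + 1 + (s%:R : 'F_l) ^+ (k * D).+1 = 0.
  move=> lin; have [l_pr ls] := sl l lin.
  rewrite exprS (one l s _ lin s_pr ls (dvdn_mull k (dvdnn D))) mulr1.
  have -> : 1 + 1 + (s%:R : 'F_l) = (s + 2)%:R by rewrite natrD addrC.
  apply/eqP.
  by rewrite -Fdvd // s2.
have Da : (D %| D * s.-1)%N by apply: dvdn_mulr.
have Dc : (D %| n3 * D' * j)%N by apply: dvdn_mulr.
have e0 : (0 < D * s.-1)%N by rewrite muln_gt0 D0 -subn1 subn_gt0.
have e1 : (0 < n3 * D')%N by rewrite muln_gt0 n30.
have e2 : (0 < n3 * D' * j)%N by rewrite muln_gt0 e1.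
have pin : p \in [:: p; q; r] by rewrite inE eqxx.
have qin : q \in [:: p; q; r] by rewrite !inE eqxx orbT.
have rin : r \in [:: p; q; r] by rewrite !inE eqxx !orbT.
have co l m : prime l -> prime m -> l != m -> coprime l m.
  by move=> l_pr m_pr lm; rewrite prime_coprime // dvdn_prime2.
have [[_ ps] [_ qs] [_ rs]] := And3 (sl p pin) (sl q qin) (sl r rin).
have copq := co p q p_pr q_pr pq; have copr := co p r p_pr r_pr pr.
have coqr := co q r q_pr r_pr qr; have cops := co p s p_pr s_pr ps.
have coqs := co q s q_pr s_pr qs; have cors := co r s r_pr s_pr rs.
rewrite Gauss_dvd; last by rewrite !coprimeMl cops coqs.
rewrite Gauss_dvd; last by rewrite coprimeMl copr.
rewrite Gauss_dvd // !Fdvd // !natrD !natrX.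
have qp : q != p by rewrite eq_sym.
have rp : r != p by rewrite eq_sym.
have rq : r != q by rewrite eq_sym.
rewrite -!andbA; apply/and4P; split; apply/eqP.
- by rewrite (zero p) // (one p q) // (one p r) // add0r two.
- by rewrite (one q p) // (zero q) // (one q r) // addr0 two.
- by rewrite (one r p) // (one r q) // (zero r) // addr0 two.
rewrite fermat_pow //; last 2 first.
- by rewrite dvdn_prime2 // eq_sym.
- by rewrite dvdn_mull.
by rewrite (zero s) // addr0 [r%:R ^+ _]exprM.
Qed.

(** At most one of the three primes is 3; it takes the place of p. *)
Lemma exists_quadruples (p q r : nat) : prime p -> prime q -> prime r ->
  odd p -> odd q -> odd r -> p <> q -> p <> r -> q <> r ->
  forall B, exists s a b c D,
  [/\ [/\ prime s, (B < s)%N & (0 < a)%N], [/\ (0 < b)%N, (0 < c)%N & (0 < D)%N] &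
   forall k, (p * q * r * s %| p ^ a + q ^ b + r ^ c + s ^ (k * D).+1)%N].
Proof.
move=> p_pr q_pr r_pr p_odd q_odd r_odd /eqP pq /eqP pr /eqP qr B.
have big l : prime l -> odd l -> l != 3 -> (4 < l)%N.
  by case: l => [|[|[|[|[|l]]]]].
have [q3|q3] := eqVneq q 3.
  have p3 : p != 3 by rewrite -q3.
  have r3 : r != 3 by rewrite -q3 eq_sym.
  have qp : q != p by rewrite eq_sym.
  have [s [a [b [c [D [h1 [b0 c0 D0] h]]]]]] :=
    quadruples_away_from_3 q_pr p_pr r_pr q_odd (big p p_pr p_odd p3) (big r r_pr r_odd r3) qp qr pr B.
  have [s_pr sB a0] := h1.
  exists s, b, a, c, D; split=> // k.
  by rewrite [(p * q)%N]mulnC [(p ^ b + _)%N]addnC.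
have [r3|r3] := eqVneq r 3.
  have p3 : p != 3 by rewrite -r3.
  have rp : r != p by rewrite eq_sym.
  have rq : r != q by rewrite eq_sym.
  have qp : q != p by rewrite eq_sym.
  have [s [a [b [c [D [[s_pr sB a0] [b0 c0 D0] h]]]]]] :=
    quadruples_away_from_3 r_pr q_pr p_pr r_odd (big q q_pr q_odd q3) (big p p_pr p_odd p3) rq rp qp B.
  exists s, c, b, a, D; split=> // k.
  have -> : (p * q * r = r * q * p)%N by ring.
  by rewrite [(p ^ c + _ + _)%N](_ : _ = r ^ a + q ^ b + p ^ c)%N //; ring.
have [s [a [b [c [D H]]]]] :=
  quadruples_away_from_3 p_pr q_pr r_pr p_odd (big q q_pr q_odd q3) (big r r_pr r_odd r3) pq pr qr B.
by exists s, a, b, c, D.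
Qed.

Lemma unbounded_infinite (S : set nat) : (forall B, exists2 n, (B < n)%N & S n) ->
  infinite_set S.
Proof.
move=> H /finite_seqP[t St]; have [n nB Sn] := H (\max_(i <- t) i)%N.
have nt : n \in t by rewrite St /= in Sn.
by have := leq_bigmax_seq (F := id) n nt isT; rewrite leqNgt nB.
Qed.

Local Close Scope ring_scope.
Local Open Scope classical_set_scope.
Local Open Scope nat_scope.

Theorem theorem2 (star : assumption_star) (p q r : nat)
    (p_prime : prime p) (q_prime : prime q) (r_prime : prime r)
    (p_odd : odd p) (q_odd : odd q) (r_odd : odd r)
    (neq_pq : p <> q) (neq_pr : p <> r) (neq_qr : q <> r)
    (mod8 : exists2 x : nat, x \in [:: p; q; r] &
              (x = 3 %[mod 8] \/ x = 5 %[mod 8])) :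
  infinite_set [set s : nat | prime s /\
    infinite_set [set t : nat * nat * nat * nat |
      let: (a, b, c, d) := t in
      [/\ 0 < a, 0 < b, 0 < c, 0 < d &
          p * q * r * s %| p ^ a + q ^ b + r ^ c + s ^ d]]].
Proof.
apply: unbounded_infinite => B.
have [s [a [b [c [D [[s_pr sB a0] [b0 c0 D0] H]]]]]] :=
  exists_quadruples p_prime q_prime r_prime p_odd q_odd r_odd neq_pq neq_pr neq_qr B.
exists s => //; split=> // /(finite_image snd).
apply: unbounded_infinite => k; exists (k * D).+1; first by rewrite ltnS leq_pmulr.
by exists (a, b, c, (k * D).+1).
Qed.
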